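(* Let $q\ge2$ be a fixed integer and, for each $N\in\mathbb N$, let $p_{N1}\ge p_{N2}\ge\cdots\ge 0$ with $\sum_{i\ge1}p_{Ni}=1$. Let $s_N=(\sum_i p_{Ni}^2)^{1/2}$ and $\psi_{Ni}=p_{Ni}/s_N$. Suppose $\lim_{N\to\infty}p_{N1}=0$ and $\psi_i=\lim_{N\to\infty}\psi_{Ni}$ exists for each $i\in\mathbb N$. Let $T_{Nm}$ be the time of the $m$-th collision in the $q$-color urn model with uniform color selection and urn selection distribution $(p_{Ni})_{i\ge1}$. Then for every $m\ge1$ there is convergence of $m$-dimensional distributions $$(s_NT_{N1},s_NT_{N2},\dots,s_NT_{Nm})\xrightarrow{\ \mathcal D\ }(\eta_1,\eta_2,\dots,\eta_m),$$ where $0<\eta_1<\eta_2<\cdots$ are the arrival times of a point process $\mathcal M$ which is the superposition of independent point processes $B^*,B_1^{-L_1},B_2^{-L_2},\dots$, where: (i) $B^*$ is a Poisson process on $[0,\infty)$ of rate $\left(1-\sum_i\psi_i^2\right)t\left(1-\frac1q\right)$ at time $t$; (ii) for each $i\in\mathbb N$, $B_i$ is the superposition of $q$ independent Poisson processes $\{B_i^1(t)\}_{t\ge0},\dots,\{B_i^q(t)\}_{t\ge0}$ on $[0,\infty)$, each of rate $\psi_i/q$; and $B_i^{-L_i}$ is the process $B_i$ with its first $L_i:=B_i(T_i')$ points removed, where $T_i'$ is the last arrival time in $B_i$ before $T_i=\inf\{t\ge0: B_i^a(t)>0\text{ and }B_i^b(t)>0\text{ for some }a\ne b\}$.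
   Context: Urn model (uniform color selection): there are $q$ colors $\{1,\dots,q\}$ and urns indexed by $\{1,2,\dots\}$, all initially empty. At each time $t=1,2,\dots$, independently of the past, a color $C_t\in\{1,\dots,q\}$ is chosen uniformly (probability $1/q$ each), and a ball of that color is dropped into urn $Z_{Nt}$, where $\mathbb P(Z_{Nt}=i)=p_{Ni}$ whatever the chosen color is. A collision occurs at time $t$ if $Z_{Ns}=Z_{Nt}$ and $C_s\ne C_t$ for some $s<t$. Let $K_t$ be the indicator that a collision occurs at time $t$; the $m$-th collision time is $T_{Nm}=\inf\{t\in\mathbb N:\sum_{j=1}^tK_j=m\}$. For a point process, $B(t)$ denotes the number of points in $[0,t]$. A Poisson process of rate $0$ has no points (so $B_i^{-L_i}$ is empty if $\psi_i=0$). *)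

(* Defs.v *)
From HB Require Import structures.
From mathcomp Require Export all_boot all_order all_algebra.
From mathcomp Require Export all_classical all_reals all_analysis.

Set Implicit Arguments.
Unset Strict Implicit.
Unset Printing Implicit Defensive.
Export Order.TTheory GRing.Theory Num.Theory.
Export numFieldNormedType.Exports.
Global Open Scope classical_set_scope.
Global Open Scope ring_scope.

Section Independence.
Context {d : measure_display} {T : measurableType d} {R : realType}.

Definition mutual_indep (P : probability T R) (I : eqType)
    (F : I -> set (set T)) : Prop :=
  forall (J : seq I) (A : I -> set T), uniq J ->
    (forall i, i \in J -> F i (A i)) ->
    P (\bigcap_(i in [set` J]) A i) = (\prod_(i <- J) P (A i))%E.

(* The sigma-algebra generated by a random element of a countable set V,
   taken with all its subsets as measurable sets. *)
Definition sigma_rv (V : Type) (X : T -> V) : set (set T) :=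
  [set X @^-1` U | U in [set: set V]].

Definition sigma_process (B : R -> T -> nat) : set (set T) :=
  <<s [set A | exists t U, 0 <= t /\ A = B t @^-1` U] >>.

End Independence.

(* Random vectors X N, each on its own probability space, converge in law to Y:
   E f(X N) -> E f(Y) for every bounded continuous f. *)
Definition cvg_in_law {R : realType} (m : nat)
    (d : nat -> measure_display) (O : forall N, measurableType (d N))
    (P : forall N, probability (O N) R) (X : forall N, O N -> 'rV[R]_m)
    (d' : measure_display) (O' : measurableType d')
    (Q : probability O' R) (Y : O' -> 'rV[R]_m) : Prop :=
  forall f : 'rV[R]_m -> R,
    continuous f -> (exists M, forall x, `|f x| <= M) ->
    (fun N => 'E_(P N)[f \o X N])%E @ \oo --> 'E_Q[f \o Y]%E.

(* Urns and times are numbered from 0: p i is the probability of urn i.+1, and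
   C t, Z t are the colour of the ball dropped at time t.+1 and the index of
   the urn receiving it. *)
Section Urns.
Context {d : measure_display} {T : measurableType d} {R : realType}.
Context {q : nat}.
Variables (C : nat -> T -> 'I_q) (Z : nat -> T -> nat).

Definition draw (t : nat) (w : T) : 'I_q * nat := (C t w, Z t w).

Record urn_model (P : probability T R) (p : nat -> R) : Prop := UrnModel {
  draw_measurable : forall t (U : set ('I_q * nat)), measurable (draw t @^-1` U);
  draw_law : forall t c i, P (draw t @^-1` [set (c, i)]) = (q%:R^-1 * p i)%:E;
  draw_indep : mutual_indep P (fun t => sigma_rv (draw t)) }.

Definition collision (t : nat) (w : T) : bool :=
  [exists s : 'I_t, (Z s w == Z t w) && (C s w != C t w)].

(* The sum K_1 + ... + K_t. *)
Definition ncollisions (t : nat) (w : T) : nat := (\sum_(j < t) collision j w)%N.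

Definition collision_time (m : nat) (w : T) : \bar R :=
  ereal_inf [set (t%:R : R)%:E | t in [set t | ncollisions t w = m]].

End Urns.

Definition l2_norm {R : realType} (p : nat -> R) : R :=
  Num.sqrt (limn (series (fun i => p i ^+ 2))).

(* A point process on [0, +oo[ is represented by its counting function:
   B t w is the number of points in [0, t]; its values at t < 0 play no role. *)
Section PointProcesses.
Context {d : measure_display} {T : measurableType d} {R : realType}.
Implicit Types (B : R -> T -> nat).

Record counting_process B : Prop := CountingProcess {
  cp_measurable : forall t U, 0 <= t -> measurable (B t @^-1` U);
  cp_nondecreasing : forall w s t, 0 <= s -> s <= t -> (B s w <= B t w)%N;
  cp_right_continuous :
    forall w t, 0 <= t -> \forall s \near t^'+, B s w = B t w }.

Definition increment B (s t : R) (w : T) : nat := (B t w - B s w)%N.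

(* Poisson process with rate r(t) at time t: the number of points in ]s, t] has
   mean \int_s^t r. The second argument of poisson_prob is a dummy, and
   poisson_prob 0 is the Dirac mass at 0. *)
Record poisson_process (P : probability T R) (r : R -> R) B : Prop :=
  PoissonProcess {
  pp_counting : counting_process B;
  pp_start : {ae P, forall w, B 0 w = 0%N};
  pp_law : forall s t (U : set nat), 0 <= s -> s <= t ->
    P (increment B s t @^-1` U) =
    poisson_prob (\int[lebesgue_measure]_(u in `]s, t]) r u) 0 U;
  pp_indep : forall t : nat -> R, 0 <= t 0%N -> {homo t : i j / (i <= j)%N >-> i <= j} ->
    mutual_indep P (fun k => sigma_rv (increment B (t k) (t k.+1))) }.

Definition is_point B (w : T) (t : R) : Prop :=
  [/\ 0 <= t, (0 < B t w)%N & forall s, 0 <= s -> s < t -> (B s w < B t w)%N].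

Definition drop_points (L : T -> nat) B : R -> T -> nat :=
  fun t w => (B t w - L w)%N.

(* The time of the k-th point (k >= 1) of the process counted by M. *)
Definition arrival_time (M : R -> T -> \bar R) (k : nat) (w : T) : \bar R :=
  ereal_inf [set t%:E | t in [set t : R | 0 <= t /\ ((k%:R : R)%:E <= M t w)%E]].

Section Coloured.
Context {q : nat}.
Implicit Types (Bc : 'I_q -> R -> T -> nat).

Definition superpose Bc : R -> T -> nat := fun t w => (\sum_(a < q) Bc a t w)%N.

Definition two_colour_time Bc (w : T) : \bar R :=
  ereal_inf [set t%:E | t in [set t : R | 0 <= t /\
    exists a b, [/\ a != b, (0 < Bc a t w)%N & (0 < Bc b t w)%N]]].

(* If there is no point before two_colour_time (almost surely only when Bc has
   no points), this is sup set0 = 0. *)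
Definition last_point_before Bc (w : T) : R :=
  sup [set t | is_point (superpose Bc) w t /\ (t%:E < two_colour_time Bc w)%E].

Definition n_removed Bc (w : T) : nat :=
  superpose Bc (last_point_before Bc w) w.

Definition thinned Bc : R -> T -> nat :=
  drop_points (n_removed Bc) (superpose Bc).

(* The counting function of the superposition of B and of all the thinned
   processes B_i^{-L_i}, where Bs i lists the q coloured components of B_i. *)
Definition collision_process B (Bs : nat -> 'I_q -> R -> T -> nat) (t : R)
    (w : T) : \bar R :=
  (((B t w)%:R : R)%:E + \sum_(i <oo) ((thinned (Bs i) t w)%:R : R)%:E)%E.

Record limit_model (P : probability T R) (psi : nat -> R) B
    (Bs : nat -> 'I_q -> R -> T -> nat) : Prop := LimitModel {
  lm_star : poisson_process P
    (fun t => (1 - limn (series (fun i => psi i ^+ 2))) * t * (1 - q%:R^-1)) B;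
  lm_colour : forall i a, poisson_process P (fun=> psi i / q%:R) (Bs i a);
  lm_colour_indep : forall i, mutual_indep P (fun a => sigma_process (Bs i a));
  lm_indep : mutual_indep P (fun o : option nat =>
    sigma_process (if o is Some i then thinned (Bs i) else B)) }.

End Coloured.
End PointProcesses.

(* Main.v *)
(* The collisions occurring in disjoint blocks of w_N ~ delta / s_N draws are
   counted, and their joint generating function is computed. If the number of
   draws of each block were a Poisson variable, the urns would be independent
   and this generating function would be a product over the urns i of
   G(delta psi_Ni), where G is explicit: the effect of one more ball on a
   function of the state of an urn (empty, one colour, two colours) is a
   triangular 3 x 3 matrix, which is diagonalized. Since generating functions
   decrease with the number of draws, changing the mean of the Poisson variables
   slightly and applying Chebyshev's inequality shows that the deterministic
   numbers of draws have the same limit. As G(theta) = 1 - kappa theta^2 +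
   O(theta^3) and sum_i psi_Ni^2 = 1, the product tends to
     exp (- kappa delta^2 (1 - sum_i psi_i^2)) prod_i G(delta psi_i).

   On the limit side, the first factor is the generating function of the
   increments of B*. Subdividing time into small cells, each containing at most
   one point of B_i with high probability, turns B_i into a sequence of draws in
   a single urn: the points of B_i are not collisions before the point which
   brings a second colour, and they all are from that point on. Hence
   G(delta psi_i) is the generating function of the increments of B_i^{-L_i}.

   Letting some of the variables tend to 0 recovers the joint law of the numbers
   of collisions in the blocks, and these numbers locate the collision times up
   to delta. Finally the limit process has no multiple points, since the
   probability that a cell of length h contains two points is O(h^2) for each
   component, and likewise for pairs of components. *)

(* By symmetry the colour of a ball alone in its urn is irrelevant, hence three states per urn. One
   ball has the eigenvalues 0, 1/q and the weight x of a collision. At x = 1/q the matrix is not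
   diagonalizable, so this value is excluded throughout, and the laws are recovered from variables
   in ]0, 1/q[ only. Diagonalization is carried out for finitely many urns; the remaining ones are
   merged into a draw without effect, and the truncation is removed afterwards. Operators act on
   functions of the state, thus backwards in time. Draws preserve the functions that decrease as the
   urns fill up, and this lets one block at a time be compared with a Poisson number of draws. The
   squares psi_Ni^2 sum to 1 for each N, but in the limit the mass 1 - sum_i psi_i^2 may escape to
   urns that are individually negligible. Only the second-order term kappa feels it: this is where
   B* comes from. On the limit side, the default values of [sup] concern a null event, which
   measurability nevertheless has to cover. *)
Require Import Defs.
From mathcomp Require Import measurable_realfun.
From mathcomp Require Import ring lra zify.

Set Implicit Arguments.
Unset Strict Implicit.
Unset Printing Implicit Defensive.

(** * Adding a ball to an urn *)

(* An urn is empty ([None]), holds a single colour ([Some false]), or at least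
   two colours ([Some true]). *)
Notation urn_state := (option bool).

Definition rank (s : urn_state) : nat :=
  match s with None => 0%N | Some false => 1%N | Some true => 2%N end.

Lemma sum_urn_state (R : realType) (F : urn_state -> R) :
  \sum_e F e = F None + F (Some false) + F (Some true).
Proof.
rewrite (bigD1 None)//= (bigD1 (Some false))//= (bigD1 (Some true))//= big1 ?addr0 ?addrA//.
by case=> [[]|].
Qed.

Definition update (T : eqType) (S : Type) (f : T -> S) (i : T) (s : S) : T -> S :=
  fun j => if j == i then s else f j.

Lemma update_id (T : eqType) (S : Type) (f : T -> S) (i : T) : update f i (f i) = f.
Proof. by apply/funext => j; rewrite /update; case: eqP => [->|]. Qed.

Section UrnOperators.
Context {R : realType} (q : nat).
Hypothesis q_ge2 : (2 <= q)%N.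
Local Notation qi := (q%:R^-1 : R).

Lemma qi_gt0 : 0 < qi.
Proof. by rewrite invr_gt0 ltr0n; exact: leq_trans q_ge2. Qed.

Lemma qi_lt1 : qi < 1.
Proof. by rewrite invf_lt1 ?ltr1n// ltr0n; exact: leq_trans q_ge2. Qed.

Lemma q_neq0 : q%:R != 0 :> R.
Proof. by rewrite pnatr_eq0 -lt0n; exact: leq_trans q_ge2. Qed.

(* Effect on a function of the state of an urn of one more ball in this urn,
   a collision being weighted by [x]. *)
Definition add_ball (x : R) (v : urn_state -> R) (s : urn_state) : R :=
  match s with
  | None => v (Some false)
  | Some false => qi * v (Some false) + (1 - qi) * x * v (Some true)
  | Some true => x * v (Some true)
  end.

(** In the order empty, one colour, two colours, [add_ball x] is triangular with these diagonal
    entries; an eigenvalue is therefore named by a state. *)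
Definition eigval (x : R) (e : urn_state) : R :=
  match e with None => 0 | Some false => qi | Some true => x end.

Definition eigvec (x : R) (e s : urn_state) : R :=
  match e, s with
  | None, None => 1
  | None, _ => 0
  | Some false, None => q%:R
  | Some false, Some false => 1
  | Some false, Some true => 0
  | Some true, None => (1 - qi) / (x - qi)
  | Some true, Some false => (1 - qi) / (x - qi) * x
  | Some true, Some true => 1
  end.

Definition eigcoord (x : R) (v : urn_state -> R) (e : urn_state) : R :=
  let c := (1 - qi) / (x - qi) * x in
  match e with
  | Some true => v (Some true)
  | Some false => v (Some false) - c * v (Some true)
  | None => v None - q%:R * (v (Some false) - c * v (Some true))
            - (1 - qi) / (x - qi) * v (Some true)
  end.

(** No condition on [x]: the matrix of the [eigvec] is triangular with 1 on the diagonal, whatever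
    value [(1 - qi) / (x - qi)] takes. *)
Lemma eig_decomp x v s : v s = \sum_e eigcoord x v e * eigvec x e s.
Proof.
by rewrite sum_urn_state; case: s => [[]|] /=; ring.
Qed.

Lemma add_ball_eigvec x e s : x != qi ->
  add_ball x (eigvec x e) s = eigval x e * eigvec x e s.
Proof.
rewrite -subr_eq0 => xq; have q0 := q_neq0.
case: e => [[]|]; case: s => [[]|] //=; rewrite ?mulr0 ?mulr1 ?addr0 //.
- field.
  rewrite q0 /=.
  by apply: contra xq => /eqP h; apply/eqP; rewrite -[RHS](mul0r qi) -h; field.
- by rewrite mulrC.
- by rewrite mulVf.
Qed.

(* The Poisson average of the powers of [add_ball], with mean [th]. *)
Definition add_poisson (x th : R) (v : urn_state -> R) (s : urn_state) : R :=
  \sum_e eigcoord x v e * expR (th * (eigval x e - 1)) * eigvec x e s.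

Section ManyUrns.
Variable I : nat.
Implicit Types (F : ('I_I -> urn_state) -> R) (sg : 'I_I -> urn_state) (v : 'I_I -> urn_state -> R).
Variables (r : R) (p : 'I_I -> R).

(* One draw: urn [i] is selected with probability [p i], and none of the
   urns under consideration with probability [r]. *)
Definition draw_op (x : R) F sg : R :=
  r * F sg + \sum_i p i * add_ball x (fun s => F (update sg i s)) (sg i).

Definition prodf v sg : R := \prod_i v i (sg i).

Lemma prodf_update v sg i s :
  prodf v (update sg i s) = v i s * \prod_(j | j != i) v j (sg j).
Proof.
rewrite /prodf (bigD1 i)//= /update eqxx; congr (_ * _).
by apply: eq_bigr => j /negbTE ->.
Qed.

Lemma add_ball_scale x (f g : urn_state -> R) c s :
  (forall s, f s = g s * c) -> add_ball x f s = add_ball x g s * c.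
Proof. by move=> fg; case: s => [[]|] /=; rewrite !fg; ring. Qed.

(** A draw changes a single urn, so it multiplies a product of eigenvectors by an average of their
    eigenvalues. *)
Lemma draw_op_eigen x (e : 'I_I -> urn_state) sg : x != qi ->
  draw_op x (prodf (fun i => eigvec x (e i))) sg =
  (r + \sum_i p i * eigval x (e i)) * prodf (fun i => eigvec x (e i)) sg.
Proof.
move=> xq; rewrite /draw_op mulrDl mulr_suml; congr (_ + _).
apply: eq_bigr => i _.
rewrite (@add_ball_scale x _ (eigvec x (e i)) (\prod_(j | j != i) eigvec x (e j) (sg j))).
  by rewrite add_ball_eigvec// -!mulrA; congr (_ * (_ * _)); rewrite /prodf [RHS](bigD1 i).
by move=> s; rewrite prodf_update.
Qed.

Lemma draw_op_sum x (T : finType) (a : T -> R) (G : T -> ('I_I -> urn_state) -> R) :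
  draw_op x (fun sg => \sum_k a k * G k sg) = fun sg => \sum_k a k * draw_op x (G k) sg.
Proof.
apply/funext => sg; rewrite /draw_op.
under [RHS]eq_bigr do rewrite mulrDr.
rewrite big_split/=; congr (_ + _).
  by rewrite mulr_sumr; apply: eq_bigr => k _; ring.
under [RHS]eq_bigr do rewrite mulr_sumr.
rewrite exchange_big/=; apply: eq_bigr => i _.
have -> : add_ball x (fun s => \sum_k a k * G k (update sg i s)) (sg i) =
   \sum_k a k * add_ball x (fun s => G k (update sg i s)) (sg i).
  case: (sg i) => [[]|] //=.
    by rewrite mulr_sumr; apply: eq_bigr => k _; ring.
  by rewrite !mulr_sumr -big_split; apply: eq_bigr => k _ /=; ring.
by rewrite mulr_sumr; apply: eq_bigr => k _; ring.
Qed.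

Lemma prodf_eigen x v :
  prodf v = fun sg => \sum_(e : {ffun 'I_I -> urn_state})
    (\prod_i eigcoord x (v i) (e i)) * prodf (fun i => eigvec x (e i)) sg.
Proof.
apply/funext => sg; rewrite /prodf.
under eq_bigr do rewrite (eig_decomp x).
by rewrite bigA_distr_bigA; apply: eq_bigr => e _; rewrite big_split.
Qed.

(** Expanding each factor in the eigenbasis makes all powers of one draw explicit, although the urns
    are dependent. *)
Lemma iter_draw_op_prodf x v m : x != qi ->
  iter m (draw_op x) (prodf v) = fun sg => \sum_(e : {ffun 'I_I -> urn_state})
    (\prod_i eigcoord x (v i) (e i)) * ((r + \sum_i p i * eigval x (e i)) ^+ m *
     prodf (fun i => eigvec x (e i)) sg).
Proof.
move=> xq; elim: m => [|m IH].
  by rewrite /= (prodf_eigen x); apply/funext => sg; apply: eq_bigr => e _; rewrite expr0 mul1r.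
rewrite iterS IH draw_op_sum; apply/funext => sg; apply: eq_bigr => e _; congr (_ * _).
rewrite exprSr -mulrA -draw_op_eigen// /draw_op mulrDr mulrCA; congr (_ + _).
rewrite mulr_sumr; apply: eq_bigr => i _.
rewrite (@add_ball_scale x _ (fun s => prodf (fun i => eigvec x (e i)) (update sg i s))
  ((r + \sum_i p i * eigval x (e i)) ^+ m)); last by move=> s; rewrite mulrC.
by ring.
Qed.

(** The benefit of Poisson numbers of draws: the exponential of the eigenvalue
    [r + \sum_i p i * eigval x (e i)] is a product over the urns. *)
Lemma poisson_draw_op x v (lam : R) sg : x != qi -> r = 1 - \sum_i p i ->
  series (fun m => lam ^+ m / m`!%:R * iter m (draw_op x) (prodf v) sg) @ \oo -->
  expR lam * prodf (fun i => add_poisson x (lam * p i) (v i)) sg.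
Proof.
move=> xq rE.
rewrite (_ : series _ = fun n => \sum_(e : {ffun 'I_I -> urn_state})
    (\prod_i eigcoord x (v i) (e i)) * prodf (fun i => eigvec x (e i)) sg *
    series (exp_coeff (lam * (r + \sum_i p i * eigval x (e i)))) n); last first.
  apply/funext => n; rewrite /series /=.
  under eq_bigr do rewrite iter_draw_op_prodf// mulr_sumr.
  rewrite exchange_big/=; apply: eq_bigr => e _.
  rewrite mulr_sumr; apply: eq_bigr => m _.
  by rewrite /exp_coeff /= exprMn; ring.
rewrite (_ : expR lam * _ = \sum_(e : {ffun 'I_I -> urn_state})
    (\prod_i eigcoord x (v i) (e i)) * prodf (fun i => eigvec x (e i)) sg *
    expR (lam * (r + \sum_i p i * eigval x (e i)))); last first.
  rewrite /prodf /add_poisson bigA_distr_bigA mulr_sumr; apply: eq_bigr => e _.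
  have -> : expR (lam * (r + \sum_i p i * eigval x (e i))) =
      expR lam * \prod_i expR (lam * p i * (eigval x (e i) - 1)).
    rewrite -expR_sum -expRD; congr expR.
    rewrite rE !mulrDr mulr1 -!addrA; congr (_ + _).
    by rewrite mulrN !mulr_sumr -sumrN -big_split/=; apply: eq_bigr => i _; ring.
  by rewrite !big_split/=; ring.
apply: cvg_big => [|e _]; first exact: (@add_continuous).
apply: cvgMr; exact: is_cvg_series_exp_coeff.
Qed.

(** Nonnegative functions that decrease as the urns fill up. Draws preserve them and lower them, so
    the effect of a number of draws is monotone in this number. *)
Definition antitone F := (forall sg, 0 <= F sg) /\
  forall sg tau, (forall i, (rank (sg i) <= rank (tau i))%N) -> F tau <= F sg.

Lemma antitone_update F sg i s t : antitone F -> (rank s <= rank t)%N ->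
  F (update sg i t) <= F (update sg i s).
Proof.
by move=> [_ aF] st; apply: aF => j; rewrite /update; case: eqP.
Qed.

Lemma add_ball_le x (f g : urn_state -> R) s : 0 <= x -> (forall s, f s <= g s) ->
  add_ball x f s <= add_ball x g s.
Proof.
move=> x0 fg; have := qi_gt0; have := qi_lt1 => a b.
case: s => [[]|] /=; [|apply: lerD|] => //; apply: ler_wpM2l => //.
by apply: mulr_ge0 => //; rewrite subr_ge0 ltW.
Qed.

Lemma add_ball_cst x c s : add_ball x (fun=> c) s = add_ball x (fun=> 1) s * c.
Proof. by case: s => [[]|] /=; ring. Qed.

(** For decreasing [f], the three values of [add_ball] are [f (Some false)], an average of it with
    the smaller number [x * f (Some true)], and this smaller number. *)
Lemma add_ball_decr x (f : urn_state -> R) s t : 0 <= x <= 1 -> (forall s, 0 <= f s) ->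
  (forall s t, (rank s <= rank t)%N -> f t <= f s) -> (rank s <= rank t)%N ->
  add_ball x f t <= add_ball x f s.
Proof.
move=> /andP[x0 x1] f0 fd st; have q0 := qi_gt0; have q1 := qi_lt1.
have h1 := fd (Some false) (Some true) isT; have h0 := fd None (Some false) isT.
have a1 := f0 (Some true); have a2 := f0 (Some false).
have h : 0 <= f (Some false) - x * f (Some true) by nra.
have h' : 0 <= q%:R^-1 * (f (Some false) - x * f (Some true)) by rewrite mulr_ge0// ltW.
have h'' : 0 <= (1 - q%:R^-1) * (f (Some false) - x * f (Some true)).
  by rewrite mulr_ge0// subr_ge0 ltW.
move: st; case: s => [[]|]; case: t => [[]|] //= _; nra.
Qed.

Lemma add_ball_contr x (f : urn_state -> R) s : 0 <= x <= 1 -> (forall s, 0 <= f s) ->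
  (forall s t, (rank s <= rank t)%N -> f t <= f s) -> add_ball x f s <= f s.
Proof.
move=> /andP[x0 x1] f0 fd; have q0 := qi_gt0; have q1 := qi_lt1.
have h1 := fd (Some false) (Some true) isT; have h0 := fd None (Some false) isT.
have a1 := f0 (Some true); have a2 := f0 (Some false).
have h : 0 <= f (Some false) - x * f (Some true) by nra.
have h'' : 0 <= (1 - q%:R^-1) * (f (Some false) - x * f (Some true)).
  by rewrite mulr_ge0// subr_ge0 ltW.
case: s => [[]|] //=; nra.
Qed.

Hypothesis p_ge0 : forall i, 0 <= p i.
Hypothesis r_ge0 : 0 <= r.

Lemma draw_op_le x F G : 0 <= x -> (forall sg, F sg <= G sg) ->
  forall sg, draw_op x F sg <= draw_op x G sg.
Proof.
move=> x0 FG sg; apply: lerD; first exact: ler_wpM2l.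
by apply: ler_sum => i _; apply: ler_wpM2l => //; exact: add_ball_le.
Qed.

Lemma iter_draw_op_le x F G m : 0 <= x -> (forall sg, F sg <= G sg) ->
  forall sg, iter m (draw_op x) F sg <= iter m (draw_op x) G sg.
Proof. by move=> x0 FG; elim: m => [//|m IH] sg /=; apply: draw_op_le. Qed.

Lemma antitone_draw_op x F : 0 <= x <= 1 -> antitone F -> antitone (draw_op x F).
Proof.
move=> /[dup] x01 /andP[x0 x1] aF; have [F0 _] := aF; split=> [sg|sg tau st].
  rewrite addr_ge0 ?mulr_ge0// sumr_ge0// => i _; rewrite mulr_ge0//.
  by rewrite -(_ : add_ball x (fun=> 0) (sg i) = 0) ?add_ball_le// add_ball_cst mulr0.
apply: lerD; first by apply: ler_wpM2l => //; apply: aF.2.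
apply: ler_sum => i _; apply: ler_wpM2l => //.
apply: (@le_trans _ _ (add_ball x (fun s => F (update sg i s)) (tau i))).
  by apply: add_ball_le => // s; apply: aF.2 => j; rewrite /update; case: eqP.
apply: add_ball_decr => // s t; exact: antitone_update.
Qed.

Lemma draw_op_contr x F sg : r = 1 - \sum_i p i -> 0 <= x <= 1 -> antitone F ->
  draw_op x F sg <= F sg.
Proof.
move=> rE x01 aF; have [F0 _] := aF.
rewrite -[leRHS](_ : r * F sg + \sum_i p i * F sg = _); last first.
  by rewrite -mulr_suml -mulrDl rE subrK mul1r.
apply: lerD => //; apply: ler_sum => i _; apply: ler_wpM2l => //.
apply: (le_trans (add_ball_contr _ _ _ _)) => //=; last by rewrite update_id.
by move=> s t; exact: antitone_update.
Qed.

Lemma antitone_iter x F m : 0 <= x <= 1 -> antitone F -> antitone (iter m (draw_op x) F).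
Proof. by move=> x01 aF; elim: m => //= m IH; exact: antitone_draw_op. Qed.

(** A draw does not amplify an additive error, since its weights sum to 1 and [x <= 1]. This carries
    the errors made on later blocks through the earlier ones. *)
Lemma draw_op_addc x F c sg : r = 1 - \sum_i p i -> 0 <= x <= 1 -> 0 <= c ->
  draw_op x (fun sg => F sg + c) sg <= draw_op x F sg + c.
Proof.
move=> rE x01 c0.
rewrite -[leRHS](_ : r * (F sg + c) + \sum_i p i * (add_ball x (fun s => F (update sg i s)) (sg i) + c) = _); last first.
  rewrite /draw_op; under eq_bigr do rewrite mulrDr.
  by rewrite big_split/= -mulr_suml rE; ring.
apply: lerD => //; apply: ler_sum => i _; apply: ler_wpM2l => //.
have /= := @add_ball_contr x (fun=> c) (sg i) x01 (fun=> c0) (fun _ _ _ => lexx _).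
by case: (sg i) => [[]|] /=; lra.
Qed.

Lemma iter_draw_op_addc x F c m sg : r = 1 - \sum_i p i -> 0 <= x <= 1 -> 0 <= c ->
  iter m (draw_op x) (fun sg => F sg + c) sg <= iter m (draw_op x) F sg + c.
Proof.
move=> rE x01 c0; elim: m sg => [//|m IH] sg; rewrite !iterS.
apply: le_trans (draw_op_addc _ _ rE x01 c0).
by apply: draw_op_le => //; case/andP: x01.
Qed.

End ManyUrns.
End UrnOperators.

(** * Poisson numbers of draws *)

Section PoissonWeights.
Context {R : realType}.
Implicit Types (lam : R).

Lemma cvg_le (f g : R ^nat) (a b : R) : (forall n, f n <= g n) ->
  f @ \oo --> a -> g @ \oo --> b -> a <= b.
Proof.
move=> fg fa gb; rewrite -(cvg_lim _ fa)// -(cvg_lim _ gb)//.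
by apply: ler_lim; [apply: cvgP fa|apply: cvgP gb|exact: nearW].
Qed.

Lemma cvgn_dist (u : R ^nat) (a : R) : u @ \oo --> a -> forall eps, 0 < eps ->
  exists N, forall n, (N <= n)%N -> `|a - u n| < eps.
Proof.
move=> ua eps e0; have [N _ h] := (@cvgrPdist_lt R R nat \oo _ u a).1 ua eps e0.
by exists N => n Nn; exact: h.
Qed.

Lemma dist_cvgn (u : R ^nat) (a : R) : (forall eps, 0 < eps ->
  exists N, forall n, (N <= n)%N -> `|a - u n| < eps) -> u @ \oo --> a.
Proof.
move=> h; apply/cvgrPdist_lt => eps e0; have [N hN] := h eps e0.
by exists N => // n /= Nn; exact: hN.
Qed.

Lemma cvgn_expR (u : R ^nat) (a : R) : u @ \oo --> a -> (fun n => expR (u n)) @ \oo --> expR a.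
Proof. by move=> ua; apply: (cvg_comp _ _ ua); exact: continuous_expR. Qed.

Lemma cvg_series_exp lam : series (fun m => lam ^+ m / m`!%:R) @ \oo --> expR lam.
Proof. exact: (@is_cvg_series_exp_coeff R lam). Qed.

Lemma poisson_variance lam :
  series (fun m => lam ^+ m / m`!%:R * (m%:R - lam) ^+ 2) @ \oo --> lam * expR lam.
Proof.
pose s : R ^nat := series (fun m => lam ^+ m / m`!%:R).
have sE n : s n.+1 = s n + lam ^+ n / n`!%:R by rewrite /s /series /= big_nat_recr.
have fn0 n : (n`!)%:R != 0 :> R by rewrite pnatr_eq0 -lt0n fact_gt0.
(* Write [m^2 = m(m-1) + m] and shift indices: the partial sums of the variance are combinations of
   those of the exponential. *)
have E n : series (fun m => lam ^+ m / m`!%:R * (m%:R - lam) ^+ 2) n.+2 =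
    lam * s n.+1 + lam ^+ 2 * (s n - 2%:R * s n.+1 + s n.+2).
  elim: n => [|n IH].
    rewrite !sE /s /series /= !big_nat_recr//= !big_geq// !factS fact0 muln1.
    by field.
  rewrite /series /= big_nat_recr//= -/(series _ n.+2).
  rewrite [X in X + _](_ : _ = series (fun m => lam ^+ m / m`!%:R * (m%:R - lam) ^+ 2) n.+2)// IH.
  rewrite (sE n.+2) (sE n.+1) (sE n) !factS !natrM !exprS !mulrS.
  have h1 : 1 + n%:R != 0 :> R by rewrite -mulrS pnatr_eq0.
  have h2 : 1 + (1 + n%:R) != 0 :> R by rewrite -!mulrS pnatr_eq0.
  by field; rewrite ?fn0 ?h1 ?h2.
have h := @cvg_series_exp lam.
suff : lam * s n.+1 + lam ^+ 2 * (s n - 2%:R * s n.+1 + s n.+2) @[n --> \oo] --> lam * expR lam.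
  move=> H; rewrite -(cvg_shiftn 2) /=; apply: cvg_trans H; apply: near_eq_cvg.
  by apply: nearW => n; rewrite addn2 E.
rewrite -[lam * expR lam]addr0 -[X in _ + X](mulr0 (lam ^+ 2)).
have s1 : s n.+1 @[n --> \oo] --> expR lam.
  by move: h; rewrite -(cvg_shiftS (series _)).
have s2 : s n.+2 @[n --> \oo] --> expR lam.
  by move: s1; rewrite -(cvg_shiftS (fun n => s n.+1)).
apply: cvgD; first exact: cvgMl_tmp.
apply: cvgMl_tmp.
rewrite (_ : 0 = expR lam - 2%:R * expR lam + expR lam); last by ring.
by apply: cvgD => //; apply: cvgB => //; apply: cvgMl_tmp.
Qed.

(* A sequence a which is monotone can be compared with its Poisson averages,
   the indicators of the tails being dominated by (m - lam)^2 / (w - lam)^2. *)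
Lemma depoissonize_le (a : R ^nat) (lam : R) (w : nat) (L : R) : 0 <= lam ->
  (forall m, 0 <= a m <= 1) -> (forall m n, (m <= n)%N -> a n <= a m) ->
  series (fun m => lam ^+ m / m`!%:R * a m) @ \oo --> expR lam * L ->
  lam < w%:R -> a w <= L + lam / (w%:R - lam) ^+ 2.
Proof.
move=> l0 a01 adec aL lw.
have dw : 0 < (w%:R - lam) ^+ 2 by rewrite exprn_gt0// subr_gt0.
suff : expR lam * a w <= expR lam * (L + lam / (w%:R - lam) ^+ 2).
  by rewrite ler_pM2l ?expR_gt0.
have -> : expR lam * (L + lam / (w%:R - lam) ^+ 2) =
  expR lam * L + lam * expR lam / (w%:R - lam) ^+ 2 by ring.
apply: (cvg_le _ (cvgMr_tmp (@cvg_series_exp lam) (b := a w))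
  (cvgD aL (cvgMr_tmp (@poisson_variance lam) (b := ((w%:R - lam) ^+ 2)^-1)))) => n.
rewrite fctE /series /= !mulr_suml -big_split; apply: ler_sum => m _ /=.
rewrite -[_ * _ / _]mulrA -mulrDr ler_wpM2l ?divr_ge0 ?exprn_ge0//.
have [mw|wm] := leqP m w.
  rewrite ler_wpDr ?divr_ge0 ?sqr_ge0//; exact: adec.
apply: (@le_trans _ _ (0 + 1)); first by rewrite add0r; case/andP: (a01 w).
apply: lerD; first by case/andP: (a01 m).
have wm' : w%:R <= m%:R :> R by rewrite ler_nat ltnW.
by rewrite ler_pdivlMr// mul1r ler_sqr ?nnegrE ?subr_ge0 ?(ltW lw) ?(le_trans (ltW lw))// lerB.
Qed.

(** The opposite bound: here the lower tail [m < w] is the one dominated by the variance. *)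
Lemma depoissonize_ge (a : R ^nat) (lam : R) (w : nat) (L : R) : 0 <= lam ->
  (forall m, 0 <= a m <= 1) -> (forall m n, (m <= n)%N -> a n <= a m) ->
  series (fun m => lam ^+ m / m`!%:R * a m) @ \oo --> expR lam * L ->
  w%:R < lam -> L <= a w + lam / (w%:R - lam) ^+ 2.
Proof.
move=> l0 a01 adec aL lw.
have dw : 0 < (w%:R - lam) ^+ 2 by rewrite exprn_even_gt0//= subr_eq0 lt_eqF.
suff : expR lam * L <= expR lam * (a w + lam / (w%:R - lam) ^+ 2).
  by rewrite ler_pM2l ?expR_gt0.
have -> : expR lam * (a w + lam / (w%:R - lam) ^+ 2) =
  expR lam * a w + lam * expR lam / (w%:R - lam) ^+ 2 by ring.
apply: (cvg_le _ aL (cvgD (cvgMr_tmp (@cvg_series_exp lam) (b := a w))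
  (cvgMr_tmp (@poisson_variance lam) (b := ((w%:R - lam) ^+ 2)^-1)))) => n.
rewrite fctE /series /= !mulr_suml -big_split; apply: ler_sum => m _ /=.
rewrite -[_ * _ / _]mulrA -mulrDr ler_wpM2l ?divr_ge0 ?exprn_ge0//.
have [wm|mw] := leqP w m.
  rewrite ler_wpDr ?divr_ge0 ?sqr_ge0//; exact: adec.
apply: (@le_trans _ _ (0 + 1)); first by rewrite add0r; case/andP: (a01 m).
apply: lerD; first by case/andP: (a01 w).
have mw' : m%:R <= w%:R :> R by rewrite ler_nat ltnW.
rewrite ler_pdivlMr// mul1r -sqrrN -[leRHS]sqrrN !opprB.
by rewrite ler_sqr ?nnegrE ?subr_ge0 ?lerB// ?(le_trans mw')// ltW.
Qed.
End PoissonWeights.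

Section Blocks.
Context {R : realType} (q : nat).
Hypothesis q_ge2 : (2 <= q)%N.
Local Notation qi := (q%:R^-1 : R).

(** The operators act backwards in time: with [foldr], the head of [xs] is the first block and its
    operator is applied last. *)
Definition add_poisson_blocks (th : R) (xs : seq R) : urn_state -> R :=
  foldr (fun x v => add_poisson q x th v) (fun=> 1) xs.

Definition blocks_gf (xs : seq R) (th : R) : R := add_poisson_blocks th xs None.

Section ManyUrns.
Variables (I : nat) (r : R) (p : 'I_I -> R).
Hypothesis p_ge0 : forall i, 0 <= p i.
Hypothesis r_ge0 : 0 <= r.
Hypothesis rE : r = 1 - \sum_i p i.

Definition draw_blocks (w : nat) (xs : seq R) : ('I_I -> urn_state) -> R :=
  foldr (fun x F => iter w (draw_op q r p x) F) (fun=> 1) xs.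

Let antitone01 (F : ('I_I -> urn_state) -> R) := antitone F /\ forall sg, F sg <= 1.

Lemma antitone01_iter x F m : 0 <= x <= 1 -> antitone01 F ->
  antitone01 (iter m (draw_op q r p x) F).
Proof.
move=> x01 [aF F1]; split; first exact: antitone_iter.
move=> sg; elim: m => [//|m IH]; apply: le_trans IH; rewrite iterS.
by apply: draw_op_contr => //; exact: antitone_iter.
Qed.

(** A Poisson average is a limit of nonnegative combinations of iterated draws, and the three
    properties pass to such limits. *)
Lemma antitone01_poisson x v lam : 0 <= x <= 1 -> x != qi -> 0 <= lam ->
  antitone01 (prodf v) -> antitone01 (prodf (fun i => add_poisson q x (lam * p i) (v i))).
Proof.
move=> x01 xq l0 av.
have H sg := @poisson_draw_op R q q_ge2 I r p x v lam sg xq rE.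
have W m : 0 <= lam ^+ m / m`!%:R by rewrite divr_ge0 ?exprn_ge0.
have A m := @antitone01_iter x _ m x01 av.
have e0 := expR_gt0 lam.
split; [split|] => [sg|sg tau st|sg]; rewrite -(ler_pM2l e0).
- rewrite mulr0; apply: (cvg_le _ (cvg_cst 0) (H sg)) => n /=.
  by rewrite sumr_ge0// => m _; rewrite mulr_ge0//; case: (A m) => [[]].
- apply: (cvg_le _ (H tau) (H sg)) => n; apply: ler_sum => m _.
  by rewrite ler_wpM2l//; case: (A m) => [[_ /(_ sg tau st)]].
- rewrite mulr1; apply: (cvg_le _ (H sg) (@cvg_series_exp R lam)) => n.
  apply: ler_sum => m _.
  by rewrite -[leRHS]mulr1 ler_wpM2l//; case: (A m).
Qed.

(** Blocks are replaced one at a time. The head block is compared with its Poisson average, at the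
    cost of one Chebyshev term; the error already made on the later blocks goes through it by
    [iter_draw_op_addc]. A smaller mean bounds from above because more draws lower the function. *)
Lemma draw_blocks_cmp w lam xs : 0 <= lam -> lam != w%:R ->
  (forall x, x \in xs -> 0 <= x <= 1 /\ x != qi) ->
  antitone01 (prodf (fun i => add_poisson_blocks (lam * p i) xs)) /\ 
  forall sg, let P := prodf (fun i => add_poisson_blocks (lam * p i) xs) sg in
    let e := (size xs)%:R * (lam / (w%:R - lam) ^+ 2) in
    if lam < w%:R then draw_blocks w xs sg <= P + e else P <= draw_blocks w xs sg + e.
Proof.
move=> l0 lw; elim: xs => [_|x xs IH xsP].
  have E sg : prodf (fun i : 'I_I => add_poisson_blocks (lam * p i) [::]) sg = 1.
    by rewrite /prodf/= big1.
  split; first by split; [split|] => *; rewrite !E.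
  by move=> sg; rewrite E /= mul0r addr0; case: ifP.
have [x01 xq] := xsP x (mem_head _ _).
have [|aP cP] := IH; first by move=> y yx; apply: xsP; rewrite inE yx orbT.
have aP' := @antitone01_poisson x _ lam x01 xq l0 aP.
split=> // sg /=; set e1 := lam / _.
have e1_ge0 : 0 <= e1 by rewrite divr_ge0// sqr_ge0.
set U := prodf _ in aP cP.
have x0 : 0 <= x by case/andP: x01.
have A m : 0 <= iter m (draw_op q r p x) U sg <= 1.
  by have [[h _] h'] := @antitone01_iter x _ m x01 aP; rewrite h h'.
have D m n : (m <= n)%N -> iter n (draw_op q r p x) U sg <= iter m (draw_op q r p x) U sg.
  elim: n => [|n IHn]; first by rewrite leqn0 => /eqP ->.
  rewrite leq_eqVlt => /orP[/eqP -> //|]; rewrite ltnS => /IHn; apply: le_trans.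
  by rewrite iterS; apply: draw_op_contr => //; case: (@antitone01_iter x _ n x01 aP).
have C := @poisson_draw_op R q q_ge2 I r p x _ lam sg xq rE.
have {}C := C (fun i => add_poisson_blocks (lam * p i) xs).
have se : 0 <= (size xs)%:R * e1 by rewrite mulr_ge0.
rewrite mulrS mulrDl mul1r addrA.
case: ifPn cP => lw' cP.
  apply: (@le_trans _ _ (iter w (draw_op q r p x) (fun sg => U sg + (size xs)%:R * e1) sg)).
    exact: iter_draw_op_le.
  apply: le_trans; first exact: iter_draw_op_addc.
  by rewrite lerD2r; apply: (depoissonize_le l0 A D C).
have wl : w%:R < lam by rewrite lt_neqAle eq_sym lw leNgt.
apply: (@le_trans _ _ (iter w (draw_op q r p x) U sg + e1)).
  exact: (depoissonize_ge l0 A D C).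
rewrite [e1 + _]addrC addrA lerD2r.
apply: (@le_trans _ _ (iter w (draw_op q r p x) (fun sg => draw_blocks w xs sg + (size xs)%:R * e1) sg)).
  exact: iter_draw_op_le.
exact: iter_draw_op_addc.
Qed.

End ManyUrns.
End Blocks.

(** * Expansion for small parameters *)

Section Expansion.
Context {R : realType}.
Implicit Types (f g : R -> R).

(** The range [0, 2] is that of the entries of an [l2_array]. *)
Definition bigO (n : nat) f :=
  exists2 c, 0 <= c & forall th, 0 <= th <= 2%:R -> `|f th| <= c * th ^+ n.

Lemma eq_bigO n f g : f =1 g -> bigO n f -> bigO n g.
Proof. by move=> fg [c c0 h]; exists c => // th ht; rewrite -fg; exact: h. Qed.

Lemma bigO_cst c : bigO 0 (fun=> c).
Proof. by exists `|c| => // th _; rewrite expr0 mulr1. Qed.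

Lemma bigO_id : bigO 1 (fun th => th).
Proof. by exists 1 => // th /andP[t0 _]; rewrite mul1r expr1 ger0_norm. Qed.

Lemma bigOD n f g : bigO n f -> bigO n g -> bigO n (fun th => f th + g th).
Proof.
move=> [c c0 hf] [d d0 hg]; exists (c + d); first exact: addr_ge0.
by move=> th ht; rewrite mulrDl; apply: le_trans (ler_normD _ _) _; apply: lerD; [exact: hf|exact: hg].
Qed.

Lemma bigOM n m f g : bigO n f -> bigO m g -> bigO (n + m) (fun th => f th * g th).
Proof.
move=> [c c0 hf] [d d0 hg]; exists (c * d); first exact: mulr_ge0.
move=> th ht; rewrite normrM exprD mulrACA.
by apply: ler_pM => //; [exact: hf|exact: hg].
Qed.

Lemma bigO_weak n k f : bigO (n + k) f -> bigO n f.
Proof.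
move=> [c c0 hf]; exists (c * 2%:R ^+ k); first by rewrite mulr_ge0// exprn_ge0.
move=> th /[dup] ht /andP[t0 t2]; apply: le_trans (hf _ ht) _.
rewrite exprD mulrA [leRHS]mulrAC ler_wpM2l// ?mulr_ge0 ?exprn_ge0//.
by rewrite lerXn2r// nnegrE.
Qed.

(** In the tail, [(k + n)! >= k!] compares each term with [|y|^n] times a term of the series of
    [expR |y|]. *)
Lemma expR_taylor (y : R) (n : nat) :
  `|expR y - series (exp_coeff y) n| <= `|y| ^+ n * expR `|y|.
Proof.
have h : (fun m => `|series (exp_coeff y) (m + n)%N - series (exp_coeff y) n|) @ \oo -->
    `|expR y - series (exp_coeff y) n|.
  apply: cvg_norm; apply: cvgB; last exact: cvg_cst.
  rewrite (cvg_shiftn n (series (exp_coeff y))); exact: is_cvg_series_exp_coeff.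
apply: (cvg_le _ h (cvgMl_tmp (is_cvg_series_exp_coeff (`|y| : R)) (a := `|y| ^+ n))) => m.
rewrite /series /= addnC (big_cat_nat (n := n)) ?leq_addr//= addrAC subrr add0r.
apply: le_trans (ler_norm_sum _ _ _) _.
rewrite -{1}[n]add0n big_addn addKn mulr_sumr; apply: ler_sum => k _.
rewrite /exp_coeff /= normrM normrX exprD normfV normr_nat mulrAC mulrC.
rewrite ler_wpM2l ?exprn_ge0//.
rewrite ler_wpM2l ?exprn_ge0// lef_pV2 ?posrE ?ltr0n ?fact_gt0// ler_nat.
apply: (@leq_trans (k`! * n`!)); first by rewrite leq_pmulr// fact_gt0.
by rewrite -(bin_fact (leq_addr n k)) addKn leq_pmull// bin_gt0 leq_addr.
Qed.

Lemma bigO_exp (a : R) n :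
  bigO n (fun th => expR (th * a) - series (exp_coeff (th * a)) n).
Proof.
exists (`|a| ^+ n * expR (2%:R * `|a|)); first by rewrite mulr_ge0 ?exprn_ge0 ?expR_ge0.
move=> th /andP[t0 t2]; apply: le_trans (expR_taylor _ _) _.
rewrite normrM (ger0_norm t0) exprMn [_ * `|a| ^+ n]mulrC -mulrA [leRHS]mulrAC -[leRHS]mulrA.
by rewrite !ler_wpM2l ?exprn_ge0// ler_expR ler_wpM2r.
Qed.

Lemma bigO_exp1 (a : R) : bigO 1 (fun th => expR (th * a) - 1).
Proof.
apply: eq_bigO (bigO_exp a 1) => th.
by rewrite /series /= big_nat1 /exp_coeff /= fact0 expr0 divr1.
Qed.

Lemma bigO_exp2 (a : R) : bigO 2 (fun th => expR (th * a) - (1 + th * a)).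
Proof.
apply: eq_bigO (bigO_exp a 2) => th.
by rewrite /series /= !big_nat_recr//= big_geq// /exp_coeff /= !factS fact0 expr0 !divr1 add0r expr1.
Qed.

Lemma bigO_exp3 (a : R) : bigO 3 (fun th => expR (th * a) - (1 + th * a + th ^+ 2 * a ^+ 2 / 2%:R)).
Proof.
apply: eq_bigO (bigO_exp a 3) => th.
by rewrite /series /= !big_nat_recr//= big_geq// /exp_coeff /= !factS fact0 expr0 !divr1 add0r expr1 exprMn.
Qed.

Lemma continuous_expM (a : R) : continuous (fun th : R => expR (th * a)).
Proof.
move=> x; apply: (@cvg_comp _ _ _ _ _ _ (nbhs (x * a))); last exact: continuous_expR.
by apply: cvgMr_tmp.
Qed.

Variable q : nat.
Hypothesis q_ge2 : (2 <= q)%N.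
Local Notation qi := (q%:R^-1 : R).

Lemma continuous_add_poisson_blocks xs s :
  continuous (fun th : R => add_poisson_blocks q th xs s).
Proof.
elim: xs s => [|x xs IH] s /=; first by move=> th; exact: cvg_cst.
have E e : continuous (fun th => eigcoord q x (add_poisson_blocks q th xs) e).
  move=> th; case: e => [[]|] /=; first exact: IH.
    apply: cvgB; first exact: IH.
    by apply: cvgMl_tmp; exact: IH.
  apply: cvgB; first apply: cvgB; [exact: IH| |by apply: cvgMl_tmp; exact: IH].
  apply: cvgMl_tmp; apply: cvgB; first exact: IH.
  by apply: cvgMl_tmp; exact: IH.
move=> th; rewrite /add_poisson; apply: cvg_big => [|e _]; first exact: add_continuous.
apply: cvgMr_tmp; apply: cvgM; first exact: E.
exact: continuous_expM.
Qed.

(** Loss of first order for an urn with one ball: a further ball, which has another colour with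
    probability [1 - qi], loses [1 - x] in its block. *)
Definition gf_beta (xs : seq R) : R := (1 - qi) * \sum_(x <- xs) (1 - x).

(** Loss of second order for an empty urn. Two balls fall both in later blocks, or one in the head
    block and one later, or both in the head block; the last case has weight 1/2. *)
Fixpoint gf_kappa (xs : seq R) : R :=
  if xs is x :: xs' then gf_kappa xs' + gf_beta xs' + (1 - qi) * (1 - x) / 2%:R else 0.

(** The three states are treated together with decreasing accuracy, because passing to the next
    state costs a ball, hence a factor [th]. *)
Lemma blocks_expansion xs : (forall x, x \in xs -> x != qi) ->
  [/\ bigO 3 (fun th => add_poisson_blocks q th xs None - (1 - gf_kappa xs * th ^+ 2)),
      bigO 2 (fun th => add_poisson_blocks q th xs (Some false) - (1 - gf_beta xs * th)) &
      bigO 1 (fun th => add_poisson_blocks q th xs (Some true) - 1)].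
Proof.
elim: xs => [_|x xs IH xsP].
  rewrite /gf_beta /= big_nil; split; apply: eq_bigO.
  - by move=> th; rewrite /= mul0r subr0 subrr.
  - by exists 0 => // th; rewrite normr0 mul0r.
  - by move=> th; rewrite /= mulr0 mul0r subr0 subrr.
  - by exists 0 => // th; rewrite normr0 mul0r.
  - by move=> th; rewrite /= subrr.
  - by exists 0 => // th; rewrite normr0 mul0r.
have [|H0 H1 H2] := IH; first by move=> y yx; apply: xsP; rewrite inE yx orbT.
have xq : x - qi != 0 by rewrite subr_eq0 xsP// mem_head.
have q0 := @q_neq0 R q q_ge2.
have bE : gf_beta (x :: xs) = gf_beta xs + (1 - qi) * (1 - x) by rewrite /gf_beta big_cons; ring.
move: H0 H1 H2; set k := gf_kappa xs; set b := gf_beta xs => H0 H1 H2.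
pose e0 th := add_poisson_blocks q th xs None - (1 - k * th ^+ 2).
pose e1 th := add_poisson_blocks q th xs (Some false) - (1 - b * th).
pose e2 th := add_poisson_blocks q th xs (Some true) - 1.
have v0E th : add_poisson_blocks q th xs None = 1 - k * th ^+ 2 + e0 th by rewrite /e0; ring.
have v1E th : add_poisson_blocks q th xs (Some false) = 1 - b * th + e1 th by rewrite /e1; ring.
have v2E th : add_poisson_blocks q th xs (Some true) = 1 + e2 th by rewrite /e2; ring.
pose d := (1 - qi) / (x - qi).
have B2 : bigO 0 (fun th => 1 + e2 th).
  by apply: bigOD; [exact: bigO_cst|exact: (@bigO_weak 0 1)].
have B1 : bigO 0 (fun th => 1 - b * th + e1 th).
  apply: bigOD; last exact: (@bigO_weak 0 2).
  apply: (@eq_bigO _ (fun th => 1 + (- b) * th)); first by move=> th; ring.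
  apply: bigOD; first exact: bigO_cst.
  by apply: (@bigO_weak 0 1); apply: (@bigOM 0 1); [exact: bigO_cst|exact: bigO_id].
have B0 : bigO 0 (fun th => 1 - k * th ^+ 2 + e0 th).
  apply: bigOD; last exact: (@bigO_weak 0 3).
  apply: (@eq_bigO _ (fun th => 1 + (- k) * (th * th))); first by move=> th; ring.
  apply: bigOD; first exact: bigO_cst.
  by apply: (@bigO_weak 0 2); apply: (@bigOM 0 2); [exact: bigO_cst|apply: (@bigOM 1 1); exact: bigO_id].
(* Calculus of orders: [Z] multiplies by a constant, [T] by [th], and [M] by a bounded function. *)
have Z n c f : bigO n f -> bigO n (fun th => c * f th).
  by move=> h; apply: (@bigOM 0 n) => //; exact: bigO_cst.
have T n f : bigO n f -> bigO n.+1 (fun th => th * f th).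
  by move=> h; apply: (@bigOM 1 n) => //; exact: bigO_id.
have M n f g : bigO n f -> bigO 0 g -> bigO n (fun th => f th * g th).
  by move=> hf hg; rewrite -[n]addn0; exact: bigOM.
rewrite bE; split.
- pose rr (a th : R) := expR (th * a) - (1 + th * a + th ^+ 2 * a ^+ 2 / 2%:R).
  have rO a : bigO 3 (rr a) by exact: bigO_exp3.
  pose C0 th := (1 - k * th ^+ 2 + e0 th) - q%:R * ((1 - b * th + e1 th) - d * x * (1 + e2 th)) - d * (1 + e2 th).
  pose C1 th := (1 - b * th + e1 th) - d * x * (1 + e2 th).
  have C1O : bigO 0 C1.
    apply: (@eq_bigO _ (fun th => (1 - b * th + e1 th) + (- (d * x)) * (1 + e2 th))).
      by move=> th; rewrite /C1; ring.
    by apply: bigOD => //; exact: Z.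
  have C0O : bigO 0 C0.
    apply: (@eq_bigO _ (fun th => (1 - k * th ^+ 2 + e0 th) + ((- q%:R) * C1 th + (- d) * (1 + e2 th)))).
      by move=> th; rewrite /C0 /C1; ring.
    by apply: bigOD => //; apply: bigOD; exact: Z.
  (* An exact identity: each exponential is its Taylor polynomial plus a remainder [rr], and what
     the polynomials leave beyond the announced expansion is grouped so that its order 3 is
     visible. *)
  apply: (@eq_bigO _ (fun th => (rr (-1) th * C0 th + (q%:R * (rr (qi - 1) th * C1 th) + d * (rr (x - 1) th * (1 + e2 th))))
     + ((e0 th + th * (e1 th + (-1) * e0 th)) + th * (th * (
        k * th + (2%:R)^-1 * (qi * (-b * th + e1 th) + (1 - qi) * x * e2 th + (-2%:R) * (- b * th + e1 th) + (-k * (th * th) + e0 th))))))).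
    move=> th; rewrite /rr /C0 /C1 /= /add_poisson sum_urn_state /= v0E v1E v2E /d -/b -/k.
    rewrite sub0r.
    move: (expR _) (expR _) (expR _) => E1 E2 E3.
    by field; rewrite ?q0 ?xq //= ?andbT; apply: contra xq => /eqP h; apply/eqP; rewrite -[RHS](mul0r qi) -h; field.
  apply: bigOD; last first.
    apply: bigOD.
      apply: bigOD => //; apply: T; apply: bigOD => //.
      by apply: Z; apply: (@bigO_weak 2 1).
    apply: (T _ _); apply: (T _ _); apply: bigOD; first by apply: Z; exact: bigO_id.
    have b1 : bigO 1 (fun th => - b * th + e1 th).
      by apply: bigOD; [apply: Z; exact: bigO_id|exact: (@bigO_weak 1 1)].
    have b2 : bigO 1 (fun th => - k * (th * th) + e0 th).
      apply: bigOD; last exact: (@bigO_weak 1 2).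
      by apply: Z; apply: (@bigO_weak 1 1); apply: (@bigOM 1 1); exact: bigO_id.
    apply: (Z _ _ _); apply: bigOD => //; apply: bigOD; last exact: Z.
    by apply: bigOD; apply: Z.
  by apply: bigOD; [|apply: bigOD; apply: Z]; apply: M.
- pose rr (a th : R) := expR (th * a) - (1 + th * a).
  have rO a : bigO 2 (rr a) by exact: bigO_exp2.
  apply: (@eq_bigO _ (fun th => (rr (qi - 1) th * ((1 - b * th + e1 th) + (- (d * x)) * (1 + e2 th)) + d * x * (rr (x - 1) th * (1 + e2 th)))
     + (e1 th + th * ((qi - 1) * (- b * th + e1 th) + (1 - qi) * x * e2 th)))).
    move=> th; rewrite /rr /= /add_poisson sum_urn_state /= v1E v2E /d -/b.
    by field; rewrite ?q0 ?xq //= ?andbT; apply: contra xq => /eqP h; apply/eqP; rewrite -[RHS](mul0r qi) -h; field.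
  have b1 : bigO 1 (fun th => - b * th + e1 th).
    by apply: bigOD; [apply: Z; exact: bigO_id|exact: (@bigO_weak 1 1)].
  apply: bigOD; last by apply: bigOD => //; apply: T; apply: bigOD; exact: Z.
  by apply: bigOD; [apply: M => //; apply: bigOD => //; exact: Z|apply: Z; exact: M].
- apply: (@eq_bigO _ (fun th => (expR (th * (x - 1)) - 1) * (1 + e2 th) + e2 th)).
    by move=> th; rewrite /= /add_poisson sum_urn_state /= v2E; ring.
  by apply: bigOD => //; apply: M => //; exact: bigO_exp1.
Qed.

Lemma gf_betaE xs : gf_beta xs = (1 - qi) * \sum_(j < size xs) (1 - nth 0 xs j).
Proof. by rewrite /gf_beta (big_nth 0) big_mkord. Qed.

(** The weight [(2j + 1) / 2] is the integral of t over [j, j + 1]; it will match the mean of B* on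
    block j. *)
Lemma gf_kappaE xs : gf_kappa xs =
  (1 - qi) * \sum_(j < size xs) (1 - nth 0 xs j) * (j.*2.+1)%:R / 2%:R.
Proof.
elim: xs => [|x xs IH] /=; first by rewrite big_ord0 mulr0.
rewrite IH gf_betaE big_ord_recl /=.
have -> : \sum_(i < size xs) (1 - nth 0 xs (0 + i)) * ((bump 0 i).*2.+1)%:R / 2%:R =
  \sum_(j < size xs) (1 - nth 0 xs j) * (j.*2.+1)%:R / 2%:R + \sum_(j < size xs) (1 - nth 0 xs j).
  rewrite -big_split /=; apply: eq_bigr => j _.
  by rewrite add0n /bump /= add1n doubleS -[j.*2.+3]addn2 natrD; field.
by rewrite double0; ring.
Qed.

End Expansion.

(** * Infinite products *)

Section ProductLimit.
Context {R : realType}.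

Lemma prod_dev (a : nat -> R) n :
  `|\prod_(i < n) a i - 1| <= expR (\sum_(i < n) `|a i - 1|) - 1.
Proof.
elim: n => [|n IH]; first by rewrite !big_ord0 subrr normr0 expR0 subrr.
rewrite !big_ord_recr /= expRD; set P := \prod_(i < n) _ in IH *; set S := expR _ in IH *.
have -> : P * a n - 1 = (P - 1) * a n + (a n - 1) by ring.
apply: le_trans (ler_normD _ _) _; rewrite normrM.
have h : `|a n| <= 1 + `|a n - 1|.
  by rewrite -{1}(subrK 1 (a n)) addrC; apply: le_trans (ler_normD _ _) _; rewrite normr1.
have h1 := expR_ge1Dx `|a n - 1|.
have h2 : 0 <= S - 1 by apply: le_trans IH.
have h3 := normr_ge0 (a n - 1); have h4 := normr_ge0 (a n); have h5 := normr_ge0 (P - 1).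
have S0 : 0 <= S by exact: expR_ge0.
apply: (@le_trans _ _ ((S - 1) * (1 + `|a n - 1|) + `|a n - 1|)).
  by rewrite lerD2r ler_pM.
have : S * (1 + `|a n - 1|) <= S * expR `|a n - 1| by rewrite ler_wpM2l.
lra.
Qed.

Lemma cauchy_tail_cvg (u e : R ^nat) : (forall m n, (m <= n)%N -> `|u n - u m| <= e m) ->
  e @ \oo --> 0 -> cvgn u.
Proof.
move=> ue e0; apply/cauchy_cvgP; apply/cauchy_exP => eps eps0.
have [m hm] := cvgn_dist e0 eps0.
exists (u m); exists m => // n /= mn.
rewrite /ball /= distrC; apply: le_lt_trans (ue _ _ mn) _.
by apply: le_lt_trans (ler_norm _) _; have := hm m (leqnn _); rewrite sub0r normrN.
Qed.

Variables (G : R -> R) (kappa : R).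
Hypothesis G_cont : continuous G.
Hypothesis GO : bigO 3 (fun th => G th - (1 - kappa * th ^+ 2)).

(** Removing the second-order term leaves factors [1 + O(th^3)]. Their product is uniformly
    convergent, while that of the [G (th i)] is not: squares may escape to large indices. *)
Let Rf th := G th * expR (kappa * th ^+ 2).

Lemma bigO_Rf : bigO 3 (fun th => Rf th - 1).
Proof.
have E : bigO 4 (fun th => expR (kappa * th ^+ 2) - (1 + kappa * th ^+ 2)).
  exists (kappa ^+ 2 * expR (4%:R * `|kappa|)); first by rewrite mulr_ge0 ?sqr_ge0 ?expR_ge0.
  move=> th /andP[t0 t2].
  have := expR_taylor (kappa * th ^+ 2) 2.
  rewrite /series /= !big_nat_recr//= big_geq// /exp_coeff /= !factS fact0 expr0 !divr1 add0r expr1.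
  move=> /le_trans; apply; rewrite real_normK ?num_real// exprMn -exprM.
  rewrite mulrAC ler_wpM2r ?exprn_ge0// ler_wpM2l ?sqr_ge0// ler_expR.
  rewrite normrM mulrC ler_wpM2r// normrX (ger0_norm t0) expr2 (_ : 4 = 2 * 2); last by ring.
  exact: ler_pM.
have T2 : bigO 2 (fun th : R => th ^+ 2).
  by exists 1 => // th /andP[t0 _]; rewrite mul1r ger0_norm// exprn_ge0.
have B : bigO 0 (fun th => expR (kappa * th ^+ 2)).
  apply: (@eq_bigO _ _ (fun th => (expR (kappa * th ^+ 2) - (1 + kappa * th ^+ 2)) + (1 + kappa * th ^+ 2))).
    by move=> th; ring.
  apply: bigOD; first exact: (@bigO_weak _ 0 4).
  apply: bigOD; first exact: bigO_cst.
  by apply: (@bigO_weak _ 0 2); apply: (@bigOM _ 0 2) => //; exact: bigO_cst.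
apply: (@eq_bigO _ _ (fun th => (G th - (1 - kappa * th ^+ 2)) * expR (kappa * th ^+ 2) +
   ((expR (kappa * th ^+ 2) - (1 + kappa * th ^+ 2)) * (1 + (- kappa) * th ^+ 2) + (- kappa ^+ 2) * (th ^+ 2 * th ^+ 2)))).
  by move=> th; rewrite /Rf; ring.
apply: bigOD; first by rewrite -[X in bigO X]addn0; exact: bigOM.
apply: (@bigO_weak _ 3 1); apply: bigOD.
  apply: (@bigOM _ 4 0) => //; apply: bigOD; first exact: bigO_cst.
  by apply: (@bigO_weak _ 0 2); apply: (@bigOM _ 0 2) => //; exact: bigO_cst.
by apply: (@bigOM _ 0 4); [exact: bigO_cst|exact: (@bigOM _ 2 2)].
Qed.

(** The arrays in use have sums of squares tending to [delta ^+ 2 <= 1]; the bound 4 leaves room for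
    finite [N] and keeps the entries below 2. *)
Definition l2_array (th : nat -> R) := [/\ forall i, 0 <= th i,
  forall i, th i.+1 <= th i & forall n, \sum_(i < n) th i ^+ 2 <= 4%:R].

(** The first [i + 1] squares are all at least [th i ^+ 2]. *)
Lemma l2_array_le th i : l2_array th -> th i <= 2%:R / Num.sqrt (i.+1%:R).
Proof.
move=> [t0 tdec ts].
have tm : forall j k, (j <= k)%N -> th k <= th j.
  by move=> j k jk; move/nonincreasing_seqP: tdec => /(_ _ _ jk).
have sp : 0 < Num.sqrt (i.+1%:R : R) by rewrite sqrtr_gt0 ltr0n.
rewrite ler_pdivlMr// -(@ler_pXn2r _ 2) ?nnegrE ?mulr_ge0 ?sqrtr_ge0//.
rewrite exprMn sqr_sqrtr// (_ : 2 ^+ 2 = 4%:R); last by ring.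
apply: le_trans (ts i.+1).
apply: (@le_trans _ _ (\sum_(j < i.+1) th i ^+ 2)); first by rewrite sumr_const card_ord mulr_natr.
apply: ler_sum => j _.
by rewrite ler_pXn2r// ?nnegrE//; apply: tm; rewrite -ltnS.
Qed.

(** By monotonicity the cubes from index [m] on sum to at most [4 * th m], which [l2_array_le] makes
    small uniformly in the array. This uniformity permits the exchange of limits in
    [gf_product_limit]. *)
Lemma prod_Rf_tail : exists2 e : R ^nat, e @ \oo --> 0 &
  forall th, l2_array th -> forall m n, (m <= n)%N ->
    `|\prod_(i < n) Rf (th i) - \prod_(i < m) Rf (th i)| <= e m.
Proof.
have [c c0 hc] := bigO_Rf.
have bnd th : l2_array th -> forall m n, \sum_(i < n) `|Rf (th (m + i)%N) - 1| <=
    8%:R * c / Num.sqrt (m.+1%:R).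
  move=> /[dup] lt [t0 tdec ts] m n.
  have tm : forall j k, (j <= k)%N -> th k <= th j.
    by move=> j k jk; move/nonincreasing_seqP: tdec => /(_ _ _ jk).
  have t2 j : th j <= 2%:R.
    apply: le_trans (tm 0%N j (leq0n _)) _; apply: le_trans (l2_array_le 0 lt) _.
    by rewrite sqrtr1 divr1.
  apply: (@le_trans _ _ (\sum_(i < n) c * th m * th (m + i)%N ^+ 2)).
    apply: ler_sum => i _; apply: le_trans (hc _ _) _; first by rewrite t0 t2.
    rewrite -mulrA exprS ler_wpM2l// ler_wpM2r ?exprn_ge0//; apply: tm; exact: leq_addr.
  rewrite -mulr_sumr.
  apply: (@le_trans _ _ (c * th m * 4%:R)).
    apply: ler_wpM2l; first exact: mulr_ge0.
    apply: le_trans (ts (m + n)%N); rewrite big_split_ord /= lerDr.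
    by apply: sumr_ge0 => i _; exact: sqr_ge0.
  have -> : 8%:R * c / Num.sqrt m.+1%:R = c * 4%:R * (2%:R / Num.sqrt m.+1%:R) by ring.
  by rewrite [c * _ * _]mulrAC ler_wpM2l// ?mulr_ge0//; exact: l2_array_le.
pose K := expR (8%:R * c).
exists (fun m => K * (expR (8%:R * c / Num.sqrt (m.+1%:R)) - 1)).
  rewrite -[X in _ --> X](mulr0 K); apply: cvgMl_tmp.
  rewrite -[X in _ --> X](subrr 1); apply: cvgB; last exact: cvg_cst.
  rewrite -[X in _ --> X]expR0; apply: cvgn_expR.
  rewrite -[X in _ --> X](mulr0 (8%:R * c)); apply: cvgMl_tmp.
  apply/cvgrPdist_lt => eps eps0; exists (Num.truncn ((eps^-1) ^+ 2)).+1 => // m /= hm.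
  rewrite sub0r normrN ger0_norm ?invr_ge0 ?sqrtr_ge0// invf_plt ?posrE ?sqrtr_gt0 ?ltr0n//.
  rewrite -(@ltr_pXn2r _ 2) ?nnegrE ?invr_ge0 ?sqrtr_ge0 ?(ltW eps0)// sqr_sqrtr//.
  apply: lt_trans (truncnS_gt _) _; rewrite ltr_nat.
  exact: leq_ltn_trans hm _.
move=> th lt m n mn; rewrite -(subnKC mn) big_split_ord /=.
set A := \prod_(i < m) _; set B := \prod_(i < n - m) _.
rewrite -[X in _ - X]mulr1 -mulrBr normrM; apply: ler_pM => //.
  have := prod_dev (fun i => Rf (th i)) m; rewrite -/A => hA.
  have : `|A| <= `|A - 1| + 1 by rewrite -{1}(subrK 1 A); apply: le_trans (ler_normD _ _) _; rewrite normr1.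
  move=> /le_trans; apply; rewrite -lerBrDr; apply: le_trans hA _; rewrite lerD2r ler_expR.
  by have := bnd _ lt 0%N m; rewrite sqrtr1 divr1.
apply: le_trans (prod_dev (fun i => Rf (th (m + i)%N)) _) _.
by rewrite lerD2r ler_expR; exact: bnd.
Qed.

Lemma prodG_Rf (th : nat -> R) n : \prod_(i < n) G (th i) =
  expR (- (kappa * \sum_(i < n) th i ^+ 2)) * \prod_(i < n) Rf (th i).
Proof.
rewrite /Rf big_split /= -expR_sum -mulr_sumr mulrCA -expRD addrC subrr expR0 mulr1.
by [].
Qed.

(** The product of the [Rf] passes to the limit termwise, whereas the sum of squares tends to [c']
    and not to the sum [sg] of the limits. The missing mass [c' - sg] remains in the exponential:
    this is the contribution of the urns that vanish individually. *)
Lemma gf_product_limit (th : nat -> nat -> R) (th' : nat -> R) (c : nat -> R) (c' sg : R) :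
  (forall N, l2_array (th N)) -> (forall i, (fun N => th N i) @ \oo --> th' i) ->
  (forall N, (fun n => \sum_(i < n) th N i ^+ 2) @ \oo --> c N) -> c @ \oo --> c' ->
  (fun n => \sum_(i < n) th' i ^+ 2) @ \oo --> sg ->
  exists L L', [/\ forall N, (fun n => \prod_(i < n) G (th N i)) @ \oo --> L N,
    (fun n => \prod_(i < n) G (th' i)) @ \oo --> L' &
    L @ \oo --> expR (- (kappa * (c' - sg))) * L'].
Proof.
move=> la tc ts cc sc.
have la' : l2_array th'.
  split=> [i|i|n].
  - by apply: (cvg_le _ (cvg_cst 0) (tc i)) => N; case: (la N).
  - by apply: (cvg_le _ (tc i.+1) (tc i)) => N; case: (la N).
  - have h : (fun N => \sum_(i < n) th N i ^+ 2) @ \oo --> \sum_(i < n) th' i ^+ 2.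
      by apply: cvg_big => [|i _]; [exact: add_continuous|apply: cvgM; exact: tc].
    have c4 : (fun _ : nat => 4%:R : R) @ \oo --> (4%:R : R) by exact: cvg_cst.
    by apply: (@cvg_le R _ _ _ _ _ h c4) => N; case: (la N).
have [e e0 he] := prod_Rf_tail.
have cRf : continuous Rf.
  move=> x; apply: cvgM; first exact: G_cont.
  apply: (@cvg_comp _ _ _ _ _ _ (nbhs (kappa * x ^+ 2))); last exact: continuous_expR.
  by apply: cvgMl_tmp; apply: cvgM; exact: cvg_id.
have cv t : l2_array t -> cvgn (fun n => \prod_(i < n) Rf (t i)).
  by move=> lt; apply: (cauchy_tail_cvg (e := e)) => // m n; exact: he.
pose l N := limn (fun n => \prod_(i < n) Rf (th N i)).
pose l' := limn (fun n => \prod_(i < n) Rf (th' i)).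
have lim_dist t m : l2_array t -> `|limn (fun n => \prod_(i < n) Rf (t i)) - \prod_(i < m) Rf (t i)| <= e m.
  move=> lt.
  have h : (fun n => `|\prod_(i < n + m) Rf (t i) - \prod_(i < m) Rf (t i)|) @ \oo -->
     `|limn (fun n => \prod_(i < n) Rf (t i)) - \prod_(i < m) Rf (t i)|.
    apply: cvg_norm; apply: cvgB; last exact: cvg_cst.
    by rewrite (cvg_shiftn m (fun n => \prod_(i < n) Rf (t i))); exact: cv.
  by apply: (cvg_le _ h (cvg_cst (e m))) => n; apply: he => //; exact: leq_addl.
have ll : l @ \oo --> l'.
  apply/cvgrPdist_lt => eps eps0.
  have [m hm] := cvgn_dist e0 (divr_gt0 eps0 (ltr0n R 4 : 0 < 4%:R)).
  have em : `|e m| < eps / 4%:R by have := hm m (leqnn _); rewrite sub0r normrN.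
  have em' := le_lt_trans (ler_norm _) em.
  have : (fun N => \prod_(i < m) Rf (th N i)) @ \oo --> \prod_(i < m) Rf (th' i).
    apply: cvg_big => [|i _]; first exact: mul_continuous.
    apply: (@cvg_comp _ _ _ _ _ _ (nbhs (th' i))); first exact: tc.
    exact: cRf.
  move=> /cvgn_dist /(_ _ (divr_gt0 eps0 (ltr0n R 4 : 0 < 4%:R))) [N0 hN].
  exists N0 => // N /= NN.
  have h1 := lim_dist _ m (la N); have h2 := lim_dist _ m la'.
  have h3 : `|\prod_(i < m) Rf (th' i) - \prod_(i < m) Rf (th N i)| < eps / 4%:R by exact: hN.
  rewrite -/(l N) in h1; rewrite -/l' in h2.
  move: h1 h2 h3 em'; set a := l N; set b := l'; set p1 := \prod_(i < m) _; set p2 := \prod_(i < m) _.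
  move=> h1 h2 h3 em'.
  have -> : b - a = (b - p2) + (p2 - p1) - (a - p1) by ring.
  apply: le_lt_trans (ler_normB _ _) _.
  apply: (@le_lt_trans _ _ (`|b - p2| + `|p2 - p1| + `|a - p1|)); first by rewrite lerD2r ler_normD.
  lra.
exists (fun N => expR (- (kappa * c N)) * l N), (expR (- (kappa * sg)) * l').
have ex (u : R ^nat) (a : R) : u @ \oo --> a -> (fun n => expR (- (kappa * u n))) @ \oo --> expR (- (kappa * a)).
  by move=> ua; apply: cvgn_expR; apply: cvgN; apply: cvgMl_tmp.
split.
- move=> N; under eq_fun do rewrite prodG_Rf.
  by apply: cvgM; [exact: ex|exact: cv].
- under eq_fun do rewrite prodG_Rf.
  by apply: cvgM; [exact: ex|exact: cv].
- rewrite mulrA -expRD (_ : - (kappa * (c' - sg)) + - (kappa * sg) = - (kappa * c')); last by ring.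
  by apply: cvgM => //; exact: ex.
Qed.

End ProductLimit.

(** * Expectations of bounded random variables *)

Section Discrete.
Context {d : measure_display} {T : measurableType d} {R : realType}.

(** Stated on fibres, so that no sigma-algebra on [S] has to be chosen; for countable [S] all
    preimages are then measurable. *)
Definition discrete_rv (S : Type) (V : T -> S) := forall v, measurable (V @^-1` [set v]).

Lemma discrete_preimage (S : countType) (V : T -> S) (U : set S) :
  discrete_rv V -> measurable (V @^-1` U).
Proof.
move=> mV.
rewrite (_ : _ @^-1` _ = \bigcup_(n : nat) [set w | pickle (V w) = n /\ U (V w)]); last first.
  by apply/seteqP; split => w /=; [move=> ?; exists (pickle (V w))|case=> n _ []].
apply: bigcup_measurable => n _.
case E : (pickle_inv n : option S) => [v|]; last first.
  rewrite (_ : [set w | _] = set0) //; apply/seteqP; split => w //= [h _].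
  by have := pickleK_inv (V w); rewrite h E.
have [Uv|Uv] := pselect (U v).
  rewrite (_ : [set w | _] = V @^-1` [set v]) //; apply/seteqP; split => w /=.
    by move=> [h _]; apply/esym/Some_inj; rewrite -E -h pickleK_inv.
  move=> ->; split => //.
  by have := @pickle_invK S n; rewrite E /= => ->.
rewrite (_ : [set w | _] = set0) //; apply/seteqP; split => w //= [h Uw].
by have := pickleK_inv (V w); rewrite h E => -[vw]; apply: Uv; rewrite vw.
Qed.

Lemma discrete_comp (S : countType) (S' : Type) (V : T -> S) (g : S -> S') :
  discrete_rv V -> discrete_rv (g \o V).
Proof. by move=> mV v; rewrite comp_preimage; exact: discrete_preimage. Qed.

Lemma discrete_pair (S S' : Type) (V : T -> S) (V' : T -> S') :
  discrete_rv V -> discrete_rv V' -> discrete_rv (fun w => (V w, V' w)).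
Proof.
move=> mV mV' [v v'].
rewrite (_ : _ @^-1` _ = V @^-1` [set v] `&` V' @^-1` [set v']); first exact: measurableI.
by apply/seteqP; split => w /= [-> ->].
Qed.

Lemma discrete_cst (S : Type) (v : S) : discrete_rv (fun _ : T => v).
Proof.
move=> u; have [->|vu] := pselect (v = u).
  by rewrite (_ : _ @^-1` _ = setT)//; apply/seteqP; split.
by rewrite (_ : _ @^-1` _ = set0)//; apply/seteqP; split.
Qed.

Lemma discrete_map (I : Type) (S : countType) (V : I -> T -> S) (s : seq I) :
  (forall i, discrete_rv (V i)) -> discrete_rv (fun w => [seq V i w | i <- s]).
Proof.
move=> mV; elim: s => [|i s IH]; first exact: discrete_cst.
exact: (discrete_comp (fun p => p.1 :: p.2) (discrete_pair (mV i) IH)).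
Qed.

Lemma measurable_discrete (S : countType) (V : T -> S) (g : S -> R) :
  discrete_rv V -> measurable_fun setT (g \o V).
Proof. by move=> mV _ Y _; rewrite setTI comp_preimage; exact: discrete_preimage. Qed.

End Discrete.

Lemma fine_prode (R : realType) (I : Type) (s : seq I) (f : I -> \bar R) :
  (forall i, f i \is a fin_num) -> fine (\prod_(i <- s) f i)%E = \prod_(i <- s) fine (f i).
Proof.
move=> ff; elim: s => [|i s IH]; first by rewrite !big_nil.
by rewrite !big_cons fineM ?IH//; exact: prode_fin_num.
Qed.

Section Expectation.
Context {d : measure_display} {T : measurableType d} {R : realType} (P : probability T R).
Implicit Types (f g : T -> R) (A : set T).
Local Notation Ex f := (\int[P]_w f w).
Local Notation Pr A := (fine (P A)).

(** Bounded measurable functions: a class stable under all operations below and integrable, so that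
    expectations are handled without further side conditions. *)
Definition bmf f := measurable_fun setT f /\ exists M, forall w, `|f w| <= M.

Lemma PrE A : measurable A -> P A = (Pr A)%:E.
Proof. by move=> mA; rewrite fineK// fin_num_measure. Qed.

Lemma Pr_ge0 A : 0 <= Pr A. Proof. by rewrite fine_ge0. Qed.

Lemma Pr_le1 A : measurable A -> Pr A <= 1.
Proof. by move=> mA; rewrite -lee_fin -PrE//; exact: probability_le1. Qed.

Lemma Pr_le A B : measurable A -> measurable B -> A `<=` B -> Pr A <= Pr B.
Proof. by move=> mA mB AB; rewrite -lee_fin -!PrE//; apply: le_measure => //; rewrite inE. Qed.

Lemma PrC A : measurable A -> Pr (~` A) = 1 - Pr A.
Proof.
by move=> mA; apply: EFin_inj; rewrite -PrE ?EFinB -?PrE//; [exact: probability_setC|exact: measurableC].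
Qed.

Lemma bmf_integrable f : bmf f -> P.-integrable setT (EFin \o f).
Proof.
move=> [mf [M fM]]; apply: measurable_bounded_integrable => //.
  by apply: le_lt_trans (probability_le1 P measurableT) _; rewrite ltry.
exists M; split; first exact: num_real.
by move=> x Mx w _ /=; apply: le_trans (fM w) _; exact: ltW.
Qed.

Lemma bmf_cst (c : R) : bmf (fun=> c).
Proof. by split; [exact: measurable_cst|exists `|c|]. Qed.

Lemma bmfD f g : bmf f -> bmf g -> bmf (fun w => f w + g w).
Proof.
move=> [mf [M fM]] [mg [N gN]]; split; first exact: measurable_funD.
by exists (M + N) => w; apply: le_trans (ler_normD _ _) _; exact: lerD.
Qed.

Lemma bmfM f g : bmf f -> bmf g -> bmf (fun w => f w * g w).
Proof.
move=> [mf [M fM]] [mg [N gN]]; split; first exact: measurable_funM.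
by exists (M * N) => w; rewrite normrM; exact: ler_pM.
Qed.

Lemma bmfB f g : bmf f -> bmf g -> bmf (fun w => f w - g w).
Proof.
move=> [mf [M fM]] [mg [N gN]]; split; first exact: measurable_funB.
by exists (M + N) => w; apply: le_trans (ler_normB _ _) _; exact: lerD.
Qed.

Lemma bmf_norm f : bmf f -> bmf (fun w => `|f w|).
Proof.
move=> [mf [M fM]]; split; first exact: (measurableT_comp (@normr_measurable R setT)).
by exists M => w; rewrite normr_id.
Qed.

Lemma bmf_indic A : measurable A -> bmf \1_A.
Proof.
move=> mA; split; first exact: measurable_indic.
by exists 1 => w; rewrite indicE; case: (_ \in _); rewrite ?normr1 ?normr0.
Qed.

Lemma bmf_sum (I : Type) (s : seq I) (h : I -> T -> R) :
  (forall i, bmf (h i)) -> bmf (fun w => \sum_(i <- s) h i w).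
Proof.
move=> bh; elim: s => [|i s IH].
  by under [X in bmf X]eq_fun do rewrite big_nil; exact: bmf_cst.
by under [X in bmf X]eq_fun do rewrite big_cons; exact: bmfD.
Qed.

Lemma bmf_prod (I : Type) (s : seq I) (h : I -> T -> R) :
  (forall i, bmf (h i)) -> bmf (fun w => \prod_(i <- s) h i w).
Proof.
move=> bh; elim: s => [|i s IH].
  by under [X in bmf X]eq_fun do rewrite big_nil; exact: bmf_cst.
by under [X in bmf X]eq_fun do rewrite big_cons; exact: bmfM.
Qed.

Lemma bmf_discrete (S : countType) (V : T -> S) (g : S -> R) :
  discrete_rv V -> (exists M, forall v, `|g v| <= M) -> bmf (fun w => g (V w)).
Proof. by move=> mV [M gM]; split; [exact: (measurable_discrete g mV)|exists M]. Qed.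

Lemma Ex_cst (c : R) : Ex (fun=> c) = c.
Proof. by rewrite Rintegral_cst// [X in fine X](probability_setT P) /= mulr1. Qed.

Lemma ExD f g : bmf f -> bmf g -> Ex (fun w => f w + g w) = Ex f + Ex g.
Proof. by move=> bf bg; apply: RintegralD => //; exact: bmf_integrable. Qed.

Lemma ExB f g : bmf f -> bmf g -> Ex (fun w => f w - g w) = Ex f - Ex g.
Proof. by move=> bf bg; apply: RintegralB => //; exact: bmf_integrable. Qed.

Lemma ExZ (c : R) f : bmf f -> Ex (fun w => c * f w) = c * Ex f.
Proof. by move=> bf; apply: RintegralZl => //; exact: bmf_integrable. Qed.

Lemma Ex_le f g : bmf f -> bmf g -> (forall w, f w <= g w) -> Ex f <= Ex g.
Proof. by move=> bf bg fg; apply: le_Rintegral => //; exact: bmf_integrable. Qed.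

Lemma Ex_ge0 f : (forall w, 0 <= f w) -> 0 <= Ex f.
Proof. by move=> f0; apply: Rintegral_ge0. Qed.

Lemma Ex_indic A : measurable A -> Ex \1_A = Pr A.
Proof. by move=> mA; rewrite /Rintegral integral_indic// setIT. Qed.

Lemma Ex_sum (I : Type) (s : seq I) (h : I -> T -> R) :
  (forall i, bmf (h i)) -> Ex (fun w => \sum_(i <- s) h i w) = \sum_(i <- s) Ex (h i).
Proof.
move=> bh; elim: s => [|i s IH].
  by rewrite big_nil; under eq_Rintegral do rewrite big_nil; exact: Ex_cst.
rewrite big_cons -IH -ExD//; last exact: bmf_sum.
by under eq_Rintegral do rewrite big_cons.
Qed.

Lemma Ex_norm f : bmf f -> `|Ex f| <= Ex (fun w => `|f w|).
Proof. by move=> bf; apply: le_normr_Rintegral => //; exact: bmf_integrable. Qed.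

Lemma Ex_cvg (h : nat -> T -> R) f (M : R) : (forall n, measurable_fun setT (h n)) ->
  (forall n w, `|h n w| <= M) -> measurable_fun setT f ->
  {ae P, forall w, h ^~ w @ \oo --> f w} -> (fun n => Ex (h n)) @ \oo --> Ex f.
Proof.
move=> mh hM mf hf.
have [|||||iF _] := @dominated_convergence _ T R P setT measurableT
    (fun n w => (h n w)%:E) (fun w => (f w)%:E) (fun=> M%:E).
- by move=> n; exact/measurable_EFinP.
- exact/measurable_EFinP.
- by apply: filterS hf => w hw _; apply: cvg_EFin => //; exact: nearW.
- by apply: (@bmf_integrable (fun=> M)); exact: bmf_cst.
- by apply: aeW => w n _; rewrite lee_fin.
rewrite -[X in _ --> X]fineK; first by move/fine_cvg.
by apply: integrable_fin_num => //.
Qed.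

Lemma Ex_ae_eq f g : measurable_fun setT f -> measurable_fun setT g ->
  {ae P, forall w, f w = g w} -> Ex f = Ex g.
Proof.
move=> mf mg fg; rewrite /Rintegral; congr fine; apply: ae_eq_integral => //.
- exact/measurable_EFinP.
- exact/measurable_EFinP.
- by apply: filterS fg => w -> _.
Qed.

Lemma Ex_le_ae (f g : T -> R) : bmf f -> bmf g -> {ae P, forall w, f w <= g w} ->
  Ex f <= Ex g.
Proof.
move=> [mf [M fM]] [mg [N gN]] fg.
(* The minimum is below [g] everywhere and equals [f] almost everywhere. *)
have mm : measurable_fun setT (fun w => Num.min (f w) (g w)) by exact: measurable_minr.
rewrite (@Ex_ae_eq f (fun w => Num.min (f w) (g w)))//.
  apply: Ex_le; last by move=> w; rewrite ge_min lexx orbT.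
    split => //; exists (M + N) => w; have := fM w; have := gN w.
    have := normr_ge0 (f w); have := normr_ge0 (g w).
    by rewrite /Num.min; case: ifP => _; lra.
  by split => //; exists N.
by apply: filterS fg => w fg; exact/esym/min_idPl.
Qed.

Lemma Ex_close_ae (f g : T -> R) (A : set T) (c M : R) : bmf f -> bmf g -> measurable A ->
  {ae P, forall w, `|f w - g w| <= c + M * \1_A w} ->
  `|Ex f - Ex g| <= c + M * Pr A.
Proof.
move=> bf bg mA fg; rewrite -ExB//; have bA := bmf_indic mA.
apply: le_trans (Ex_norm (bmfB bf bg)) _; rewrite -{1}(Ex_cst c) -Ex_indic// -ExZ// -ExD//; last 2 first.
- exact: bmf_cst.
- by apply: bmfM => //; exact: bmf_cst.
apply: Ex_le_ae => //; first by apply: bmf_norm; exact: bmfB.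
by apply: bmfD; [exact: bmf_cst|apply: bmfM => //; exact: bmf_cst].
Qed.

Lemma Pr_cvg0 (A : nat -> set T) : (forall n, measurable (A n)) ->
  {ae P, forall w, exists m, forall n, (m <= n)%N -> ~ A n w} -> (fun n => Pr (A n)) @ \oo --> 0.
Proof.
move=> mA hA; rewrite -(Ex_cst 0).
rewrite (_ : (fun n => _) = (fun n => Ex \1_(A n))); last by apply/funext => n; rewrite Ex_indic.
apply: (@Ex_cvg (fun n => \1_(A n)) (fun=> 0) 1).
- by move=> n; exact: measurable_indic.
- by move=> n w; rewrite indicE; case: (_ \in _); rewrite ?normr1 ?normr0.
- exact: measurable_cst.
- apply: filterS hA => w [m hm]; apply: dist_cvgn => e e0; exists m => n mn.
  by rewrite indicE memNset ?subrr ?normr0//; exact: hm.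
Qed.

Lemma Pr0_ae (A : set T) : measurable A -> Pr A = 0 -> {ae P, forall w, ~ A w}.
Proof.
move=> mA A0; exists A; split => //; first by rewrite PrE// A0.
by move=> w /= /contrapT.
Qed.

Section Independent.
Context {I : eqType} {S : countType}.
Variables (F : I -> set (set T)) (V : I -> T -> S) (g : I -> S -> R).
Hypothesis indep : mutual_indep P F.
Hypothesis FV : forall i v, F i (V i @^-1` [set v]).
Hypothesis mV : forall i, discrete_rv (V i).
Hypothesis g_bnd : forall i, exists M, forall v, `|g i v| <= M.

Let indV (J : seq I) (v : I -> S) w : R := \prod_(i <- J) \1_(V i @^-1` [set v i]) w.

Let indVE J v w : indV J v w = \1_(\bigcap_(i in [set` J]) (V i @^-1` [set v i])) w.
Proof.
rewrite /indV; elim: J => [|i J IH].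
  by rewrite big_nil indicE mem_set.
rewrite big_cons IH !indicE -natrM mulnb; congr ((nat_of_bool _)%:R).
apply/andP/idP => [[/set_mem h1 /set_mem h2]|/set_mem h].
  by apply/mem_set => j /=; rewrite inE => /orP[/eqP ->//|jJ]; apply: h2.
by split; apply/mem_set; [apply: h; rewrite /= mem_head|move=> j /= jJ; apply: h; rewrite /= inE jJ orbT].
Qed.

(** Independence is given for events. The induction turns the indicators of the list [J2] into
    functions in [J1] one index at a time, by expanding [g i (V i)] over the values of [V i]. *)
Lemma Ex_prod_indep_aux (J1 J2 : seq I) (v : I -> S) : uniq (J1 ++ J2) ->
  Ex (fun w => (\prod_(i <- J1) g i (V i w)) * indV J2 v w) =
  (\prod_(i <- J1) Ex (fun w => g i (V i w))) * \prod_(i <- J2) Pr (V i @^-1` [set v i]).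
Proof.
have bg i : bmf (fun w => g i (V i w)) by exact: bmf_discrete.
elim: J1 J2 v => [|i J1 IH] J2 v.
  rewrite cat0s => uJ; rewrite big_nil mul1r.
  under eq_Rintegral do rewrite big_nil mul1r indVE.
  have mJ : measurable (\bigcap_(i in [set` J2]) (V i @^-1` [set v i])).
    by apply: fin_bigcap_measurable => // i _; exact: mV.
  rewrite Ex_indic// (indep uJ)//.
  by rewrite fine_prode// => j; apply: fin_num_measure; exact: mV.
move=> uJ.
have uJ' : uniq (J1 ++ i :: J2).
  by rewrite -cat_rcons -cats1 -(perm_uniq (s1 := (i :: J1) ++ J2))// perm_cat2r perm_sym cats1 perm_rcons.
have iJ2 : i \notin J2 by move: uJ; rewrite /= mem_cat negb_or => /andP[/andP[]].
pose X w := (\prod_(j <- J1) g j (V j w)) * indV J2 v w.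
have bX : bmf X.
  by apply: bmfM; [exact: bmf_prod|apply: bmf_prod => j; apply: bmf_indic; exact: mV].
(* Term number [k] of this expansion, along the enumeration of [S] by [pickle]; numbers that encode
   no value contribute 0. *)
pose gk k w : R := if (pickle_inv k : option S) is Some u then g i u * \1_(V i @^-1` [set u]) w else 0.
have bgk k : bmf (gk k).
  rewrite /gk; case: (pickle_inv k) => [u|]; last exact: bmf_cst.
  by apply: bmfM; [exact: bmf_cst|apply: bmf_indic; exact: mV].
have sgk n w : \sum_(k < n) gk k w = if (pickle (V i w) < n)%N then g i (V i w) else 0.
  have E k : gk k w = if k == pickle (V i w) then g i (V i w) else 0.
    rewrite /gk; case: eqP => [->|h].
      by rewrite pickleK_inv indicE mem_set// mulr1.
    case E : (pickle_inv k : option S) => [u|//].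
    rewrite indicE memNset ?mulr0// => /= hu; apply: h.
    by have := @pickle_invK S k; rewrite E /= hu.
  under eq_bigr do rewrite E.
  case: ltnP => [lt|le].
    rewrite (bigD1 (Ordinal lt))//= eqxx big1 ?addr0// => k /negbTE.
    by rewrite -val_eqE /= => ->.
  by rewrite big1// => k _; rewrite ltn_eqF// (leq_trans (ltn_ord k)).
have [M gM] := g_bnd i; have M0 : 0 <= M := le_trans (normr_ge0 _) (gM (v i)).
have sb n w : `|\sum_(k < n) gk k w| <= M.
  by rewrite sgk; case: ifP => // _; rewrite normr0.
have cg (Y : T -> R) : bmf Y ->
   (fun n => Ex (fun w => (\sum_(k < n) gk k w) * Y w)) @ \oo --> Ex (fun w => g i (V i w) * Y w).
  move=> [mY [N YN]]; apply: (@Ex_cvg _ _ (M * N)).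
  - by move=> n; apply: measurable_funM => //; have [] := @bmf_sum _ (index_enum 'I_n) (fun k => gk k) (fun k => bgk k).
  - by move=> n w; rewrite normrM; apply: ler_pM.
  - by have [] := bmfM (bg i) (conj mY (ex_intro _ N YN)).
  - apply: aeW => w; apply: cvgMr_tmp; apply: dist_cvgn => e e0.
    exists (pickle (V i w)).+1 => n hn; rewrite sgk hn subrr normr0//.
have c1 := cg X bX; have c2 := cg (fun=> 1) (bmf_cst 1).
have EX n (Y : T -> R) : bmf Y -> Ex (fun w => (\sum_(k < n) gk k w) * Y w) =
   \sum_(k < n) (if (pickle_inv k : option S) is Some u then g i u * Ex (fun w => \1_(V i @^-1` [set u]) w * Y w) else 0).
  move=> bY; under eq_Rintegral do rewrite mulr_suml.
  rewrite Ex_sum; last by move=> k; exact: bmfM.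
  apply: eq_bigr => k _; rewrite /gk; case: (pickle_inv k) => [u|].
    rewrite -ExZ; first by under eq_Rintegral do rewrite -mulrA.
    by apply: bmfM => //; apply: bmf_indic; exact: mV.
  by under eq_Rintegral do rewrite mul0r; exact: Ex_cst.
have key n : Ex (fun w => (\sum_(k < n) gk k w) * X w) =
   Ex (fun w => (\sum_(k < n) gk k w) * 1) *
   ((\prod_(i <- J1) Ex (fun w => g i (V i w))) * \prod_(i <- J2) Pr (V i @^-1` [set v i])).
  rewrite !EX//; last exact: bmf_cst.
  rewrite mulr_suml; apply: eq_bigr => k _; case: (pickle_inv k) => [u|]; last by rewrite mul0r.
  rewrite -mulrA; congr (_ * _).
  pose v' j := if j == i then u else v j.
  have v'i : v' i = u by rewrite /v' eqxx.
  have v'j j : j \in J2 -> v' j = v j.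
    by move=> jJ; rewrite /v'; case: eqP => // ji; rewrite -ji jJ in iJ2.
  have E2 : \prod_(j <- i :: J2) Pr (V j @^-1` [set v' j]) =
      Pr (V i @^-1` [set u]) * \prod_(j <- J2) Pr (V j @^-1` [set v j]).
    by rewrite big_cons v'i; congr (_ * _); apply: eq_big_seq => j jJ; rewrite v'j.
  have H := IH (i :: J2) v' uJ'; rewrite E2 in H.
  rewrite (_ : Ex (fun w => \1_(V i @^-1` [set u]) w * X w) =
      Ex (fun w => (\prod_(j <- J1) g j (V j w)) * indV (i :: J2) v' w)).
    by under [in RHS]eq_Rintegral do rewrite mulr1; rewrite H Ex_indic; [ring|exact: mV].
  apply: eq_Rintegral => w _; rewrite /X /indV big_cons v'i.
  rewrite mulrCA; congr (_ * (_ * _)); apply: eq_big_seq => j jJ.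
  by rewrite v'j.
rewrite big_cons -mulrA.
under eq_Rintegral do rewrite big_cons -mulrA.
under [in RHS]eq_Rintegral do rewrite -[g i _]mulr1.
rewrite -(cvg_lim _ c1)//; apply: cvg_lim => //.
under eq_fun do rewrite key.
exact: cvgMr_tmp.
Qed.

Lemma Ex_prod_indep (J : seq I) : uniq J ->
  Ex (fun w => \prod_(i <- J) g i (V i w)) = \prod_(i <- J) Ex (fun w => g i (V i w)).
Proof.
(* [Ex_prod_indep_aux] asks for values in [S]. If there are none and [J] is not empty, then [T] is
   empty, which a probability forbids. *)
move=> uJ; case: (pselect (exists s : S, True)) => [[s _]|noS].
  have := @Ex_prod_indep_aux J [::] (fun=> s); rewrite cats0 big_nil mulr1 => <-//.
  by apply: eq_Rintegral => w _; rewrite /indV big_nil mulr1.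
case: J uJ => [|i J] _; first by under eq_Rintegral do rewrite big_nil; rewrite big_nil Ex_cst.
have T0 : setT = set0 :> set T by apply/seteqP; split => // w _; apply: noS; exists (V i w).
by have := probability_setT P; rewrite T0 measure0 => /eqP; rewrite eq_sym onee_eq0.
Qed.

End Independent.

End Expectation.

(** * Random draws *)

Lemma sum_option (R : nmodType) (A : finType) (F : option A -> R) :
  \sum_d F d = F None + \sum_a F (Some a).
Proof.
rewrite (bigD1 None)//=; congr (_ + _).
rewrite (reindex_omap Some id)//=; last by case.
by apply: eq_bigl => a; rewrite eqxx.
Qed.

Section Draws.
Context {R : realType} (q I : nat).
Hypothesis q_ge2 : (2 <= q)%N.

(* [None] stands for a step in which none of the urns under consideration
   receives a ball. *)
Local Notation draw_type := (option ('I_q * 'I_I)).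

Definition colours (h : seq draw_type) (i : 'I_I) : {set 'I_q} :=
  [set c | Some (c, i) \in h].

Definition state_of (A : {set 'I_q}) : urn_state :=
  if #|A| == 0%N then None else Some (1 < #|A|)%N.

Definition state (h : seq draw_type) (i : 'I_I) : urn_state := state_of (colours h i).

Definition collide (h : seq draw_type) (d : draw_type) : bool :=
  if d is Some (c, i) then ~~ (colours h i \subset finset.set1 c) else false.

Lemma state_nil : state [::] = fun=> None.
Proof.
apply/funext => i; rewrite /state /state_of (_ : colours _ _ = finset.set0) ?cards0//.
Qed.

Lemma state_rcons h c i :
  state (rcons h (Some (c, i))) = update (state h) i (state_of (c |: colours h i)).
Proof.
apply/funext => j; rewrite /state /update; case: eqP => [->|/eqP ji]; congr state_of.
  by apply/setP => c'; rewrite !inE mem_rcons inE; congr (_ || _); apply/eqP/eqP => [[]|->].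
apply/setP => c'; rewrite !inE mem_rcons inE; case: eqP => // -[_ /eqP].
by rewrite (negbTE ji).
Qed.

Lemma state_rcons_None h : state (rcons h None) = state h.
Proof.
by apply/funext => j; congr state_of; apply/setP => c; rewrite !inE mem_rcons inE.
Qed.

Variables (r : R) (p : 'I_I -> R).

Definition draw_weight (d : draw_type) : R := if d is Some (_, i) then p i / q%:R else r.

(** A new ball distinguishes only whether [A] has 0, 1 or more elements. Summing over its colour is
    what reduces the history of an urn to three states. *)
Lemma sum_colours x (A : {set 'I_q}) (f : urn_state -> R) :
  \sum_(c : 'I_q) x ^+ (~~ (A \subset finset.set1 c)) * f (state_of (c |: A)) =
  q%:R * add_ball q x f (state_of A).
Proof.
have q0 := @q_neq0 R q q_ge2.
have [/eqP A0|A0] := boolP (#|A| == 0%N).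
  move/cards0_eq: A0 => ->; rewrite {2}/state_of cards0 eqxx /=.
  under eq_bigr do rewrite finset.sub0set /= mul1r finset.setU0 /state_of cards1 /=.
  by rewrite sumr_const card_ord mulr_natl.
have [A1|A1] := ltnP 1 #|A|.
  rewrite {2}/state_of (negbTE A0) A1 /=.
  rewrite (eq_bigr (fun=> x * f (Some true))) ?sumr_const ?card_ord ?mulr_natl// => c _.
  have -> : A \subset finset.set1 c = false.
    by apply/negbTE/negP => /subset_leq_card; rewrite cards1 leqNgt A1.
  have h : (1 < #|c |: A|)%N by apply: leq_trans A1 _; apply: subset_leq_card; exact: finset.subsetUr.
  by rewrite /= expr1 /state_of h (gtn_eqF (ltnW h)).
have {A1}/cards1P [c0 ->] : #|A| == 1%N by rewrite eqn_leq A1 lt0n.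
rewrite {2}/state_of cards1 /=.
rewrite (bigD1 c0)//= subxx /= mul1r finset.setUid /state_of cards1 /= -/(state_of _).
rewrite (eq_bigr (fun=> x * f (Some true))) => [|c cc0]; last first.
  by rewrite finset.sub1set inE eq_sym cc0 expr1 cards2 cc0.
have -> : \sum_(i | i != c0) x * f (Some true) = (q%:R - 1) * (x * f (Some true)).
  rewrite sumr_const -[LHS]mulr_natl; congr (_ * _).
  rewrite (eq_card (B := predC1 c0)); last by move=> c; rewrite !inE.
  have := cardC1 c0; rewrite card_ord => ->.
  by rewrite -subn1 natrB// (leq_trans _ q_ge2).
by field.
Qed.

Lemma draw_op_step x (F : ('I_I -> urn_state) -> R) h :
  \sum_d draw_weight d * (x ^+ (collide h d) * F (state (rcons h d))) =
  draw_op q r p x F (state h).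
Proof.
have q0 := @q_neq0 R q q_ge2.
rewrite sum_option /= mul1r state_rcons_None /draw_op; congr (_ + _).
pose G c i := p i / q%:R * (x ^+ (~~ (colours h i \subset finset.set1 c)) * F (state (rcons h (Some (c, i))))).
rewrite (eq_bigr (fun a => G a.1 a.2)); last by case.
rewrite -(pair_bigA _ G)/= /G {G}.
rewrite exchange_big/=; apply: eq_bigr => i _.
rewrite -mulr_sumr; under eq_bigr do rewrite state_rcons.
by rewrite (sum_colours x _ (fun s => F (update (state h) i s))) mulrA divfK.
Qed.

Context {dd : measure_display} {T : measurableType dd} (P : probability T R).
Variable X : nat -> T -> option draw_type.
Hypothesis mX : forall t, discrete_rv (X t).

(** The outer [option] of [X] lets a step fail: draws never do, while a time cell of the limit
    process fails when it contains several points. Accordingly, the weights of a step may sum to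
    less than 1. *)
Definition cylinder (h : seq draw_type) : set T :=
  [set w | [seq X s w | s <- iota 0 (size h)] = [seq Some d | d <- h]].

Hypothesis X_law : forall h, fine (P (cylinder h)) = \prod_(d <- h) draw_weight d.

(* Product of the weights of the collisions at times t, t + 1, ..., given the
   history h before time t; it vanishes if one of the X t is [None]. *)
Fixpoint run (xs : seq R) (t : nat) (h : seq draw_type) (w : T) : R :=
  if xs is x :: xs' then
    if X t w is Some d then x ^+ (collide h d) * run xs' t.+1 (rcons h d) w else 0
  else 1.

Lemma measurable_cylinder h : measurable (cylinder h).
Proof. by have := discrete_map (iota 0 (size h)) mX; apply. Qed.

Lemma run_bound xs t h w : (forall x, x \in xs -> 0 <= x <= 1) -> 0 <= run xs t h w <= 1.
Proof.
elim: xs t h => [|x xs IH] t h xsP /=; first by rewrite ler01 lexx.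
case: (X t w) => [d|]; last by rewrite lexx ler01.
have /andP[x0 x1] := xsP x (mem_head _ _).
have /andP[h0 h1] := IH t.+1 (rcons h d) (fun y yx => xsP y (@mem_behead _ (x :: xs) y yx)).
by rewrite mulr_ge0 ?exprn_ge0//= mulr_ile1 ?exprn_ge0 ?exprn_ile1.
Qed.

Lemma measurable_run xs t h : measurable_fun setT (run xs t h).
Proof.
elim: xs t h => [|x xs IH] t h /=; first exact: measurable_cst.
rewrite (_ : (fun w => _) = (fun w => \sum_d \1_(X t @^-1` [set Some d]) w * (x ^+ (collide h d) * run xs t.+1 (rcons h d) w))).
  apply: measurable_sum => d; apply: measurable_funM; first by apply: measurable_indic; exact: mX.
  by apply: measurable_funM => //; exact: measurable_cst.
apply/funext => w; case E : (X t w) => [d|].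
  rewrite (bigD1 d)//= big1 ?addr0 => [|d' dd']; rewrite indicE.
    by rewrite mem_set ?mul1r//= E.
  by rewrite memNset ?mul0r//= E => -[] /eqP; rewrite eq_sym (negbTE dd').
by rewrite big1// => d _; rewrite indicE memNset ?mul0r//= E.
Qed.

Lemma bmf_run xs t h : (forall x, x \in xs -> 0 <= x <= 1) -> bmf (run xs t h).
Proof.
move=> xsP; split; first exact: measurable_run.
by exists 1 => w; have /andP[h0 h1] := run_bound t h w xsP; rewrite ger0_norm.
Qed.

(** Condition on the history [h], then on the next step: the future weights depend on [h] through
    [state h] only, which gives the backward recursion of [foldr]. *)
Lemma Ex_run_aux xs h : (forall x, x \in xs -> 0 <= x <= 1) ->
  \int[P]_w (\1_(cylinder h) w * run xs (size h) h w) =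
  fine (P (cylinder h)) * foldr (draw_op q r p) (fun=> 1) xs (state h).
Proof.
elim: xs h => [|x xs IH] h xsP /=.
  under eq_Rintegral do rewrite mulr1.
  by rewrite Ex_indic ?mulr1//; exact: measurable_cylinder.
have xsP' y : y \in xs -> 0 <= y <= 1 by move=> yx; apply: xsP; rewrite inE yx orbT.
rewrite -draw_op_step mulr_sumr.
transitivity (\int[P]_w \sum_(d : draw_type) (x ^+ (collide h d) * (\1_(cylinder (rcons h d)) w * run xs (size h).+1 (rcons h d) w))).
  apply: eq_Rintegral => w _.
  have E d : \1_(cylinder (rcons h d)) w = \1_(cylinder h) w * \1_(X (size h) @^-1` [set Some d]) w :> R.
    rewrite !indicE -natrM mulnb; congr ((nat_of_bool _)%:R).
    rewrite /cylinder /= size_rcons -addn1 iotaD /= add0n cats1.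
    apply/idP/andP => [/set_mem /=|[/set_mem /= h1 /set_mem /= h2]].
      by rewrite !map_rcons => /rcons_inj[h1 h2]; split; apply/mem_set.
    by apply/mem_set; rewrite /= !map_rcons h1 h2.
  case EX : (X (size h) w) => [d|].
    rewrite (bigD1 d)//= big1 ?addr0 => [|d' dd'].
      by rewrite E [\1_(X _ @^-1` _) w]indicE mem_set//= mulr1; ring.
    by rewrite E [\1_(X _ @^-1` _) w]indicE memNset ?(mulr0, mul0r)//= EX => -[] /eqP; rewrite eq_sym (negbTE dd').
  by rewrite mulr0 big1// => d _; rewrite E [\1_(X _ @^-1` _) w]indicE memNset ?(mulr0, mul0r)//= EX.
have bb d : bmf (fun w => \1_(cylinder (rcons h d)) w * run xs (size h).+1 (rcons h d) w).
  by apply: bmfM; [apply: bmf_indic; exact: measurable_cylinder|exact: bmf_run].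
rewrite Ex_sum; last by move=> d; apply: bmfM => //; exact: bmf_cst.
apply: eq_bigr => d _; rewrite ExZ//.
have := IH (rcons h d) xsP'; rewrite size_rcons => ->.
by rewrite !X_law -cats1 big_cat big_seq1 /=; ring.
Qed.

Lemma Ex_run xs : (forall x, x \in xs -> 0 <= x <= 1) ->
  \int[P]_w run xs 0 [::] w = foldr (draw_op q r p) (fun=> 1) xs (fun=> None).
Proof.
move=> xsP; have := @Ex_run_aux xs [::] xsP; rewrite X_law big_nil mul1r state_nil => <-.
apply: eq_Rintegral => w _; rewrite indicE mem_set ?mul1r//.
Qed.

Definition history (d : nat -> draw_type) (t : nat) : seq draw_type :=
  [seq d s | s <- iota 0 t].

Lemma run_good xs t w (d : nat -> draw_type) :
  (forall s, (s < t + size xs)%N -> X s w = Some (d s)) ->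
  run xs t (history d t) w =
  \prod_(j < size xs) nth 0 xs j ^+ collide (history d (t + j)%N) (d (t + j)%N).
Proof.
elim: xs t => [|x xs IH] t hd /=; first by rewrite big_ord0.
rewrite hd ?addnS ?ltnS ?leq_addr// big_ord_recl /= addn0; congr (_ * _).
have -> : rcons (history d t) (d t) = history d t.+1.
  by rewrite /history -[t.+1]addn1 iotaD map_cat /= cats1.
rewrite IH; last by move=> s hs; apply: hd; rewrite addnS -addSn.
by apply: eq_bigr => j _; rewrite /bump /= add1n addnS.
Qed.

Lemma run_bad xs t h w s : (t <= s < t + size xs)%N -> X s w = None -> run xs t h w = 0.
Proof.
elim: xs t h => [|x xs IH] t h /=; first by rewrite addn0 => /andP[h1 h2]; rewrite ltnNge h1 in h2.
move=> /andP[ts st] Xs; case E : (X t w) => [d|//].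
rewrite IH ?mulr0// addSnnS st andbT ltn_neqAle ts andbT.
by apply/eqP => tE; rewrite tE Xs in E.
Qed.

Lemma foldr_draw_blocks w xs : foldr (draw_op q r p) (fun=> 1) (flatten [seq nseq w x | x <- xs]) =
  draw_blocks q r p w xs.
Proof.
elim: xs => [//|x xs IH] /=; rewrite foldr_cat IH.
by move: (draw_blocks q r p w xs) => U; elim: {IH}w => //= w ->.
Qed.

End Draws.

Definition block_incr (M : nat -> nat) (w j : nat) : nat := (M (j.+1 * w) - M (j * w))%N.

Definition block_incrs (M : nat -> nat) (w J : nat) : seq nat :=
  [seq block_incr M w j | j <- iota 0 J].

Definition pow {R : realType} (xs : seq R) (ds : seq nat) : R :=
  \prod_(z <- zip xs ds) z.1 ^+ z.2.

Lemma block_incr_sum (c : nat -> nat) w j :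
  block_incr (fun n => \sum_(t < n) c t)%N w j = (\sum_(t < w) c (j * w + t))%N.
Proof.
rewrite /block_incr mulSn addnC -!(big_mkord xpredT c) (big_cat_nat (n := j * w)%N)//= ?leq_addr//.
by rewrite addKn -{1}[(j * w)%N]add0n big_addn addKn big_mkord; apply: eq_bigr => t _; rewrite addnC.
Qed.

Section Pow.
Context {R : realType}.
Implicit Types (xs : seq R).

Lemma pow_bound xs ds : (forall x, x \in xs -> 0 <= x <= 1) -> 0 <= pow xs ds <= 1.
Proof.
rewrite /pow; elim: xs ds => [|x xs IH] [|d ds] xsP /=; rewrite ?big_nil ?ler01 ?lexx//.
rewrite big_cons /=; have /andP[x0 x1] := xsP x (mem_head _ _).
have /andP[h0 h1] := IH ds (fun y yx => xsP y (@mem_behead _ (x :: xs) y yx)).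
by rewrite mulr_ge0 ?exprn_ge0//= mulr_ile1 ?exprn_ge0 ?exprn_ile1.
Qed.

Lemma prod_flatten_pow xs w (c : nat -> nat) :
  let ys := flatten [seq nseq w x | x <- xs] in
  \prod_(t < size ys) nth 0 ys t ^+ c t =
  pow xs (block_incrs (fun n => \sum_(t < n) c t)%N w (size xs)).
Proof.
rewrite /block_incrs (eq_map (block_incr_sum c w)) /=.
elim: xs c => [|x xs IH] c; first by rewrite /pow !big_nil big_ord0.
rewrite /= size_cat size_nseq big_split_ord /= /pow big_cons /=; congr (_ * _).
  under eq_bigr => t _ do rewrite nth_cat size_nseq ltn_ord nth_nseq ltn_ord.
  by rewrite -expr_sum.
rewrite (iotaDl 1 0) -map_comp.
under eq_bigr => t _ do rewrite nth_cat size_nseq ltnNge leq_addr /= addKn.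
rewrite (IH (fun t => c (w + t)%N)) /pow; congr bigop.body.
congr zip; apply: eq_map => j /=; apply: eq_bigr => t _.
by rewrite mulSn addnA.
Qed.

End Pow.

(** * The urn model, as a limit of models with finitely many urns *)

Section SequenceOfDraws.
Context {d : measure_display} {T : measurableType d} {R : realType} {q : nat}.
Hypothesis q_ge2 : (2 <= q)%N.
Variables (P : probability T R) (p : nat -> R) (C : nat -> T -> 'I_q) (Z : nat -> T -> nat).
Hypothesis model : urn_model C Z P p.
Hypothesis p_ge0 : forall i, 0 <= p i.
Hypothesis p_sum : series p @ \oo --> (1 : R).

Let discrete_draw t : discrete_rv (draw C Z t).
Proof. by move=> v; exact: (draw_measurable model). Qed.

Section Truncated.
Variable I : nat.

(** Follows the first [I] urns only; a ball in another urn becomes [None], the draw without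
    effect. *)
Definition trunc_draw (cz : 'I_q * nat) : option ('I_q * 'I_I) :=
  omap (fun i => (cz.1, i)) (insub cz.2 : option 'I_I).

Let X t w := Some (trunc_draw (draw C Z t w)).

Let dX t : discrete_rv (X t).
Proof. exact: (discrete_comp (fun cz => Some (trunc_draw cz)) (discrete_draw t)). Qed.

Let r := 1 - \sum_(i < I) p i.

Lemma trunc_draw_law t dd :
  fine (P (X t @^-1` [set Some dd])) = draw_weight r (fun i : 'I_I => p i) dd.
Proof.
have S c i : fine (P (X t @^-1` [set Some (Some (c, i))])) = p i / q%:R.
  rewrite (_ : _ @^-1` _ = draw C Z t @^-1` [set (c, val i)]).
    by rewrite (draw_law model) /= mulrC.
  apply/seteqP; split => w; rewrite /X /trunc_draw /draw /=.
    by case: insubP => //= j _ <- -[-> ->].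
  by move=> [-> ->]; rewrite valK.
case: dd => [[c i]|]; first exact: S.
(* The case [None] by complement: the probabilities of all values sum to 1. *)
have : \int[P]_w \sum_(dd : option ('I_q * 'I_I)) \1_(X t @^-1` [set Some dd]) w = 1.
  rewrite -[RHS](Ex_cst P); apply: eq_Rintegral => w _.
  rewrite (bigD1 (trunc_draw (draw C Z t w)))//= indicE mem_set// big1 ?addr0// => e /eqP ne.
  by rewrite indicE memNset// => -[] /esym.
rewrite Ex_sum; last by move=> e; apply: bmf_indic; exact: dX.
rewrite (eq_bigr (fun e => fine (P (X t @^-1` [set Some e])))); last by move=> e _; rewrite Ex_indic//; exact: dX.
have E : \sum_(a : 'I_q * 'I_I) fine (P (X t @^-1` [set Some (Some a)])) = \sum_(i < I) p i.
  rewrite (eq_bigr (fun a : 'I_q * 'I_I => (fun (c : 'I_q) (i : 'I_I) => p i / q%:R) a.1 a.2)); last by case=> c i _; rewrite S.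
  rewrite -(pair_bigA _ (fun (c : 'I_q) (i : 'I_I) => p i / q%:R))/= sumr_const card_ord -[LHS]mulr_natl mulr_sumr.
  by apply: eq_bigr => i _; rewrite mulrCA divff ?mulr1//; exact: q_neq0.
by rewrite sum_option E /= /r => <-; rewrite addrK.
Qed.

Lemma trunc_cylinder_law h :
  fine (P (cylinder X h)) = \prod_(dd <- h) draw_weight r (fun i : 'I_I => p i) dd.
Proof.
rewrite (_ : cylinder X h = \bigcap_(s in [set` iota 0 (size h)]) (X s @^-1` [set Some (nth None h s)])); last first.
  rewrite /cylinder; apply/seteqP; split => w /=.
    move=> E s /=; rewrite mem_iota add0n /= => sh.
    have := congr1 (fun l => nth None l s) E.
    by rewrite (nth_map 0%N) ?size_iota// nth_iota// (nth_map None).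
  move=> E; apply: (@eq_from_nth _ None); first by rewrite !size_map size_iota.
  move=> s; rewrite size_map size_iota => sh.
  by rewrite (nth_map 0%N) ?size_iota// nth_iota// (nth_map None)//; apply: E; rewrite /= mem_iota.
rewrite (draw_indep model (iota_uniq _ _)); last first.
  move=> s _; exists [set cz | trunc_draw cz = nth None h s] => //.
  by apply/seteqP; split => w /=; rewrite /X; [move=> ->|case].
rewrite fine_prode; last by move=> s; apply: fin_num_measure; exact: dX.
rewrite [RHS](big_nth None) /index_iota subn0.
by apply: eq_bigr => s _; exact: trunc_draw_law.
Qed.

Lemma trunc_collide t w :
  collide (history (fun s => trunc_draw (draw C Z s w)) t) (trunc_draw (draw C Z t w)) =
  (Z t w < I)%N && collision C Z t w.
Proof.
rewrite {2}/trunc_draw /=; case: insubP => [i -> /= iE|/negbTE -> //].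
apply/idP/idP => [/subsetPn[c]|/existsP[s /andP[/eqP Zs Cs]]].
  rewrite !inE => /mapP[s]; rewrite mem_iota add0n /= => st.
  rewrite /trunc_draw /=; case: insubP => //= j _ jE [-> ij] cc.
  by apply/existsP; exists (Ordinal st) => /=; rewrite cc andbT -jE -iE ij.
apply/subsetPn; exists (C s w); rewrite !inE//.
apply/mapP; exists (nat_of_ord s); first by rewrite mem_iota add0n /=.
by rewrite /trunc_draw /= Zs -iE valK.
Qed.

Definition trunc_ncollisions (n : nat) (w : T) : nat :=
  (\sum_(t < n) ((Z t w < I)%N && collision C Z t w))%N.

Lemma trunc_run w (xs : seq R) v : (forall x, x \in xs -> 0 <= x <= 1) ->
  run X (flatten [seq nseq w x | x <- xs]) 0 [::] v =
  pow xs (block_incrs (trunc_ncollisions ^~ v) w (size xs)).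
Proof.
move=> xsP; rewrite (@run_good _ _ _ _ _ X _ 0 v (fun s => trunc_draw (draw C Z s v)))//.
under eq_bigr do rewrite add0n trunc_collide.
exact: (prod_flatten_pow xs w (fun t => (Z t v < I)%N && collision C Z t v : nat)).
Qed.

Lemma bmf_trunc w (xs : seq R) : (forall x, x \in xs -> 0 <= x <= 1) ->
  bmf (fun v => pow xs (block_incrs (trunc_ncollisions ^~ v) w (size xs))).
Proof.
move=> xsP; under [X in bmf X]eq_fun do rewrite -trunc_run//.
by apply: bmf_run => // x /flattenP[s /mapP[y yx ->]] /nseqP[-> _]; exact: xsP.
Qed.

Lemma Ex_trunc w (xs : seq R) : (forall x, x \in xs -> 0 <= x <= 1) ->
  \int[P]_v pow xs (block_incrs (trunc_ncollisions ^~ v) w (size xs)) =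
  draw_blocks q r (fun i : 'I_I => p i) w xs (fun=> None).
Proof.
move=> xsP; under eq_Rintegral do rewrite -trunc_run//.
rewrite -foldr_draw_blocks; apply: Ex_run => //; first exact: trunc_cylinder_law.
by move=> x /flattenP[s /mapP[y yx ->]] /nseqP[-> _]; exact: xsP.
Qed.

End Truncated.

(** Finitely many draws visit finitely many urns, so the truncation is eventually exact, at a level
    depending on [v]. *)
Lemma trunc_ncollisions_full v n : exists m, forall I, (m <= I)%N ->
  forall k, (k <= n)%N -> trunc_ncollisions I k v = ncollisions C Z k v.
Proof.
exists (\max_(t < n) Z t v).+1 => I mI k kn; apply: eq_bigr => t _.
rewrite (_ : (Z t v < I)%N = true)//; apply: leq_trans mI; rewrite ltnS.
exact: (leq_bigmax (Ordinal (leq_trans (ltn_ord t) kn))).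
Qed.

Lemma discrete_trunc_ncollisions I n : discrete_rv (trunc_ncollisions I n).
Proof.
have h t : discrete_rv (fun w => (Z t w < I)%N && collision C Z t w).
  rewrite (_ : (fun w => _) = (fun h => collide (take t h) (nth None h t)) \o
     (fun w => [seq @trunc_draw I (draw C Z s w) | s <- iota 0 t.+1])).
    apply: discrete_comp; apply: discrete_map => s.
    exact: (discrete_comp (@trunc_draw I) (discrete_draw s)).
  apply/funext => w; rewrite /comp -trunc_collide.
  have -> : iota 0 t.+1 = rcons (iota 0 t) t by rewrite -addn1 iotaD cats1.
  by rewrite map_rcons -cats1 take_size_cat ?nth_cat ?size_map ?size_iota// ltnn subnn.
rewrite (_ : trunc_ncollisions I n = (fun s : seq bool => (\sum_(b <- s) b)%N) \o
    (fun w => [seq ((Z t w < I)%N && collision C Z t w) | t <- iota 0 n])).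
  by apply: discrete_comp; exact: discrete_map.
apply/funext => w /=; rewrite big_map.
by rewrite /trunc_ncollisions -(big_mkord xpredT (fun t => ((Z t w < I)%N && collision C Z t w) : nat)) /index_iota subn0.
Qed.

Lemma discrete_ncollisions n : discrete_rv (ncollisions C Z n).
Proof.
move=> m.
rewrite (_ : _ @^-1` _ = \bigcup_k \bigcap_(I in [set I | (k <= I)%N]) trunc_ncollisions I n @^-1` [set m]).
  apply: bigcup_measurable => k _; apply: bigcap_measurable => [|I _]; first by exists k => /=.
  exact: discrete_trunc_ncollisions.
apply/seteqP; split => w /=.
  move=> nm; have [k hk] := trunc_ncollisions_full w n.
  by exists k => // I /= kI; rewrite hk.
move=> [k _ hk]; have [k' hk'] := trunc_ncollisions_full w n.
by rewrite -(hk' (maxn k k')) ?leq_maxr//; apply: hk; rewrite /= leq_maxl.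
Qed.

Lemma discrete_block_incrs (M : nat -> T -> nat) w J : (forall n, discrete_rv (M n)) ->
  discrete_rv (fun v => block_incrs (M ^~ v) w J).
Proof.
move=> dM; apply: discrete_map => j.
exact: (discrete_comp (fun z => (z.1 - z.2)%N) (discrete_pair (dM _) (dM _))).
Qed.

Lemma urn_gf w (xs : seq R) : (forall x, x \in xs -> 0 <= x <= 1) ->
  (fun I => draw_blocks q (1 - \sum_(i < I) p i) (fun i : 'I_I => p i) w xs (fun=> None)) @ \oo -->
  \int[P]_v pow xs (block_incrs ((ncollisions C Z) ^~ v) w (size xs)).
Proof.
move=> xsP; under eq_fun do rewrite -Ex_trunc//.
apply: (@Ex_cvg _ _ _ _ _ _ 1).
- by move=> I; have [] := @bmf_trunc I w xs xsP.
- by move=> I v; have /andP[h0 h1] := pow_bound (block_incrs (trunc_ncollisions I ^~ v) w (size xs)) xsP; rewrite ger0_norm.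
- exact: (measurable_discrete (pow xs) (discrete_block_incrs w (size xs) discrete_ncollisions)).
- apply: aeW => v; have [m hm] := trunc_ncollisions_full v (size xs * w)%N.
  apply: dist_cvgn => e e0; exists m => I mI.
  rewrite (_ : block_incrs (trunc_ncollisions I ^~ v) w (size xs) = block_incrs ((ncollisions C Z) ^~ v) w (size xs)).
    by rewrite subrr normr0.
  apply/eq_in_map => j; rewrite mem_iota add0n /= => jx.
  by rewrite /block_incr !(hm I mI)// leq_mul2r ?jx ?orbT// (ltnW jx) orbT.
Qed.

Lemma ncollisionsS n v : ncollisions C Z n.+1 v = (ncollisions C Z n v + collision C Z n v)%N.
Proof. by rewrite /ncollisions big_ord_recr. Qed.

Lemma ncollisions_homo v : {homo (ncollisions C Z) ^~ v : m n / (m <= n)%N}.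
Proof. by apply: homo_leq => [//|m n k|n]; [exact: leq_trans|rewrite ncollisionsS leq_addr]. Qed.

(** The count moves by steps of at most 1 and skips no level; [collision_time] is an infimum over
    the times when the count equals [m]. *)
Lemma ncollisions_hit m n v : (m <= ncollisions C Z n v)%N -> exists2 k, (k <= n)%N & ncollisions C Z k v = m.
Proof.
elim: n => [|n IH]; first by rewrite /ncollisions big_ord0 leqn0 => /eqP ->; exists 0%N => //; rewrite big_ord0.
have [/IH [k kn kE] _|lt] := leqP m (ncollisions C Z n v); first by exists k => //; exact: leqW.
rewrite ncollisionsS => le; exists n.+1 => //; apply/eqP; rewrite ncollisionsS eqn_leq le andbT.
by case: (collision _ _ _ _) le lt => /=; lia.
Qed.

Lemma collision_timeE m n0 v : (m <= ncollisions C Z n0 v)%N ->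
  exists k, collision_time C Z m v = (k%:R : R)%:E /\
    forall n, (k <= n)%N = (m <= ncollisions C Z n v)%N.
Proof.
move=> /ncollisions_hit [k1 _ k1E].
have ex : exists k, ncollisions C Z k v == m by exists k1; apply/eqP.
pose k := ex_minn ex; exists k; rewrite /k; case: ex_minnP => {k} k /eqP kE kmin; split; last first.
  move=> n; apply/idP/idP => [kn|/ncollisions_hit [j jn /eqP jE]].
    by rewrite -kE; exact: ncollisions_homo.
  exact: leq_trans (kmin _ jE) jn.
apply/eqP; rewrite eq_le; apply/andP; split.
  by apply: ereal_inf_lbound; exists k.
by apply: le_ereal_inf_tmp => _ [j /= /eqP jE <-]; rewrite lee_fin ler_nat; exact: kmin.
Qed.

End SequenceOfDraws.

(** * Limit of the generating functions of the urn models *)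

Section SequenceLemmas.
Context {R : realType}.

Lemma cvgn_cst (c : R) : (fun _ : nat => c) @ \oo --> c.
Proof. exact: cvg_cst. Qed.

Lemma cvgn_ext (u v : R ^nat) (l : R) : (forall n, u n = v n) -> u @ \oo --> l -> v @ \oo --> l.
Proof. by move=> /funext ->. Qed.

Lemma cvgn_shift n (u : R ^nat) (l : R) : u @ \oo --> l -> (fun N => u (N + n)%N) @ \oo --> l.
Proof. by rewrite (cvg_shiftn n u). Qed.

Lemma seriesE (u : R ^nat) n : series u n = \sum_(i < n) u i.
Proof. by rewrite /series /= big_mkord. Qed.

Lemma cvg_series_ge (u : R ^nat) l n : (forall i, 0 <= u i) ->
  (fun n => \sum_(i < n) u i) @ \oo --> l -> \sum_(i < n) u i <= l.
Proof.
move=> u0 ul; rewrite -(cvg_lim _ ul)//.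
apply: (nondecreasing_cvgn_le (u_ := fun n => \sum_(i < n) u i)); last by apply: cvgP ul.
by apply/nondecreasing_seqP => k; rewrite big_ord_recr /= lerDl.
Qed.

End SequenceLemmas.

Section UrnProbabilities.
Context {R : realType}.
Variable p : nat -> R.
Hypothesis p_ge0 : forall i, 0 <= p i.
Hypothesis p_noninc : forall i, p i.+1 <= p i.
Hypothesis p_sum : series p @ \oo --> (1 : R).

Lemma p_sum_le1 n : \sum_(i < n) p i <= 1.
Proof. by apply: cvg_series_ge => //; apply: (cvgn_ext (seriesE p)). Qed.

Lemma p_le_p0 i : p i <= p 0%N.
Proof. by move/nonincreasing_seqP: p_noninc; apply. Qed.

Lemma p0_le1 : p 0%N <= 1.
Proof. by have := p_sum_le1 1; rewrite big_ord1. Qed.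

Lemma p0_gt0 : 0 < p 0%N.
Proof.
rewrite lt_neqAle p_ge0 andbT eq_sym; apply/eqP => h.
have p0 : p = fun=> 0 by apply/funext => i; apply/eqP; rewrite eq_le p_ge0 andbT -h p_le_p0.
have c0 : series p @ \oo --> (0 : R).
  by rewrite p0 (_ : series _ = fun=> 0); [exact: cvg_cst|apply/funext => n; rewrite seriesE big1].
have e1 : limn (series p) = 1 by rewrite (cvg_lim _ p_sum).
have e2 : limn (series p) = 0 by rewrite (cvg_lim _ c0).
by move: e2; rewrite e1 => /eqP; rewrite oner_eq0.
Qed.

(** The bound by which [p_first] forces [l2_norm] to 0. *)
Lemma p_sqr_sum_le n : \sum_(i < n) p i ^+ 2 <= p 0%N.
Proof.
apply: (@le_trans _ _ (\sum_(i < n) p i * p 0%N)).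
  by apply: ler_sum => i _; rewrite expr2 ler_wpM2l// p_le_p0.
by rewrite -mulr_suml -[leRHS]mul1r ler_wpM2r// p_sum_le1.
Qed.

Lemma cvg_p_sqr : cvgn (series (fun i => p i ^+ 2)).
Proof.
apply: nondecreasing_is_cvgn.
  by apply/nondecreasing_seqP => k; rewrite /series /= big_nat_recr//= lerDl sqr_ge0.
by exists (p 0%N) => _ [n _ <-]; rewrite seriesE; exact: p_sqr_sum_le.
Qed.

Lemma l2_norm_sqr : (fun n => \sum_(i < n) p i ^+ 2) @ \oo --> l2_norm p ^+ 2.
Proof.
have h : 0 <= limn (series (fun i => p i ^+ 2)).
  by apply: limr_ge; [exact: cvg_p_sqr|apply: nearW => n; rewrite seriesE sumr_ge0// => i _; rewrite sqr_ge0].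
rewrite /l2_norm sqr_sqrtr// (_ : (fun n => _) = series (fun i => p i ^+ 2)).
  exact: cvg_p_sqr.
by apply/funext => n; rewrite seriesE.
Qed.

Lemma l2_norm_sqr_le : l2_norm p ^+ 2 <= p 0%N.
Proof. exact: (@cvg_le R _ _ _ _ p_sqr_sum_le l2_norm_sqr (@cvgn_cst R _)). Qed.

Lemma p0_le_l2_norm : p 0%N <= l2_norm p.
Proof.
have h : p 0%N ^+ 2 <= l2_norm p ^+ 2.
  have := @cvg_series_ge R (fun i => p i ^+ 2) (l2_norm p ^+ 2) 1 (fun i => sqr_ge0 _).
  by rewrite big_ord1; apply; exact: l2_norm_sqr.
by move: h; rewrite ler_sqr ?nnegrE ?sqrtr_ge0.
Qed.

Lemma l2_norm_gt0 : 0 < l2_norm p.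
Proof. exact: lt_le_trans p0_gt0 p0_le_l2_norm. Qed.

End UrnProbabilities.

Section UrnLimit.
Context {R : realType} {q : nat}.
Hypothesis q_ge2 : (2 <= q)%N.
Variables (p : nat -> nat -> R) (psi : nat -> R).
Hypothesis p_ge0 : forall N i, 0 <= p N i.
Hypothesis p_noninc : forall N i, p N i.+1 <= p N i.
Hypothesis p_sum : forall N, series (p N) @ \oo --> (1 : R).
Hypothesis p_first : (fun N => p N 0%N) @ \oo --> (0 : R).
Hypothesis psi_lim : forall i, (fun N => p N i / l2_norm (p N)) @ \oo --> psi i.

Lemma psi_ge0 i : 0 <= psi i.
Proof.
apply: (@cvg_le R _ _ _ _ _ (@cvgn_cst R 0) (@psi_lim i)) => N.
by rewrite divr_ge0// ltW// l2_norm_gt0.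
Qed.

Lemma psi_sqr_sum_le1 n : \sum_(i < n) psi i ^+ 2 <= 1.
Proof.
have h : (fun N => \sum_(i < n) (p N i / l2_norm (p N)) ^+ 2) @ \oo --> \sum_(i < n) psi i ^+ 2.
  by apply: cvg_big => [|i _]; [exact: add_continuous|apply: cvgM; exact: psi_lim].
have c1 : (fun _ : nat => 1 : R) @ \oo --> (1 : R) by exact: cvg_cst.
apply: (@cvg_le R _ _ _ _ _ h c1) => N.
have s0 := l2_norm_gt0 (p_ge0 N) (@p_noninc N) (@p_sum N).
under eq_bigr do rewrite expr_div_n.
rewrite -mulr_suml ler_pdivrMr ?exprn_gt0// mul1r.
apply: (@cvg_series_ge R (fun i => p N i ^+ 2)); first by move=> i; exact: sqr_ge0.
exact: l2_norm_sqr.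
Qed.

Lemma psi_le1 i : psi i <= 1.
Proof.
have : psi i ^+ 2 <= 1.
  apply: le_trans (psi_sqr_sum_le1 i.+1); rewrite big_ord_recr /= lerDr sumr_ge0// => j _.
  exact: sqr_ge0.
by rewrite -[X in _ <= X](expr1n _ 2) ler_sqr ?nnegrE ?psi_ge0.
Qed.

Lemma cvg_psi_sqr : series (fun i => psi i ^+ 2) @ \oo --> limn (series (fun i => psi i ^+ 2)).
Proof.
apply: nondecreasing_is_cvgn.
  by apply/nondecreasing_seqP => k; rewrite /series /= big_nat_recr//= lerDl sqr_ge0.
by exists 1 => _ [n _ <-]; rewrite seriesE; exact: psi_sqr_sum_le1.
Qed.

Lemma psi_sqr_lim_le1 : limn (series (fun i => psi i ^+ 2)) <= 1.
Proof.
apply: (@cvg_le R _ _ _ _ _ cvg_psi_sqr (@cvgn_cst R 1)) => n; rewrite seriesE; exact: psi_sqr_sum_le1.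
Qed.

Lemma cvg_l2_norm0 : (fun N => l2_norm (p N)) @ \oo --> (0 : R).
Proof.
apply: dist_cvgn => e e0; have [N hN] := cvgn_dist p_first (exprn_gt0 2 e0).
exists N => n Nn; have := hN n Nn; rewrite !sub0r !normrN !ger0_norm//; last first.
  by rewrite ltW// l2_norm_gt0.
move=> h; rewrite -(@ltr_pXn2r _ 2) ?nnegrE ?sqrtr_ge0 ?(ltW e0)//.
by apply: le_lt_trans h; exact: l2_norm_sqr_le.
Qed.

Section Blocks.
Variables (w : nat -> nat) (delta : R) (xs : seq R).
Hypothesis delta01 : 0 < delta <= 1.
Hypothesis w_delta : (fun N => (w N)%:R * l2_norm (p N)) @ \oo --> delta.
Hypothesis w_gt0 : forall N, (0 < w N)%N.
Hypothesis xs01 : forall x, x \in xs -> 0 <= x <= 1 /\ x != q%:R^-1.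

Let a N : R := (Num.sqrt (w N)%:R)^-1.
Let b N : R := Num.sqrt (a N).

Let a_cvg : a @ \oo --> (0 : R).
Proof.
have s0 := cvg_l2_norm0.
have [d0 d1] := andP delta01.
have h : (fun N => Num.sqrt (l2_norm (p N) / ((w N)%:R * l2_norm (p N)))) @ \oo --> Num.sqrt (0 / delta).
  apply: (@cvg_comp _ _ _ _ _ _ (nbhs (0 / delta))); last exact: sqrt_continuous.
  apply: cvgM => //; apply: cvgV => //; exact: lt0r_neq0.
move: h; rewrite mul0r sqrtr0; apply: cvgn_ext => N.
have sN : l2_norm (p N) != 0 by apply: lt0r_neq0; exact: l2_norm_gt0.
rewrite invfM mulrCA mulfV// mulr1 sqrtrV//.
Qed.

Let b_cvg : b @ \oo --> (0 : R).
Proof.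
by rewrite -[X in _ --> X](@sqrtr0 R); apply: (@cvg_comp _ _ _ _ _ _ (nbhs (0 : R))); [exact: a_cvg|exact: sqrt_continuous].
Qed.

Let a_gt0 N : 0 < a N. Proof. by rewrite invr_gt0 sqrtr_gt0 ltr0n. Qed.
Let b_gt0 N : 0 < b N. Proof. by rewrite sqrtr_gt0. Qed.
Let b_le1 N : b N <= 1.
Proof.
rewrite -[X in _ <= X]sqrtr1 ler_wsqrtr// invf_le1 ?sqrtr_gt0 ?ltr0n//.
by rewrite -[X in X <= _]sqrtr1 ler_wsqrtr// ler1n.
Qed.

(* Blocks of w draws are compared with Poisson numbers of draws of mean
   w (1 +- w^(-1/4)): this changes the mean by much more than sqrt w. *)
Let lam (sg : bool) N : R := (w N)%:R * (1 + (-1) ^+ sg * b N).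

Let lam_ge0 sg N : 0 <= lam sg N.
Proof.
rewrite mulr_ge0//; have := b_le1 N; have := b_gt0 N.
by case: sg; rewrite ?expr1 ?expr0; lra.
Qed.

(** With [b = w^(-1/4)] and [a = w^(-1/2)], the Chebyshev term is of order [a], hence vanishes. The
    value [sg = true] is the mean below [w], since [(-1) ^+ true = -1]. *)
Let err sg N : lam sg N / ((w N)%:R - lam sg N) ^+ 2 = (1 + (-1) ^+ sg * b N) * a N.
Proof.
have wN : (w N)%:R != 0 :> R by rewrite pnatr_eq0 -lt0n.
have wa : (w N)%:R * a N ^+ 2 = 1.
  by rewrite /a exprVn sqr_sqrtr// mulfV.
have -> : ((w N)%:R - lam sg N) ^+ 2 = (w N)%:R ^+ 2 * a N.
  rewrite /lam mulrDr mulr1 opprD addrA subrr sub0r sqrrN exprMn exprMn -exprM mulnC exprM sqrrN expr1n expr1n mul1r.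
  by rewrite /b sqr_sqrtr// ltW.
rewrite /lam; have a0 : a N != 0 by exact: lt0r_neq0.
set c := 1 + _; have -> : c * a N = c * a N / ((w N)%:R * a N ^+ 2) by rewrite wa divr1.
by field; rewrite wN a0.
Qed.

Let th sg N i : R := lam sg N * p N i.

Let lam_s sg : (fun N => lam sg N * l2_norm (p N)) @ \oo --> delta.
Proof.
rewrite (_ : (fun N => _) = (fun N => (w N)%:R * l2_norm (p N) * (1 + (-1) ^+ sg * b N))).
  rewrite -[X in _ --> X]mulr1; apply: cvgM => //.
  rewrite -[X in _ --> X]addr0; apply: cvgD; first exact: cvg_cst.
  by rewrite -[X in _ --> X](mulr0 ((-1) ^+ sg)); apply: cvgMl_tmp.
by apply/funext => N; rewrite /lam; ring.
Qed.

Let th_sqr sg N : (fun n => \sum_(i < n) th sg N i ^+ 2) @ \oo --> (lam sg N * l2_norm (p N)) ^+ 2.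
Proof.
rewrite (_ : (fun n => _) = (fun n => lam sg N ^+ 2 * \sum_(i < n) p N i ^+ 2)).
  by rewrite [X in _ --> X]exprMn; apply: cvgMl_tmp; apply: l2_norm_sqr.
by apply/funext => n; rewrite mulr_sumr; apply: eq_bigr => i _; rewrite exprMn.
Qed.

Let G := blocks_gf q xs.

(** A squeeze between two Poisson means: the smaller mean bounds from above, the larger one from
    below, and both products over the urns have the same limit. [u N] stands for the generating
    function of all urns, obtained by removing the truncation. *)
Lemma draw_blocks_limit : exists L', [/\ (fun n => \prod_(i < n) G (delta * psi i)) @ \oo --> L' &
  forall (u : nat -> R),
  (forall N, (fun I => draw_blocks q (1 - \sum_(i < I) p N i) (fun i : 'I_I => p N i) (w N) xs (fun=> None)) @ \oo --> u N) ->
  u @ \oo --> expR (- (gf_kappa q xs * (delta ^+ 2 - delta ^+ 2 * limn (series (fun i => psi i ^+ 2))))) * L'].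
Proof.
have [d0 d1] := andP delta01.
(* From [N0] on, the sums of squares are at most 4, as [l2_array] demands; the sequences are shifted
   by [N0]. *)
have [N0 hN0] : exists N0, forall N, (N0 <= N)%N -> forall sg, lam sg N * l2_norm (p N) <= 2%:R.
  have [N1 h1] := cvgn_dist (@lam_s true) ltr01; have [N2 h2] := cvgn_dist (@lam_s false) ltr01.
  exists (maxn N1 N2) => N; rewrite geq_max => /andP[n1 n2] sg.
  have := h1 _ n1; have := h2 _ n2; move: d1; case: sg; rewrite !ltr_norml; lra.
have Gc : continuous G by exact: continuous_add_poisson_blocks.
have GO : bigO 3 (fun t => G t - (1 - gf_kappa q xs * t ^+ 2)).
  by have [] := @blocks_expansion R q q_ge2 xs (fun x xx => (xs01 xx).2).
have la sg N : l2_array (th sg (N + N0)%N).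
  have s0 := l2_norm_gt0 (p_ge0 (N + N0)) (@p_noninc (N + N0)) (@p_sum (N + N0)).
  split=> [i|i|n].
  - by rewrite mulr_ge0.
  - by rewrite ler_wpM2l.
  - apply: le_trans (_ : (lam sg (N + N0)%N * l2_norm (p (N + N0)%N)) ^+ 2 <= _).
      by apply: (@cvg_series_ge R (fun i => th sg (N + N0)%N i ^+ 2) _ n (fun i => sqr_ge0 _)); exact: th_sqr.
    rewrite (_ : 4%:R = 2%:R ^+ 2); last by ring.
    have h2 := hN0 (N + N0)%N (leq_addl _ _) sg.
    have h0 : 0 <= lam sg (N + N0)%N * l2_norm (p (N + N0)%N).
      by apply: mulr_ge0; [exact: lam_ge0|exact: ltW].
    by apply: lerXn2r; rewrite ?nnegrE.
have tc sg i : (fun N => th sg (N + N0)%N i) @ \oo --> delta * psi i.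
  rewrite (cvg_shiftn N0 (fun N => th sg N i)).
  rewrite (_ : (fun N => _) = (fun N => lam sg N * l2_norm (p N) * (p N i / l2_norm (p N)))).
    by apply: cvgM.
  apply/funext => N; rewrite /th; field; apply: lt0r_neq0; exact: l2_norm_gt0.
have cc sg : (fun N => (lam sg (N + N0)%N * l2_norm (p (N + N0)%N)) ^+ 2) @ \oo --> delta ^+ 2.
  rewrite (cvg_shiftn N0 (fun N => (lam sg N * l2_norm (p N)) ^+ 2)).
  by apply: cvgM.
have sc : (fun n => \sum_(i < n) (delta * psi i) ^+ 2) @ \oo --> delta ^+ 2 * limn (series (fun i => psi i ^+ 2)).
  rewrite (_ : (fun n => _) = (fun n => delta ^+ 2 * series (fun i => psi i ^+ 2) n)).
    by apply: cvgMl_tmp; exact: cvg_psi_sqr.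
  by apply/funext => n; rewrite seriesE mulr_sumr; apply: eq_bigr => i _; rewrite exprMn.
have [Lm [L' [Lm1 Lm2 Lm3]]] := gf_product_limit Gc GO (la true) (fun i => @tc true i) (fun N => @th_sqr true (N + N0)%N) (@cc true) sc.
have [Lp [L'' [Lp1 Lp2 Lp3]]] := gf_product_limit Gc GO (la false) (fun i => @tc false i) (fun N => @th_sqr false (N + N0)%N) (@cc false) sc.
have LL : L'' = L' by apply: (cvg_unique _ Lp2 Lm2); exact: Rhausdorff.
rewrite LL in Lp3.
exists L'; split => // u hu.
rewrite -(cvg_shiftn N0 u).
have ec0 (sg : bool) : (fun N => (size xs)%:R * ((1 + (-1) ^+ sg * b N) * a N)) @ \oo --> (0 : R).
  rewrite -[X in _ --> X](mulr0 (size xs)%:R); apply: cvgMl_tmp.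
  rewrite -[X in _ --> X](mulr0 (1 + (-1) ^+ sg * 0)); apply: cvgM => //.
  by apply: cvgD; [exact: cvg_cst|exact: cvgMl_tmp].
have ec (sg : bool) := @cvgn_shift R N0 _ _ (@ec0 sg).
have cmp sg N I : let P := \prod_(i < I) G (th sg N i) in
    let e := (size xs)%:R * ((1 + (-1) ^+ sg * b N) * a N) in
    if sg then draw_blocks q (1 - \sum_(i < I) p N i) (fun i : 'I_I => p N i) (w N) xs (fun=> None) <= P + e
    else P <= draw_blocks q (1 - \sum_(i < I) p N i) (fun i : 'I_I => p N i) (w N) xs (fun=> None) + e.
  have wN : (0 : R) < (w N)%:R by rewrite ltr0n.
  have lw : (lam sg N < (w N)%:R) = sg.
    rewrite /lam -[X in _ < X]mulr1 ltr_pM2l//; have := b_gt0 N; case: sg; rewrite ?expr1 ?expr0.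
      by move=> h; apply/idP; lra.
    by move=> h; apply/negbTE; rewrite -leNgt; lra.
  have lw' : lam sg N != (w N)%:R.
    rewrite /lam -[X in _ != X]mulr1; apply/eqP => /(mulfI (lt0r_neq0 wN)).
    by have := b_gt0 N; case: (sg); rewrite ?expr1 ?expr0; lra.
  have r0 : 0 <= 1 - \sum_(i < I) p N i by rewrite subr_ge0; exact: p_sum_le1.
  have [_ /(_ (fun=> None))] := @draw_blocks_cmp R q q_ge2 I (1 - \sum_(i < I) p N i) (fun i : 'I_I => p N i)
    (fun i => p_ge0 N i) r0 erefl (w N) (lam sg N) xs (lam_ge0 sg N) lw' xs01.
  by rewrite err lw.
apply: (squeeze_cvgr (f := fun N => Lp N - (size xs)%:R * ((1 + (-1) ^+ false * b (N + N0)%N) * a (N + N0)%N))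
   (h := fun N => Lm N + (size xs)%:R * ((1 + (-1) ^+ true * b (N + N0)%N) * a (N + N0)%N))).
- apply: nearW => N; apply/andP; split.
    rewrite lerBlDr.
    apply: (cvg_le (fun I => cmp false (N + N0)%N I) (Lp1 N)).
    by apply: cvgD; [exact: hu|exact: cvg_cst].
  apply: (cvg_le (fun I => cmp true (N + N0)%N I) (hu _)).
  by apply: cvgD; [exact: Lm1|exact: cvg_cst].
- by rewrite -[X in _ --> X]subr0; apply: cvgB.
- by rewrite -[X in _ --> X]addr0; apply: cvgD.
Qed.

End Blocks.
End UrnLimit.

(** * Paths of the coloured processes *)

Lemma historyS (q I : nat) (d : nat -> option ('I_q * 'I_I)) t :
  history d t.+1 = rcons (history d t) (d t).
Proof. by rewrite /history -[t.+1]addn1 iotaD map_cat /= cats1. Qed.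

Section CountingFunctions.
Context {R : realType}.
Implicit Types (f : R -> nat) (t : R).

Lemma at_rightP (t : R) (Q : R -> Prop) : (\forall s \near t^'+, Q s) ->
  exists2 e, 0 < e & forall s, t < s -> s < t + e -> Q s.
Proof.
move=> [e /= e0 he]; exists e => // s ts st; apply: he => //=.
by rewrite distrC ger0_norm ?subr_ge0 ?ltW// ltrBlDl.
Qed.

Definition counting_fun f := (forall s t, 0 <= s -> s <= t -> (f s <= f t)%N) /\
  forall t, 0 <= t -> \forall s \near t^'+, f s = f t.

Lemma counting_fun_sum (I : finType) (F : I -> R -> nat) : (forall i, counting_fun (F i)) ->
  counting_fun (fun t => \sum_i F i t)%N.
Proof.
move=> hF; split => [s t s0 st|t t0].
  by apply: leq_sum => i _; exact: (hF i).1.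
have : \forall s \near t^'+, forall i, F i s = F i t.
  by apply: filter_forall => i; exact: (hF i).2.
by apply: filterS => s hs; apply: eq_bigr => i _.
Qed.

Lemma counting_fun_sub f (c : nat) : counting_fun f -> counting_fun (fun t => f t - c)%N.
Proof.
move=> [fm fr]; split => [s t s0 st|t t0]; first by apply: leq_sub2r; exact: fm.
by apply: filterS (fr t t0) => s ->.
Qed.

Lemma counting_funD f (g : R -> nat) : counting_fun f -> counting_fun g -> counting_fun (fun t => f t + g t)%N.
Proof.
move=> [fm fr] [gm gr]; split => [s t s0 st|t t0]; first by apply: leq_add; [exact: fm|exact: gm].
by apply: filterS2 (fr t t0) (gr t t0) => s -> ->.
Qed.

(** Right-continuity makes the infimum of the times above a level a minimum. *)
Lemma level_time f m t1 : counting_fun f -> 0 <= t1 -> (m <= f t1)%N ->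
  exists tau, [/\ 0 <= tau, tau <= t1, (m <= f tau)%N &
    forall s, 0 <= s -> s < tau -> (f s < m)%N].
Proof.
move=> [fm fr] t10 mt1.
pose A := [set t | 0 <= t /\ (m <= f t)%N].
have A0 : lbound A 0 by move=> t [].
have iA : has_inf A by split; [exists t1|exists 0].
have lbA t : A t -> inf A <= t by move=> At; apply: ge_inf => //; exists 0.
have tau0 : 0 <= inf A by apply: lb_le_inf => //; exists t1.
exists (inf A); split => //; first exact: lbA.
  have [e e0 he] := at_rightP (fr _ tau0).
  have [s [s0 ms] st] : exists2 s, A s & s < inf A + e by apply: inf_adherent.
  have [ts|ts] := eqVneq (inf A) s; first by rewrite ts.
  by rewrite -(he s)// lt_neqAle ts lbA.
by move=> s s0 st; rewrite ltnNge; apply/negP => ms; have := lbA s (conj s0 ms); rewrite leNgt st.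
Qed.

(** Supplies rational times, with which suprema and infima over time become countable. *)
Lemma grid_between (t : R) (u : \bar R) : 0 <= t -> (t%:E < u)%E ->
  exists i k : nat, t <= i%:R / k.+1%:R :> R /\ ((i%:R / k.+1%:R : R)%:E < u)%E.
Proof.
move=> t0 tu.
have [v tv vu] : exists2 v : R, t < v & (v%:E <= u)%E.
  case: u tu => [u| |] tu //.
  - by exists u => //; rewrite -lte_fin.
  - by exists (t + 1); [lra|rewrite leey].
pose k := Num.truncn (v - t)^-1; pose i := (Num.truncn (t * k.+1%:R)).+1.
have k0 : (0 : R) < k.+1%:R by rewrite ltr0n.
have hk : (v - t)^-1 < k.+1%:R by exact: truncnS_gt.
have hi : t * k.+1%:R < i%:R by exact: truncnS_gt.
have hi' : i%:R <= t * k.+1%:R + 1 :> R.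
  by rewrite /i -natr1 lerD2r truncn_le// mulr_ge0// ltW.
exists i, k; split; first by rewrite ler_pdivlMr// ltW.
apply: lt_le_trans vu; rewrite lte_fin ltr_pdivrMr//.
apply: le_lt_trans hi' _; rewrite -ltrBrDl -mulrBl -ltr_pdivrMl ?subr_gt0// mulr1//.
Qed.

End CountingFunctions.

Section Coloured.
Context {d : measure_display} {T : measurableType d} {R : realType} {q : nat}.
Variable Bc : 'I_q -> R -> T -> nat.
Hypothesis cBc : forall a, counting_process (Bc a).

Local Notation S := (superpose Bc).

Lemma counting_process_fun (B : R -> T -> nat) w : counting_process B -> counting_fun (B ^~ w).
Proof.
move=> cB; split => [s t s0 st|t t0]; first exact: (cp_nondecreasing cB).
exact: (cp_right_continuous cB).
Qed.

Lemma counting_superpose w : counting_fun (S ^~ w).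
Proof. by apply: counting_fun_sum => a; exact: counting_process_fun. Qed.

Lemma counting_thinned w : counting_fun (thinned Bc ^~ w).
Proof. exact: (counting_fun_sub _ (counting_superpose w)). Qed.

Lemma superpose_homo w s t : 0 <= s -> s <= t -> (S s w <= S t w)%N.
Proof. exact: (counting_superpose w).1. Qed.

Definition two_colours t w := exists a b, [/\ a != b, (0 < Bc a t w)%N & (0 < Bc b t w)%N].

Lemma two_colours_homo w s t : 0 <= s -> s <= t -> two_colours s w -> two_colours t w.
Proof.
move=> s0 st [a [b [ab ha hb]]]; exists a, b; split => //.
- by apply: leq_trans ha _; exact: (cp_nondecreasing (cBc a)).
- by apply: leq_trans hb _; exact: (cp_nondecreasing (cBc b)).
Qed.

Local Notation tc := (two_colour_time Bc).

(** The infimum is attained: the finitely many colours are constant together just after [t]. *)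
Lemma two_colour_timeP w t : 0 <= t -> (tc w <= t%:E)%E <-> two_colours t w.
Proof.
move=> t0; split => [le|h]; last first.
  by apply: ereal_inf_lbound; exists t.
have : \forall s \near t^'+, forall a, Bc a s w = Bc a t w.
  by apply: filter_forall => a; exact: (cp_right_continuous (cBc a)).
move=> /at_rightP [e e0 he].
have : (tc w < (t + e)%:E)%E by apply: le_lt_trans le _; rewrite lte_fin; lra.
move=> /ereal_inf_lt [_ [s [s0 hs] <-]]; rewrite lte_fin => st.
have [ts|] := ltP t s.
  have [a [b [ab ha hb]]] := hs; exists a, b; split => //; [rewrite -(he s)//|rewrite -(he s)//].
by move=> le'; apply: two_colours_homo hs.
Qed.

Lemma two_colour_time_ge0 w : (0 <= tc w)%E.
Proof. by apply: le_ereal_inf_tmp => _ [t [t0 _] <-]; rewrite lee_fin. Qed.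

Lemma lt_two_colour_time w t : 0 <= t -> (t%:E < tc w)%E <-> ~ two_colours t w.
Proof.
move=> t0; have h := two_colour_timeP w t0; rewrite ltNge; split.
  by move=> /negP nle /h.
by move=> nh; apply/negP => /h.
Qed.

Definition unbounded_points w := forall n, exists k : nat, (n <= S (k%:R : R) w)%N.
Definition never_two w := forall k : nat, ~ two_colours (k%:R : R) w.

(* The cases where the set of points before two_colour_time has no supremum
   in the sense of Defs, so that all points counted at time 0 are removed. *)
Definition degenerate w := two_colours 0 w \/ (never_two w /\ unbounded_points w).

Lemma two_colour_time_never w : never_two w <-> tc w = +oo%E.
Proof.
split => [nt|tE k].
  apply/eqP; rewrite eq_le leey /= leNgt; apply/negP => lt.
  have := two_colour_time_ge0 w; case E : (tc w) lt => [t| |]// _; rewrite lee_fin => t0.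
  apply: (nt (Num.truncn t).+1); apply: (@two_colours_homo _ t) => //; first by rewrite ltW// truncnS_gt.
  by apply/two_colour_timeP => //; rewrite E.
by apply/lt_two_colour_time; rewrite ?tE ?ltry.
Qed.

(** In the first case the set under [sup] is empty, in the second it is unbounded; both give the
    default value 0. *)
Lemma n_removed_degenerate w : degenerate w -> n_removed Bc w = S 0 w.
Proof.
rewrite /n_removed => h; suff -> : last_point_before Bc w = 0 by [].
case: h => [h0|[nt ub]].
  rewrite /last_point_before (_ : [set t | _] = set0) ?sup0//.
  apply/seteqP; split => // t [[t0 _ _]]; move/(two_colour_timeP w (lexx 0)): h0 => le.
  by move=> /lt_le_trans/(_ le); rewrite lte_fin ltNge t0.
move/two_colour_time_never: nt => tE.
apply: sup_out => -[_ [K hK]].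
pose K' := `|K| + 1.
have K0 : 0 <= K' by rewrite addr_ge0.
have [k hk] := ub (S K' w).+1.
have [tau [tau0 _ h1 h2]] := level_time (counting_superpose w) (ler0n R k) hk.
have : tau <= K.
  apply: hK; split; last by rewrite tE ltry.
  split => //; first exact: leq_ltn_trans h1.
  by move=> s s0 st; apply: leq_trans h1; exact: h2.
rewrite leNgt => /negP; apply; apply: (@lt_le_trans _ _ K').
  by rewrite /K'; apply: le_lt_trans (ler_norm K) _; lra.
by rewrite leNgt; apply/negP => lt; have := superpose_homo w tau0 (ltW lt); rewrite leqNgt h1.
Qed.

(** The usable form of the definition: [L_i] is the largest count before the second colour. If it is
    positive, the last point is the first time at which this count is reached; if it is 0, the empty
    [sup] gives time 0, where the count is 0 as well. *)
Lemma n_removed_max w : ~ degenerate w ->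
  (forall t, 0 <= t -> ~ two_colours t w -> (S t w <= n_removed Bc w)%N) /\
  exists t, [/\ 0 <= t, ~ two_colours t w & S t w = n_removed Bc w].
Proof.
move=> nd.
have n0 : ~ two_colours 0 w by move=> h; apply: nd; left.
have [M hM] : exists M, forall t, 0 <= t -> ~ two_colours t w -> (S t w <= M)%N.
  have [nt|/existsNP [k /contrapT hk]] := pselect (never_two w).
    have /existsNP [n hn] : ~ unbounded_points w by move=> ub; apply: nd; right.
    exists n => t t0 _; rewrite leqNgt; apply/negP => lt; apply: hn; exists (Num.truncn t).+1.
    by apply: leq_trans (ltnW lt) _; apply: superpose_homo => //; rewrite ltW// truncnS_gt.
  exists (S (k%:R : R) w) => t t0 ht; apply: superpose_homo => //.
  by rewrite leNgt; apply/negP => lt; apply: ht; apply: two_colours_homo hk => //; exact: ltW.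
pose Q m := `[< exists t, [/\ 0 <= t, ~ two_colours t w & S t w = m] >].
have exQ : exists m, Q m by exists (S 0 w); apply/asboolP; exists 0.
have ubQ m : Q m -> (m <= M)%N by move=> /asboolP[t [t0 ht <-]]; exact: hM.
case: (ex_maxnP exQ ubQ) => m /asboolP[t1 [t10 ht1 St1]] maxm.
have lem t : 0 <= t -> ~ two_colours t w -> (S t w <= m)%N.
  by move=> t0 ht; apply: maxm; apply/asboolP; exists t.
suff -> : n_removed Bc w = m by split => //; exists t1.
rewrite /n_removed /last_point_before; set A := [set t | _].
have [m0|m0] := posnP m.
  rewrite (_ : A = set0) ?sup0.
    by apply/eqP; rewrite eqn_leq lem//= m0.
  apply/seteqP; split => // t [[t0 St _] /lt_two_colour_time h].
  by have := lem t t0 (h t0); rewrite m0 leqNgt St.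
have [tau [tau0 tau1 h1 h2]] := level_time (counting_superpose w) t10 (eq_leq (esym St1)).
have ntau : ~ two_colours tau w by move=> h; apply: ht1; exact: two_colours_homo h.
have Stau : S tau w = m by apply/eqP; rewrite eqn_leq h1 lem.
have Atau : A tau.
  split; last exact/lt_two_colour_time.
  by split => //; [rewrite Stau|move=> s s0 st; rewrite Stau; exact: h2].
have ubA : ubound A tau.
  move=> t [[t0 _ ht] /(lt_two_colour_time w t0) nt]; rewrite leNgt; apply/negP => lt.
  by have := ht tau tau0 lt; rewrite Stau ltnNge lem.
suff -> : sup A = tau by [].
apply/eqP; rewrite eq_le; apply/andP; split; first by apply: ge_sup => //; exists tau.
by apply: ub_le_sup => //; exists tau.
Qed.

Let mB a t (t0 : 0 <= t) : discrete_rv (Bc a t).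
Proof. by move=> v; exact: (cp_measurable (cBc a)). Qed.

Lemma discrete_superpose t : 0 <= t -> discrete_rv (S t).
Proof.
move=> t0; rewrite (_ : S t = (fun s : seq nat => \sum_(x <- s) x)%N \o (fun w => [seq Bc a t w | a <- enum 'I_q])).
  by apply: discrete_comp; apply: discrete_map => a; exact: mB.
by apply/funext => w /=; rewrite big_map big_enum.
Qed.

Lemma measurable_two_colours t : 0 <= t -> measurable [set w | two_colours t w].
Proof.
move=> t0; rewrite (_ : [set w | _] = ((fun s : seq nat => [exists a : 'I_q, exists b : 'I_q,
    [&& a != b, (0 < nth 0 s a)%N & (0 < nth 0 s b)%N]]) \o (fun w => [seq Bc a t w | a <- enum 'I_q])) @^-1` [set true]).
  by apply: discrete_comp; apply: discrete_map => a; exact: mB.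
have E w (a : 'I_q) : nth 0%N [seq Bc a t w | a <- enum 'I_q] a = Bc a t w.
  by rewrite (nth_map a) ?size_enum_ord// nth_ord_enum.
apply/seteqP; split => w /=.
  by move=> [a [b [ab ha hb]]]; apply/existsP; exists a; apply/existsP; exists b; rewrite ab !E ha hb.
by move=> /existsP[a /existsP[b]]; rewrite !E => /and3P[ab ha hb]; exists a, b.
Qed.

Lemma measurable_degenerate : measurable [set w | degenerate w].
Proof.
rewrite (_ : [set w | _] = [set w | two_colours 0 w] `|`
   ((\bigcap_(k : nat) ~` [set w | two_colours (k%:R : R) w]) `&`
    (\bigcap_(n : nat) \bigcup_(k : nat) (S (k%:R : R) @^-1` [set m | (n <= m)%N])))).
  apply: measurableU; first exact: measurable_two_colours.
  apply: measurableI; apply: bigcapT_measurable => n.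
    by apply: measurableC; exact: measurable_two_colours.
  by apply: bigcup_measurable => k _; apply: discrete_preimage; exact: discrete_superpose.
apply/seteqP; split => w /=.
  case=> [h|[h1 h2]]; [by left|right; split => [k _|n _]]; first exact: h1.
  by have [k hk] := h2 n; exists k.
case=> [h|[h1 h2]]; [by left|right; split => [k|n]]; first exact: (h1 k I).
by have [k _ hk] := h2 n I; exists k.
Qed.

(** Outside the degenerate event the maximum of [n_removed_max] may be taken over rational times:
    any time before the second colour is followed by a rational one, with at least as many
    points. *)
Lemma discrete_n_removed : discrete_rv (n_removed Bc).
Proof.
have ge l : measurable [set w | (l <= n_removed Bc w)%N].
  rewrite (_ : [set w | _] = ([set w | degenerate w] `&` S 0 @^-1` [set m | (l <= m)%N]) `|`
     (~` [set w | degenerate w] `&` \bigcup_(i : nat) \bigcup_(k : nat)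
       (~` [set w | two_colours (i%:R / k.+1%:R : R) w] `&` S (i%:R / k.+1%:R : R) @^-1` [set m | (l <= m)%N]))).
    apply: measurableU; apply: measurableI.
    - exact: measurable_degenerate.
    - by apply: discrete_preimage; exact: discrete_superpose.
    - by apply: measurableC; exact: measurable_degenerate.
    - apply: bigcup_measurable => i _; apply: bigcup_measurable => k _; apply: measurableI.
        by apply: measurableC; apply: measurable_two_colours; rewrite divr_ge0.
      by apply: discrete_preimage; apply: discrete_superpose; rewrite divr_ge0.
  apply/seteqP; split => w /=.
    have [dw|ndw] := pselect (degenerate w).
      by rewrite n_removed_degenerate// => h; left.
    have [h1 [t [t0 nt St]]] := n_removed_max ndw.
    rewrite -St => lS; right; split => //.
    have [i [k [ti it]]] := grid_between t0 ((lt_two_colour_time w t0).2 nt).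
    exists i => //; exists k => //; split.
      by apply/(lt_two_colour_time w) => //; rewrite divr_ge0.
    by apply: leq_trans lS _; exact: superpose_homo.
  case=> [[dw]|[ndw [i _ [k _ [nt lS]]]]]; first by rewrite n_removed_degenerate.
  have [h1 _] := n_removed_max ndw.
  by apply: leq_trans lS _; apply: h1 => //; rewrite divr_ge0.
move=> l; rewrite (_ : _ @^-1` _ = [set w | (l <= n_removed Bc w)%N] `\` [set w | (l.+1 <= n_removed Bc w)%N]).
  exact: measurableD.
apply/seteqP; split => w /= => [->|[h1 h2]]; first by rewrite leqnn ltnn.
by apply/eqP; rewrite eqn_leq h1 andbT leqNgt; apply/negP.
Qed.

Lemma discrete_thinned t : 0 <= t -> discrete_rv (thinned Bc t).
Proof.
move=> t0; exact: (discrete_comp (fun z => (z.1 - z.2)%N) (discrete_pair (discrete_superpose t0) discrete_n_removed)).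
Qed.

(** * Time cells with at most one point, seen as draws in a single urn *)

Section GoodPattern.
Variable h : R.
Hypothesis h_gt0 : 0 < h.

Definition cell_incr (a : 'I_q) (c : nat) (w : T) : nat :=
  increment (Bc a) (c%:R * h) (c.+1%:R * h) w.

(** [Some None] is an empty cell, [Some (Some (a, ord0))] a single point of colour [a], read as a
    ball in the unique urn; [None] is a cell with several points. *)
Definition pattern (c : nat) (w : T) : option (option ('I_q * 'I_1)) :=
  if (\sum_a cell_incr a c w == 0)%N then Some None
  else if (\sum_a cell_incr a c w == 1)%N then
    omap (fun a => Some (a, ord0)) [pick a | (0 < cell_incr a c w)%N]
  else None.

Lemma pattern_SomeP c w dd : pattern c w = Some dd <->
  forall a, cell_incr a c w = (dd == Some (a, ord0)) :> nat.
Proof.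
rewrite /pattern; have q1 (a b : 'I_q) (x : 'I_1) : (Some (a, x) == Some (b, ord0) :> option ('I_q * 'I_1)) = (a == b).
  by rewrite (ord1 x); apply/eqP/eqP => [[]|->].
split.
  case: ifPn => [s0 [<-] a|_].
    by apply/eqP; rewrite eqn0Ngt; apply/negP => h0; move: s0; rewrite (bigD1 a)//= addn_eq0 => /andP[/eqP e]; rewrite e in h0.
  case: ifPn => // s1; case: pickP => //= a ha -[<-] b; rewrite q1.
  move: s1; rewrite (bigD1 a)//=; case: (eqVneq a b) => [<-|ba]; first by move: ha; lia.
  by rewrite (bigD1 b) 1?eq_sym//=; move: ha; lia.
case: dd => [[a x]|] H.
  have S1 : (\sum_a cell_incr a c w = 1)%N.
    rewrite (bigD1 a)//= H q1 eqxx big1 ?addn0// => b ba.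
    by rewrite H q1 eq_sym (negbTE ba).
  rewrite S1 /=; case: pickP => [b|/(_ a)]; last by rewrite H q1 eqxx.
  by rewrite H q1 /=; case: eqP => // -> _; rewrite (ord1 x).
by rewrite big1.
Qed.

Variable w : T.
Hypothesis B0 : forall a, Bc a 0 w = 0%N.
Hypothesis reg : ~ degenerate w.
Variables (n : nat) (dd : nat -> option ('I_q * 'I_1)).
Hypothesis good : forall c, (c < n)%N -> pattern c w = Some (dd c).

Let g (c : nat) : R := c%:R * h.
Let g_ge0 c : 0 <= g c. Proof. by rewrite mulr_ge0// ltW. Qed.
Let g_le c c' : (c <= c')%N -> g c <= g c'.
Proof. by move=> cc; rewrite ler_wpM2r ?ler_nat// ltW. Qed.

Let step a c : (c < n)%N -> Bc a (g c.+1) w = (Bc a (g c) w + (dd c == Some (a, ord0)))%N.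
Proof.
move=> cn; have /pattern_SomeP/(_ a) := good cn; rewrite /cell_incr /increment => <-.
by rewrite subnKC//; apply: (cp_nondecreasing (cBc a)) => //; exact: g_le.
Qed.

Let colour_seen a c : (c <= n)%N -> (a \in colours (history dd c) ord0) = (0 < Bc a (g c) w)%N.
Proof.
elim: c => [|c IH] cn; first by rewrite /g mul0r B0 !inE.
rewrite step// addn_gt0 -IH ?(ltnW cn)// lt0b.
by rewrite historyS [LHS]inE [X in _ = X || _]inE mem_rcons inE orbC eq_sym.
Qed.

Let Sstep c : (c < n)%N -> S (g c.+1) w = (S (g c) w + (dd c != None))%N.
Proof.
move=> cn; rewrite /superpose; under eq_bigr do rewrite step//.
rewrite big_split /=; congr addn; case: (dd c) => [[a x]|]; last by rewrite big1.
rewrite (bigD1 a)//= (ord1 x) eqxx big1 // => b /eqP ba.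
by apply/eqP; rewrite eqb0; apply/eqP => -[ab]; apply: ba.
Qed.

Let two_seen c : (c <= n)%N -> two_colours (g c) w <-> (1 < #|colours (history dd c) ord0|)%N.
Proof.
move=> cn; split.
  by move=> [a [b [ab ha hb]]]; apply/card_gt1P; exists a, b; rewrite !colour_seen.
by move=> /card_gt1P[a [b [ha hb ab]]]; exists a, b; rewrite -!colour_seen.
Qed.

(** The removed points are exactly those that are not collisions: those preceding the point which
    brings the second colour. *)
Lemma thinned_pattern c : (c <= n)%N ->
  thinned Bc (g c) w = (\sum_(j < c) collide (history dd j) (dd j))%N.
Proof.
have [Lmax [t [t0 nt SL]]] := n_removed_max reg.
have th c0 : thinned Bc (g c0) w = (S (g c0) w - n_removed Bc w)%N by [].
elim: c => [|c IH] cn.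
  by rewrite big_ord0 th /g mul0r /superpose big1.
rewrite big_ord_recr /= -IH ?(ltnW cn)// !th Sstep//.
(* If two colours are already there, all the removed points lie before [g c] and every new point is
   a collision. Otherwise nothing has been counted yet. *)
have [tw|ntw] := pselect (two_colours (g c) w).
  have LS : (n_removed Bc w <= S (g c) w)%N.
    rewrite -SL; apply: superpose_homo => //; rewrite leNgt; apply/negP => lt; apply: nt.
    by apply: two_colours_homo tw => //; exact: ltW.
  rewrite addnC -addnBA// addnC; congr (_ + _)%N.
  move/two_seen : tw => /(_ (ltnW cn)) c2; case: (dd c) => [[a x]|]//=.
  rewrite (ord1 x); case: (boolP (_ \subset _)) => // /subset_leq_card.
  by rewrite cards1 leqNgt c2.
have SL1 := Lmax _ (g_ge0 c) ntw.
have -> : (S (g c) w - n_removed Bc w = 0)%N by apply/eqP; rewrite subn_eq0.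
rewrite add0n.
have coll : two_colours (g c.+1) w <-> collide (history dd c) (dd c).
  have H := two_seen cn; have H0 := two_seen (ltnW cn); rewrite H; split.
    move=> /card_gt1P[a [b []]]; rewrite !colour_seen// !step//; case E : (dd c) => [[e x]|] /=; last first.
      by rewrite !addn0 => ha hb ab; exfalso; apply: ntw; exists a, b.
    rewrite (ord1 x) => ha hb ab; apply/subsetPn.
    have e1 u : (Some (e, ord0) == Some (u, ord0) :> option ('I_q * 'I_1)) = (e == u).
      by apply/eqP/eqP => [[]|->].
    move: ha hb; rewrite !e1; have [ea|ea] := eqVneq e a.
      have -> : (e == b) = false by rewrite ea (negbTE ab).
      by rewrite addn0 => _ hb; exists b; rewrite ?colour_seen ?(ltnW cn)// inE ea eq_sym.
    by rewrite addn0 => ha _; exists a; rewrite ?colour_seen ?(ltnW cn)// inE eq_sym.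
  case E : (dd c) => [[e x]|] //=; rewrite (ord1 x) => /subsetPn[a ha].
  rewrite inE => ae; apply/card_gt1P; exists a, e; split => //.
    by move: ha; rewrite !colour_seen ?(ltnW cn)// step// => ha; rewrite addn_gt0 ha.
  by rewrite colour_seen// step// E (ord1 x) eqxx addn1.
have [tw'|ntw'] := pselect (two_colours (g c.+1) w); last first.
  have := Lmax _ (g_ge0 c.+1) ntw'; rewrite Sstep// -subn_eq0 => /eqP ->.
  by case: (collide _ _) coll => // [[_ /(_ isT)]].
rewrite (coll.1 tw').
have ddc : dd c != None by move: (coll.1 tw'); case: (dd c).
(* The single point of this cell brings the second colour. The time [t] that realizes the maximum
   cannot have seen it: else all counts at [t] would be those at [g c.+1], and two colours would be
   present at [t]. *)
have LS : (n_removed Bc w <= S (g c) w)%N.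
  rewrite -SL; have [le|lt] := leP t (g c); first exact: superpose_homo.
  have tg : t <= g c.+1 by rewrite leNgt; apply/negP => lt'; apply: nt; apply: two_colours_homo tw' => //; exact: ltW.
  have := superpose_homo w t0 tg; rewrite Sstep// ddc addn1 leq_eqVlt ltnS => /orP[/eqP e|//].
  exfalso; apply: nt; have [a [b [ab ha hb]]] := tw'.
  have eqB u : Bc u t w = Bc u (g c.+1) w.
    have le v : (Bc v t w <= Bc v (g c.+1) w)%N by exact: (cp_nondecreasing (cBc v)).
    apply/eqP; rewrite eqn_leq le /= leqNgt; apply/negP => lt2.
    have : (S t w < S (g c.+1) w)%N.
      by rewrite /superpose (bigD1 u)//= [ltnRHS](bigD1 u)//= -addSn leq_add// leq_sum.
    by rewrite e Sstep// ddc addn1 ltnn.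
  by exists a, b; rewrite !eqB.
have -> : n_removed Bc w = S (g c) w by apply/eqP; rewrite eqn_leq LS SL1.
by rewrite ddc addnC addnK.
Qed.

End GoodPattern.
End Coloured.

(** * Laws of the coloured processes *)

Lemma cvg_natS_inv {R : realType} : (fun K => (K.+1%:R)^-1 : R) @ \oo --> (0 : R).
Proof.
apply: dist_cvgn => e e0; exists (Num.truncn e^-1).+1 => n hn.
rewrite sub0r normrN ger0_norm ?invr_ge0// invf_plt ?posrE ?ltr0n//.
by apply: lt_trans (truncnS_gt _) _; rewrite ltr_nat; apply: leq_ltn_trans hn _.
Qed.

Section PoissonLaw.
Context {R : realType}.

Lemma bernoulli_inequality (t : R) n : 0 <= t <= 1 -> 1 - n%:R * t <= (1 - t) ^+ n.
Proof.
move=> /andP[t0 t1]; elim: n => [|n IH]; first by rewrite mul0r subr0 expr0.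
rewrite exprS -natr1 mulrDl mul1r.
have h : 0 <= 1 - t by lra.
have := ler_wpM2l h IH; have : 0 <= n%:R * t * t by rewrite !mulr_ge0.
nra.
Qed.

(** [expR (- u) * (1 + u)] is the probability of at most one point in a cell of mean [u]; it is at
    least [(1 - u)(1 + u)], and Bernoulli's inequality handles [n] cells. *)
Lemma exp_poisson_lower (u : R) n : 0 <= u <= 1 -> 1 - n%:R * u ^+ 2 <= (expR (- u) * (1 + u)) ^+ n.
Proof.
move=> /andP[u0 u1]; apply: le_trans (@bernoulli_inequality (u ^+ 2) n _) _.
  by rewrite sqr_ge0 -[X in _ <= X](expr1n _ 2) ler_pXn2r// ?nnegrE.
have h := expR_ge1Dx (- u).
apply: lerXn2r; rewrite ?nnegrE.
- by rewrite subr_ge0 -[X in _ <= X](expr1n _ 2) ler_pXn2r// ?nnegrE.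
- by rewrite mulr_ge0 ?expR_ge0//; lra.
- have := ler_wpM2r (_ : 0 <= 1 + u) h; rewrite (_ : 0 <= 1 + u) ; last by lra.
  by move=> /(_ isT); apply: le_trans; rewrite le_eqVlt; apply/orP; left; apply/eqP; ring.
Qed.

(** Once [expR (z - th)] is factored out, what remains is the same expression with [th = z], which
    tends to 1 by [exp_poisson_lower]. *)
Lemma cvg_exp_poisson (th z : R) : 0 <= z ->
  (fun K => (expR (- (th / K.+1%:R)) * (1 + z / K.+1%:R)) ^+ K.+1) @ \oo --> expR (z - th).
Proof.
move=> z0.
have K0 K : K.+1%:R != 0 :> R by rewrite pnatr_eq0.
have inv0 := @cvg_natS_inv R.
have E K : (expR (- (th / K.+1%:R)) * (1 + z / K.+1%:R)) ^+ K.+1 =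
    expR (z - th) * (expR (- (z / K.+1%:R)) * (1 + z / K.+1%:R)) ^+ K.+1.
  rewrite !exprMn mulrA; congr (_ * _).
  rewrite -!expRM_natl -expRD; congr expR; field.
  by rewrite addrC natr1.
apply: (cvgn_ext (fun K => esym (E K))).
rewrite -[X in _ --> X]mulr1; apply: cvgMl_tmp.
have zz : (fun K => z / K.+1%:R) @ \oo --> (0 : R).
  by rewrite -[X in _ --> X](mulr0 z); exact: cvgMl_tmp.
have [N hN] := cvgn_dist zz ltr01.
have z2 : (fun K => 1 - z ^+ 2 / K.+1%:R) @ \oo --> (1 : R).
  rewrite -[X in _ --> X]subr0 -[X in _ --> _ - X](mulr0 (z ^+ 2)).
  by apply: cvgB; [exact: cvg_cst|exact: cvgMl_tmp].
apply: (squeeze_cvgr (f := fun K => 1 - z ^+ 2 / K.+1%:R) (h := fun=> 1)) => //; last exact: cvg_cst.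
exists N => // K /= NK; have := hN K NK; rewrite sub0r normrN => h.
have u0 : 0 <= z / K.+1%:R by rewrite divr_ge0.
have u1 : z / K.+1%:R <= 1 by apply: ltW; apply: le_lt_trans h; exact: ler_norm.
apply/andP; split.
  apply: le_trans (@exp_poisson_lower (z / K.+1%:R) K.+1 _); last by rewrite u0 u1.
  by rewrite lerD2l lerN2 le_eqVlt; apply/orP; left; apply/eqP; field; rewrite addrC natr1.
apply: exprn_ile1; first by rewrite mulr_ge0 ?expR_ge0// addr_ge0.
by rewrite expRN ler_pdivrMl ?expR_gt0// mulr1; exact: expR_ge1Dx.
Qed.

Lemma poisson_prob_set1 (mu : R) (k n : nat) : 0 <= mu ->
  poisson_prob mu k [set n] = (mu ^+ n / n`!%:R * expR (- mu))%:E.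
Proof.
rewrite le_eqVlt /poisson_prob => /orP[/eqP <-|mu0].
  rewrite ltxx oppr0 expR0 mulr1 diracE; case: n => [|n].
    by rewrite mem_set//= expr0 fact0 divr1.
  by rewrite memNset//= expr0n mul0r.
by rewrite mu0 esum_set1 /poisson_pmf mu0// lee_fin !mulr_ge0 ?expR_ge0 ?invr_ge0 ?exprn_ge0 ?ltW.
Qed.

Context {d : measure_display} {T : measurableType d} (P : probability T R).

Lemma poisson_increment_law rt B s t n : poisson_process P rt B -> 0 <= s -> s <= t ->
  0 <= \int[lebesgue_measure]_(u in `]s, t]) rt u ->
  let mu := \int[lebesgue_measure]_(u in `]s, t]) rt u in
  fine (P (increment B s t @^-1` [set n])) = mu ^+ n / n`!%:R * expR (- mu).
Proof.
by move=> pB s0 st mu0 mu; rewrite (pp_law pB)// poisson_prob_set1.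
Qed.

Lemma Rintegral_itv_cst (c s t : R) : s <= t ->
  \int[lebesgue_measure]_(u in `]s, t]) c = c * (t - s).
Proof.
move=> st; rewrite Rintegral_cst//= lebesgue_measure_itv/= lte_fin.
case: ltP => [lt|le]; first by rewrite -EFinB.
by have -> : t - s = 0 by lra; rewrite /= mulr0.
Qed.

Lemma discrete_increment (B : R -> T -> nat) (s t : R) : counting_process B -> 0 <= s -> 0 <= t ->
  discrete_rv (increment B s t).
Proof.
move=> cB s0 t0; apply: (discrete_comp (fun z => (z.2 - z.1)%N) (V := fun w => (B s w, B t w))).
by apply: discrete_pair => v; exact: (cp_measurable cB).
Qed.

End PoissonLaw.

Section SigmaProcess.
Context {d : measure_display} {T : measurableType d} {R : realType}.
Variable B : R -> T -> nat.

Let gens := [set A | exists t U, 0 <= t /\ A = B t @^-1` U].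
(** With this measurable space, lemmas on [discrete_rv] yield membership in [sigma_process B]. *)
Let T' := g_sigma_algebraType gens.

Lemma sigma_process_discrete t : 0 <= t -> discrete_rv (B t : T' -> nat).
Proof.
by move=> t0 v; apply: sub_sigma_algebra; exists t, [set v].
Qed.

Lemma sigma_process_seq (S : countType) (ts : seq R) (f : seq nat -> S) (v : S) :
  (forall t, t \in ts -> 0 <= t) -> sigma_process B ((fun w => f [seq B t w | t <- ts]) @^-1` [set v]).
Proof.
move=> ts0.
(* [discrete_map] quantifies over all indices; the absolute value makes every time admissible and
   does not change those of [ts]. *)
have H : discrete_rv ((fun w => [seq B `|t| w | t <- ts]) : T' -> seq nat).
  by apply: discrete_map => t; exact: sigma_process_discrete.
have -> : (fun w => f [seq B t w | t <- ts]) = f \o (fun w => [seq B `|t| w | t <- ts]).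
  apply/funext => w /=; congr f; apply/eq_in_map => t tt.
  by rewrite ger0_norm//; exact: ts0.
exact: (discrete_comp f H).
Qed.

End SigmaProcess.

Section OneColouredProcess.
Context {d : measure_display} {T : measurableType d} {R : realType} {q : nat}.
Hypothesis q_ge2 : (2 <= q)%N.
Variables (P : probability T R) (psi : R) (Bc : 'I_q -> R -> T -> nat).
Hypothesis psi_ge0 : 0 <= psi.
Hypothesis pBc : forall a, poisson_process P (fun=> psi / q%:R) (Bc a).
Hypothesis iBc : mutual_indep P (fun a => sigma_process (Bc a)).

Let cBc a : counting_process (Bc a). Proof. exact: pp_counting (pBc a). Qed.

Lemma q_gt0 : (0 : R) < q%:R. Proof. by rewrite ltr0n; exact: leq_trans q_ge2. Qed.

Lemma rate_itv s t : s <= t ->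
  \int[lebesgue_measure]_(u in `]s, t]) (psi / q%:R) = psi / q%:R * (t - s).
Proof. exact: Rintegral_itv_cst. Qed.

Lemma colour_zero_law a t : 0 <= t ->
  fine (P (increment (Bc a) 0 t @^-1` [set 0%N])) = expR (- (psi * t / q%:R)).
Proof.
move=> t0; rewrite (poisson_increment_law _ (pBc a))// rate_itv// subr0.
  by rewrite expr0 fact0 divr1 mul1r mulrAC.
by rewrite mulr_ge0 ?divr_ge0.
Qed.

(** If [psi = 0] there are no points at all; otherwise every colour eventually appears, and there
    are at least two colours. Neither degenerate case survives. *)
Lemma regular_ae : {ae P, forall w, (forall a, Bc a 0 w = 0%N) /\ ~ degenerate Bc w}.
Proof.
have B0 : {ae P, forall w, forall a, Bc a 0 w = 0%N}.
  by apply: filter_forall => a; exact: pp_start (pBc a).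
have [psi0|psi0] := eqVneq psi 0.
  have H : {ae P, forall w, forall (n : nat) a, increment (Bc a) 0 (n%:R : R) w = 0%N}.
    apply/ae_foralln => n; apply: filter_forall => a.
    have m0 : measurable (increment (Bc a) 0 (n%:R : R) @^-1` [set 0%N]) by exact: discrete_increment.
    have := @Pr0_ae _ _ _ P (~` (increment (Bc a) 0 (n%:R : R) @^-1` [set 0%N])) (measurableC m0).
    rewrite PrC// colour_zero_law// psi0 !mul0r oppr0 expR0 subrr => /(_ erefl).
    by apply: filterS => w /contrapT.
  apply: filterS2 B0 H => w b0 inc; split => // -[[a [b [_]]]|[_ /(_ 1%N) [k]]]; first by rewrite b0.
  rewrite /superpose big1// => a _; have := inc k a.
  by rewrite /increment b0 subn0.
have psi_gt0 : 0 < psi by rewrite lt_neqAle eq_sym psi0.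
have H : {ae P, forall w, forall a, exists n : nat, increment (Bc a) 0 (n%:R : R) w <> 0%N}.
  apply: filter_forall => a.
  have m0 : measurable (\bigcap_(n : nat) increment (Bc a) 0 (n%:R : R) @^-1` [set 0%N]).
    by apply: bigcapT_measurable => n; exact: discrete_increment.
  have := @Pr0_ae _ _ _ P _ m0.
  have -> : fine (P (\bigcap_(n : nat) increment (Bc a) 0 (n%:R : R) @^-1` [set 0%N])) = 0.
    apply/eqP; rewrite eq_le Pr_ge0 andbT.
    have c : (fun n : nat => expR (- (psi * n%:R / q%:R))) @ \oo --> (0 : R).
      apply: (cvg_comp _ _ _ (@cvgr_expR R)).
      apply/cvgryPge => A; exists (Num.truncn (`|A| * q%:R / psi)).+1 => // n /= hn.
      rewrite ler_pdivlMr ?q_gt0// [_ * n%:R]mulrC -ler_pdivrMr//.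
      apply: (@le_trans _ _ (`|A| * q%:R / psi)).
        by rewrite ler_wpM2r ?invr_ge0// ler_wpM2r ?ler_norm.
      by rewrite ltW//; apply: lt_le_trans (truncnS_gt _) _; rewrite ler_nat.
    apply: (@cvg_le R _ _ _ _ _ (@cvgn_cst R _) c) => n.
    rewrite -(@colour_zero_law a)//; apply: Pr_le => //; first exact: discrete_increment.
    by move=> w /(_ n I).
  by move=> /(_ erefl); apply: filterS => w /existsNP[n /not_implyP[_ hn]]; exists n.
apply: filterS2 B0 H => w b0 inc; split => // -[[a [b [_]]]|[nt _]]; first by rewrite b0.
have [q0 q1] : (0 < q)%N /\ (1 < q)%N by split => //; exact: leq_trans q_ge2.
have [n0 h0] := inc (Ordinal q0); have [n1 h1] := inc (Ordinal q1).
apply: (nt (maxn n0 n1)); exists (Ordinal q0), (Ordinal q1); split => //.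
- move: h0; rewrite /increment b0 subn0 => /eqP; rewrite -lt0n => /leq_trans; apply.
  by apply: (cp_nondecreasing (cBc _)); rewrite ?ler_nat ?leq_maxl.
- move: h1; rewrite /increment b0 subn0 => /eqP; rewrite -lt0n => /leq_trans; apply.
  by apply: (cp_nondecreasing (cBc _)); rewrite ?ler_nat ?leq_maxr.
Qed.

Section Cells.
Variable h : R.
Hypothesis h_gt0 : 0 < h.

(** [r] is the probability of an empty cell and [p] that of a cell with one point; [1 - r - p] is
    that of a failure. *)
Let r : R := expR (- (psi * h)).
Let p (_ : 'I_1) : R := r * (psi * h).

Lemma discrete_pattern c : discrete_rv (pattern Bc h c).
Proof.
pose f (s : seq nat) : option (option ('I_q * 'I_1)) :=
  if (\sum_(a < q) nth 0 s a == 0)%N then Some None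
  else if (\sum_(a < q) nth 0 s a == 1)%N then
    omap (fun a => Some (a, ord0)) [pick a : 'I_q | (0 < nth 0 s a)%N]
  else None.
rewrite (_ : pattern Bc h c = f \o (fun w => [seq cell_incr Bc h a c w | a <- enum 'I_q])).
  apply: discrete_comp; apply: discrete_map => a; apply: discrete_increment => //.
  - by rewrite mulr_ge0// ltW.
  - by rewrite mulr_ge0// ltW.
apply/funext => w; rewrite /f /=.
have E (a : 'I_q) : nth 0%N [seq cell_incr Bc h a c w | a <- enum 'I_q] a = cell_incr Bc h a c w.
  by rewrite (nth_map a) ?size_enum_ord// nth_ord_enum.
rewrite (eq_bigr (fun a => cell_incr Bc h a c w)); last by move=> a _; rewrite E.
by rewrite (eq_pick (Q := fun a => 0 < cell_incr Bc h a c w)%N)//; move=> a; rewrite /= E.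
Qed.

Lemma cell_incr_law a c n : fine (P (cell_incr Bc h a c @^-1` [set n])) =
  (psi * h / q%:R) ^+ n / n`!%:R * expR (- (psi * h / q%:R)).
Proof.
have E : c.+1%:R * h - c%:R * h = h by rewrite -mulrBl -natr1; ring.
have le : c%:R * h <= c.+1%:R * h by rewrite ler_wpM2r ?ler_nat// ltW.
have c0 : 0 <= c%:R * h by rewrite mulr_ge0// ltW.
rewrite (poisson_increment_law _ (pBc a))// rate_itv// E.
  by rewrite [psi / q%:R * h]mulrAC.
by rewrite mulr_ge0 ?divr_ge0// ltW.
Qed.

Lemma colour_cells_law a (n : nat -> nat) m :
  fine (P (\bigcap_(c in [set` iota 0 m]) cell_incr Bc h a c @^-1` [set n c])) =
  \prod_(c <- iota 0 m) fine (P (cell_incr Bc h a c @^-1` [set n c])).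
Proof.
have g0 : 0 <= 0%:R * h by rewrite mul0r.
have gm : {homo (fun c : nat => c%:R * h) : i j / (i <= j)%N >-> i <= j}.
  by move=> i j ij; rewrite ler_wpM2r ?ler_nat// ltW.
rewrite (pp_indep (pBc a) g0 gm (iota_uniq 0 m) (A := fun c => cell_incr Bc h a c @^-1` [set n c])).
  rewrite fine_prode// => c; apply: fin_num_measure; apply: discrete_increment => //.
  - by rewrite mulr_ge0// ltW.
  - by rewrite mulr_ge0// ltW.
by move=> c _; exists [set n c].
Qed.

(** Independence is used first between the colours, then between the increments of each colour;
    exchanging the two products gives one factor per cell. *)
Lemma pattern_cylinder_law hs :
  fine (P (cylinder (pattern Bc h) hs)) = \prod_(dd <- hs) draw_weight r p dd.
Proof.
pose n a c : nat := nth None hs c == Some (a, ord0).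
pose A a := \bigcap_(c in [set` iota 0 (size hs)]) cell_incr Bc h a c @^-1` [set n a c].
have -> : cylinder (pattern Bc h) hs = \bigcap_(a in [set` index_enum 'I_q]) A a.
  rewrite /cylinder; apply/seteqP; split => w /=.
    move=> E a _ c /=; rewrite mem_iota add0n /= => ch.
    have := congr1 (fun l => nth None l c) E.
    rewrite (nth_map 0%N) ?size_iota// nth_iota// (nth_map None)// add0n.
    by move=> /pattern_SomeP H; exact: H.
  move=> H; apply: (@eq_from_nth _ None); first by rewrite !size_map size_iota.
  move=> c; rewrite size_map size_iota => ch.
  rewrite (nth_map 0%N) ?size_iota// nth_iota// (nth_map None)// add0n.
  by apply/(pattern_SomeP _ h_gt0) => a; apply: (H a); rewrite /= ?mem_index_enum// mem_iota.
rewrite (iBc (index_enum_uniq _)); last first.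
  move=> a _; rewrite /A.
  pose f (s : seq nat) := [seq (nth 0 s c.+1 - nth 0 s c)%N | c <- iota 0 (size hs)].
  pose ts : seq R := [seq c%:R * h | c <- iota 0 (size hs).+1].
  have ts0 t : t \in ts -> 0 <= t by move=> /mapP[c _ ->]; rewrite mulr_ge0// ltW.
  have := sigma_process_seq (B := Bc a) f [seq n a c | c <- iota 0 (size hs)] ts0.
  congr (sigma_process _ _).
  have E w c : (c <= size hs)%N -> nth 0%N [seq Bc a t w | t <- ts] c = Bc a (c%:R * h) w.
    move=> ch; rewrite (nth_map 0) ?size_map ?size_iota// (nth_map 0%N) ?size_iota//.
    by rewrite nth_iota.
  apply/seteqP; split => w /=.
    move=> F c /=; rewrite mem_iota add0n /= => ch.
    have := congr1 (fun l => nth 0%N l c) F; rewrite /f !(nth_map 0%N) ?size_iota// !nth_iota// add0n.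
    by rewrite !E// ltnW.
  move=> F; apply/eq_in_map => c cm; move: (cm); rewrite mem_iota add0n /= => ch.
  apply: etrans (F c cm); rewrite /cell_incr /increment.
  by apply: congr2; [exact: (E w c.+1 ch)|exact: (E w c (ltnW ch))].
rewrite fine_prode; last first.
  move=> a; apply: fin_num_measure; apply: fin_bigcap_measurable => // c _.
  by apply: discrete_increment => //; rewrite mulr_ge0// ltW.
rewrite (eq_bigr (fun a => \prod_(c <- iota 0 (size hs)) fine (P (cell_incr Bc h a c @^-1` [set n a c])))); last first.
  by move=> a _; exact: colour_cells_law.
rewrite exchange_big /= [RHS](big_nth None) /index_iota subn0; apply: eq_bigr => c _.
rewrite (eq_bigr (fun a => (psi * h / q%:R) ^+ n a c * expR (- (psi * h / q%:R)))); last first.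
  by move=> a _; rewrite cell_incr_law /n; case: eqP; rewrite /= ?fact0 ?divr1.
rewrite big_split /= prodr_const card_ord -expRM_natl.
have -> : q%:R * - (psi * h / q%:R) = - (psi * h) by field; exact: lt0r_neq0 q_gt0.
rewrite /n; case: (nth None hs c) => [[a x]|] /=; last by rewrite big1 ?mul1r.
rewrite (bigD1 a)//= (ord1 x) eqxx expr1 big1 ?mulr1.
  by rewrite /p -/r; ring.
move=> b /eqP ba; case: eqP => // -[ab]; by case: ba.
Qed.

Lemma Ex_pattern_run xs : (forall x, x \in xs -> 0 <= x <= 1) ->
  \int[P]_w run (pattern Bc h) xs 0 [::] w = foldr (draw_op q r p) (fun=> 1) xs (fun=> None).
Proof.
by move=> xsP; apply: Ex_run => //; [exact: discrete_pattern|exact: pattern_cylinder_law].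
Qed.

Lemma thinned_run : {ae P, forall w : T, forall (xs : seq R) n,
  size xs = n -> (forall c, (c < n)%N -> pattern Bc h c w <> None) ->
  run (pattern Bc h) xs 0 [::] w =
    \prod_(c < n) nth 0 xs c ^+ (block_incr (fun c => thinned Bc (c%:R * h) w) 1 c) /\
  forall c, (c < n)%N -> (block_incr (fun c => thinned Bc (c%:R * h) w) 1 c <= 1)%N }.
Proof.
apply: filterS regular_ae => w [b0 nd] xs n sz good.
have [dd hdd] : exists dd : nat -> option ('I_q * 'I_1), forall c, (c < n)%N -> pattern Bc h c w = Some (dd c).
  exists (fun c => odflt None (pattern Bc h c w)) => c /good; by case: (pattern _ _ _ _).
have TP c : (c <= n)%N -> thinned Bc (c%:R * h) w = (\sum_(j < c) collide (history dd j) (dd j))%N.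
  exact: (thinned_pattern cBc h_gt0 b0 nd hdd).
have BI c : (c < n)%N -> block_incr (fun c => thinned Bc (c%:R * h) w) 1 c = collide (history dd c) (dd c).
  by move=> cn; rewrite /block_incr !muln1 !TP ?(ltnW cn)// big_ord_recr /= addKn.
split; last by move=> c cn; rewrite BI//; case: collide.
rewrite (@run_good _ _ _ _ _ _ xs 0 w dd) ?sz//.
by apply: eq_bigr => c _; rewrite add0n BI.
Qed.

Definition bad_cell n : set T := [set w | exists2 c, (c < n)%N & pattern Bc h c w = None].

Lemma measurable_bad_cell n : measurable (bad_cell n).
Proof.
rewrite (_ : bad_cell n = \bigcup_(c in [set c | (c < n)%N]) pattern Bc h c @^-1` [set None]).
  by apply: bigcup_measurable => c _; exact: discrete_pattern.
by apply/seteqP; split => w [c cn hc]; exists c.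
Qed.

Lemma bad_cell_law n : fine (P (bad_cell n)) = 1 - (r + p ord0) ^+ n.
Proof.
(* With all weights equal to 1, the run is the indicator that no cell fails. *)
have E : (r + p ord0) ^+ n = \int[P]_w run (pattern Bc h) (nseq n 1) 0 [::] w.
  rewrite Ex_pattern_run; last by move=> x /nseqP[-> _]; rewrite ler01 lexx.
  suff -> : foldr (draw_op q r p) (fun=> 1) (nseq n 1) = fun=> (r + p ord0) ^+ n by [].
  elim: n => [//|n IH] /=; rewrite IH; apply/funext => sg.
  rewrite /draw_op big_ord1 exprS mulrDl; congr (_ + _ * _).
  by case: (sg ord0) => [[]|] /=; rewrite ?mul1r ?mulr1//; ring.
rewrite E; have -> : \int[P]_w run (pattern Bc h) (nseq n 1) 0 [::] w = \int[P]_w \1_(~` bad_cell n) w.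
  apply: eq_Rintegral => w _; rewrite indicE.
  have [[c cn hc]|nb] := pselect (bad_cell n w).
    rewrite (@run_bad _ _ _ _ _ _ _ 0 [::] w c) ?size_nseq// memNset//= => nb; apply: nb; by exists c.
  rewrite mem_set//.
  rewrite (@run_good _ _ _ _ _ _ (nseq n 1) 0 w (fun c => odflt None (pattern Bc h c w))).
    rewrite big1// => j _; rewrite nth_nseq.
    have -> : (j < n)%N by rewrite -[X in (_ < X)%N](size_nseq n (1 : R)) ltn_ord.
    by rewrite expr1n.
  move=> c; rewrite add0n size_nseq => cn; case E' : (pattern Bc h c w) => //.
  by exfalso; apply: nb; exists c.
rewrite Ex_indic; last by apply: measurableC; exact: measurable_bad_cell.
by rewrite (PrC P (measurable_bad_cell n)) opprB addrC subrK.
Qed.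

Lemma r_le1 : r <= 1.
Proof. by rewrite expR_le1 oppr_le0 mulr_ge0// ltW. Qed.

Lemma bad_cell_le n : psi * h <= 1 -> fine (P (bad_cell n)) <= n%:R * (psi * h) ^+ 2.
Proof.
move=> ph1; rewrite bad_cell_law lerBlDr -lerBlDl.
have := @exp_poisson_lower R (psi * h) n; rewrite ph1 andbT mulr_ge0//; last exact: ltW.
by move=> /(_ isT) /le_trans; apply; rewrite le_eqVlt /p /r mulrDr mulr1 eqxx.
Qed.

(** A point of the thinned process needs an earlier point of [B_i], hence a quadratic bound. With
    [u = psi * h], failing cells cost at most [(j + 1) u^2] and a collision in cell [j] at most
    [j u^2]. *)
Lemma thinned_cell_le j : psi * h <= 1 ->
  fine (P [set w | (0 < block_incr (fun c => thinned Bc (c%:R * h) w) 1 j)%N]) <=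
  (2 * j.+1)%:R * (psi * h) ^+ 2.
Proof.
move=> ph1.
have ph0 : 0 <= psi * h by rewrite mulr_ge0// ltW.
have p0 : 0 <= p ord0 by rewrite mulr_ge0 ?expR_ge0.
have r0 : 0 <= r by exact: expR_ge0.
have rp1 : r + p ord0 <= 1.
  rewrite /p -{1}[r]mulr1 -mulrDr /r expRN ler_pdivrMl ?expR_gt0// mulr1; exact: expR_ge1Dx.
(* The final weight 0 kills the run when cell [j] brings a collision; a failing cell kills it
   too. *)
pose xs := rcons (nseq j 1) (0 : R).
have xsP x : x \in xs -> 0 <= x <= 1.
  by rewrite mem_rcons inE => /orP[/eqP ->|/nseqP[-> _]]; rewrite ?lexx ?ler01.
(* The power is the probability that no cell fails. The subtracted term bounds a collision in the
   last cell: a point there and an earlier ball, either present at the start or fallen in one of the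
   [k] previous cells. *)
have low k sg : (r + p ord0) ^+ k.+1 - p ord0 * ((sg ord0 != None)%:R + k%:R * p ord0) <=
    foldr (draw_op q r p) (fun=> 1) (rcons (nseq k 1) 0) sg.
  elim: k sg => [|k IH] sg.
    rewrite /= /draw_op big_ord1 mul0r addr0 expr1 mulr1.
    case: (sg ord0) => [[]|] /=; rewrite ?mulr0 ?mulr1 ?subr0 ?mul0r ?addr0 ?addrK//.
      by rewrite lerDl mulr_ge0.
    by rewrite lerDl divr_ge0.
  rewrite /= {1}/draw_op big_ord1.
  have A s : (r + p ord0) ^+ k.+1 - p ord0 * (1 + k%:R * p ord0) <=
      foldr (draw_op q r p) (fun=> 1) (rcons (nseq k 1) 0) (update sg ord0 s).
    apply: le_trans (IH _); rewrite lerD2l lerN2 ler_wpM2l// lerD2r /update eqxx.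
    by case: (s != None); rewrite ?ler01.
  have B : (r + p ord0) ^+ k.+1 - p ord0 * (1 + k%:R * p ord0) <=
     add_ball q 1 (fun s => foldr (draw_op q r p) (fun=> 1) (rcons (nseq k 1) 0) (update sg ord0 s)) (sg ord0).
    have := A None; have A1 := A (Some false); have A2 := A (Some true) => _.
    have i0 := @qi_gt0 R q q_ge2; have i1 := @qi_lt1 R q q_ge2.
    case: (sg ord0) => [[]|] //=; rewrite ?mul1r ?mulr1//.
    move: A1 A2; set u := _ - _; set f1 := foldr _ _ _ _; set f2 := foldr _ _ _ _ => A1 A2.
    have := ler_wpM2l (ltW i0) A1; have i2 : 0 <= 1 - q%:R^-1 :> R by lra.
    by have := ler_wpM2l i2 A2; lra.
  apply: le_trans (lerD (ler_wpM2l r0 (IH sg)) (ler_wpM2l p0 B)).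
  rewrite -[k.+1%:R]natr1 (exprS _ k.+1); set e := (sg ord0 != None)%:R.
  have e0 : 0 <= e :> R by exact: ler0n.
  have k0 : 0 <= k%:R :> R by exact: ler0n.
  set a := (r + p ord0) ^+ k.+1; set pp := p ord0 in p0 rp1 *.
  have h1 : 0 <= pp * e * (1 - r) by apply: mulr_ge0; [exact: mulr_ge0|rewrite subr_ge0; exact: r_le1].
  have h2 : 0 <= pp * k%:R * pp * (1 - r - pp) by apply: mulr_ge0; [exact: mulr_ge0 (mulr_ge0 p0 k0) p0|rewrite -addrA -opprD subr_ge0].
  rewrite -subr_ge0.
  have -> : r * (a - pp * (e + k%:R * pp)) + pp * (a - pp * (1 + k%:R * pp)) - ((r + pp) * a - pp * (e + (k%:R + 1) * pp)) =
      pp * e * (1 - r) + pp * k%:R * pp * (1 - r - pp) by ring.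
  exact: addr_ge0.
have {}low := low j (fun=> None); rewrite /= add0r in low.
have dT c : discrete_rv (thinned Bc (c%:R * h)) by apply: discrete_thinned => //; rewrite mulr_ge0// ltW.
pose A := [set w | (0 < block_incr (fun c => thinned Bc (c%:R * h) w) 1 j)%N].
have mA : measurable A.
  apply: (discrete_preimage (V := fun w => block_incr (fun c => thinned Bc (c%:R * h) w) 1 j) [set k | (0 < k)%N]).
  exact: (discrete_comp (fun z => (z.1 - z.2)%N) (discrete_pair (dT _) (dT _))).
have bR : bmf (run (pattern Bc h) xs 0 [::]) by apply: bmf_run => //; exact: discrete_pattern.
have key : fine (P A) <= 1 - \int[P]_w run (pattern Bc h) xs 0 [::] w.
  rewrite -{1}(Ex_cst P 1) -ExB//; last exact: bmf_cst.
  rewrite -Ex_indic//.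
  apply: Ex_le_ae; [exact: bmf_indic|by apply: bmfB => //; exact: bmf_cst|].
  apply: filterS thinned_run => w hw.
  have /andP[g0 g1] := @run_bound R q 1 _ _ (pattern Bc h) xs 0 [::] w xsP.
  rewrite indicE; have [Aw|nA] := pselect (A w); last by rewrite memNset// subr_ge0.
  rewrite mem_set// lerBrDr addrC -lerBrDr subrr.
  have [[c cn hc]|nb] := pselect (bad_cell j.+1 w).
    by rewrite (@run_bad _ _ _ _ _ _ _ 0 [::] w c)// size_rcons size_nseq.
  have [|c cn hc|-> _] := hw xs j.+1; first by rewrite size_rcons size_nseq.
    by apply: nb; exists c.
  by rewrite big_ord_recr /= nth_rcons size_nseq ltnn eqxx expr0n (gtn_eqF Aw) mulr0.
apply: le_trans key _; rewrite Ex_pattern_run//.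
have e := @exp_poisson_lower R (psi * h) j.+1 _.
have {}e : 1 - j.+1%:R * (psi * h) ^+ 2 <= (r + p ord0) ^+ j.+1.
  have -> : r + p ord0 = expR (- (psi * h)) * (1 + psi * h) by rewrite /p /r mulrDr mulr1.
  by apply: e; rewrite ph0.
have pu : p ord0 <= psi * h by rewrite /p -[leRHS]mul1r ler_wpM2r//; exact: r_le1.
have : p ord0 * (j%:R * p ord0) <= j%:R * (psi * h) ^+ 2.
  by rewrite mulrCA ler_wpM2l// expr2; exact: ler_pM.
have : j%:R * (psi * h) ^+ 2 <= j.+1%:R * (psi * h) ^+ 2 by rewrite ler_wpM2r ?sqr_ge0// ler_nat.
move: low; set F := foldr _ _ _ _; rewrite natrM; lra.
Qed.

End Cells.
End OneColouredProcess.

Section OneUrn.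
Context {R : realType} {q : nat}.
Hypothesis q_ge2 : (2 <= q)%N.

Lemma cvg_eigcoord x (v : nat -> urn_state -> R) (v' : urn_state -> R) e :
  (forall s, (fun K => v K s) @ \oo --> v' s) ->
  (fun K => eigcoord q x (v K) e) @ \oo --> eigcoord q x v' e.
Proof.
move=> vv; case: e => [[]|] /=; first exact: vv.
  by apply: cvgB; [exact: vv|apply: cvgMl_tmp; exact: vv].
apply: cvgB; [apply: cvgB; [exact: vv|]|]; apply: cvgMl_tmp; last exact: vv.
by apply: cvgB; [exact: vv|apply: cvgMl_tmp; exact: vv].
Qed.

(** In the eigenbasis a block of [K.+1] cells multiplies by [(expR (- th / K.+1) (1 + th * mu /
    K.+1))^K.+1], where [mu] is an eigenvalue. Its limit [expR (th * (mu - 1))] is the factor in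
    [add_poisson]. *)
Lemma cvg_draw_blocks (th : R) xs : 0 <= th -> (forall x, x \in xs -> 0 <= x /\ x != q%:R^-1) ->
  forall s, (fun K => draw_blocks q (expR (- (th / K.+1%:R)))
      (fun _ : 'I_1 => expR (- (th / K.+1%:R)) * (th / K.+1%:R)) K.+1 xs (fun=> s)) @ \oo -->
    add_poisson_blocks q th xs s.
Proof.
move=> th0; elim: xs => [|x xs IH] xsP s; first exact: @cvgn_cst.
have {}IH := IH (fun y yx => xsP y (mem_behead (s := x :: xs) yx)).
have [x0 xq] := xsP x (mem_head _ _).
pose F K := draw_blocks q (expR (- (th / K.+1%:R))) (fun _ : 'I_1 => expR (- (th / K.+1%:R)) * (th / K.+1%:R)) K.+1 xs.
have {}IH t : (fun K => F K (fun=> t)) @ \oo --> add_poisson_blocks q th xs t by exact: IH.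
rewrite /= /add_poisson.
have FE K : F K = prodf (fun (_ : 'I_1) s => F K (fun=> s)).
  apply/funext => sg; rewrite /prodf big_ord1; congr (F K _).
  by apply/funext => i; rewrite (ord1 i).
apply: (@cvgn_ext _ (fun K => \sum_(e : {ffun 'I_1 -> urn_state})
    eigcoord q x (fun s => F K (fun=> s)) (e ord0) *
    ((expR (- (th / K.+1%:R)) * (1 + th * eigval q x (e ord0) / K.+1%:R)) ^+ K.+1 *
     eigvec q x (e ord0) s))).
  move=> K; rewrite [RHS](_ : _ = iter K.+1 (draw_op q (expR (- (th / K.+1%:R))) (fun _ : 'I_1 => expR (- (th / K.+1%:R)) * (th / K.+1%:R)) x) (F K) (fun=> s))//.
  rewrite [X in iter _ _ X]FE iter_draw_op_prodf//.
  apply: eq_bigr => e _; rewrite /prodf !big_ord1; congr (_ * (_ ^+ _ * _)); ring.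
have -> : \sum_e eigcoord q x (add_poisson_blocks q th xs) e *
    expR (th * (eigval q x e - 1)) * eigvec q x e s =
  \sum_(e : {ffun 'I_1 -> urn_state}) eigcoord q x (add_poisson_blocks q th xs) (e ord0) *
    (expR (th * (eigval q x (e ord0) - 1)) * eigvec q x (e ord0) s).
  transitivity (\prod_(i < 1) \sum_e eigcoord q x (add_poisson_blocks q th xs) e *
    (expR (th * (eigval q x e - 1)) * eigvec q x e s)).
    by rewrite big_ord1; apply: eq_bigr => e _; rewrite mulrA.
  by rewrite bigA_distr_bigA; apply: eq_bigr => e _; rewrite big_ord1.
apply: cvg_big => [|e _]; first exact: (@add_continuous).
apply: cvgM; first by apply: cvg_eigcoord.
apply: cvgMr_tmp; rewrite mulrBr mulr1; apply: cvg_exp_poisson.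
apply: mulr_ge0 => //; by case: (e ord0) => [[]|] //=.
Qed.

End OneUrn.

Lemma sum_block_incr (f : nat -> nat) n : {homo f : i j / (i <= j)%N} ->
  (\sum_(t < n) block_incr f 1 t = f n - f 0)%N.
Proof.
move=> hf; elim: n => [|n IH]; first by rewrite big_ord0 subnn.
rewrite big_ord_recr /= IH /block_incr !muln1.
by rewrite addnC addnBA ?subnK ?hf.
Qed.

Section ThinnedGF.
Context {d : measure_display} {T : measurableType d} {R : realType} {q : nat}.
Hypothesis q_ge2 : (2 <= q)%N.
Variables (P : probability T R) (psi : R) (Bc : 'I_q -> R -> T -> nat).
Hypothesis psi_ge0 : 0 <= psi.
Hypothesis pBc : forall a, poisson_process P (fun=> psi / q%:R) (Bc a).
Hypothesis iBc : mutual_indep P (fun a => sigma_process (Bc a)).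

Lemma thinned_gf (delta : R) (xs : seq R) : 0 < delta ->
  (forall x, x \in xs -> 0 <= x <= 1 /\ x != q%:R^-1) ->
  \int[P]_w pow xs (block_incrs (fun c => thinned Bc (c%:R * delta) w) 1 (size xs)) =
  blocks_gf q xs (psi * delta).
Proof.
move=> d0 xsP; set J := size xs; set th := psi * delta.
have cBc a : counting_process (Bc a) by exact: pp_counting (pBc a).
have th0 : 0 <= th by rewrite mulr_ge0// ltW.
have xs01 x : x \in xs -> 0 <= x <= 1 by move=> /xsP[].
pose D w := block_incrs (fun c => thinned Bc (c%:R * delta) w) 1 J; under eq_Rintegral do rewrite -/(D _).
have dT c : discrete_rv (thinned Bc (c%:R * delta)) by apply: discrete_thinned => //; rewrite mulr_ge0// ltW.
have bD : bmf (fun w => pow xs (D w)).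
  apply: (bmf_discrete (g := pow xs)); first exact: discrete_block_incrs.
  by exists 1 => v; have /andP[a b] := pow_bound v xs01; rewrite ger0_norm.
pose h K : R := delta / K.+1%:R.
have h0 K : 0 < h K by rewrite divr_gt0.
pose ys K := flatten [seq nseq K.+1 x | x <- xs].
have ys01 K x : x \in ys K -> 0 <= x <= 1.
  by move=> /flattenP[l /mapP[y yx ->] /nseqP[-> _]]; exact: xs01.
pose bad K := bad_cell Bc (h K) (size (ys K)).
have phE K : psi * h K = th / K.+1%:R by rewrite /h mulrA.
have szys K : size (ys K) = (K.+1 * J)%N.
  rewrite size_flatten /shape -map_comp (eq_map (g := fun=> K.+1)); last by move=> x; rewrite /= size_nseq.
  by rewrite sumnE big_map big_const_seq count_predT iter_addn_0.
have Prbad : (fun K => fine (P (bad K))) @ \oo --> (0 : R).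
  apply: (@cvgn_ext _ (fun K => 1 - ((expR (- (th / K.+1%:R)) * (1 + th / K.+1%:R)) ^+ K.+1) ^+ J)).
    by move=> K; rewrite /bad (bad_cell_law q_ge2 psi_ge0)// szys exprM phE mulrDr mulr1.
  rewrite -[X in _ --> X](subrr 1); apply: cvgB; first exact: cvg_cst.
  have := @cvg_exp_poisson R th th th0; rewrite subrr expR0 => c.
  elim: (J) => [|n IH]; first exact: @cvgn_cst.
  by rewrite -[X in _ --> X](mulr1 1); under eq_fun do rewrite exprS; exact: cvgM.
have close K : `|\int[P]_w pow xs (D w) -
    draw_blocks q (expR (- (th / K.+1%:R))) (fun _ : 'I_1 => expR (- (th / K.+1%:R)) * (th / K.+1%:R)) K.+1 xs (fun=> None)|
    <= fine (P (bad K)).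
  have := @Ex_pattern_run _ _ _ _ q_ge2 P psi Bc psi_ge0 pBc iBc (h K) (h0 K) (ys K) (@ys01 K).
  rewrite foldr_draw_blocks phE => <-.
  rewrite -[leRHS]mul1r -[leRHS]add0r; apply: Ex_close_ae => //.
  - by apply: bmf_run => [c|x]; [exact: (discrete_pattern pBc)|exact: ys01].
  - exact: (measurable_bad_cell pBc).
  have := @thinned_run _ _ _ _ q_ge2 P psi Bc psi_ge0 pBc (h K) (h0 K).
  apply: filterS => w /(_ (ys K) (size (ys K)) erefl) hw; rewrite add0r mul1r.
  rewrite indicE; have [Aw|nA] := pselect (bad K w).
    rewrite mem_set//; have /andP[a0 a1] := pow_bound (D w) xs01.
    have /andP[b0 b1] := @run_bound R q 1 _ _ (pattern Bc (h K)) (ys K) 0 [::] w (@ys01 K).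
    by rewrite [X in _ <= X](_ : _ = 1)// ler_norml; lra.
  rewrite memNset//; have [|-> _] := hw; first by move=> c cn hc; apply: nA; exists c.
  rewrite prod_flatten_pow (_ : block_incrs _ _ _ = D w) ?subrr ?normr0//.
  apply/eq_in_map => j _; set f := fun c => thinned Bc (c%:R * h K) w.
  have hf : {homo f : i j / (i <= j)%N}.
    move=> i k ik; apply: (counting_thinned cBc w).1; first by rewrite mulr_ge0// ltW.
    by rewrite ler_wpM2r ?ler_nat// ltW.
  rewrite /block_incr !(sum_block_incr _ hf) !muln1.
  have E1 k : thinned Bc (k%:R * delta) w = f (k * K.+1)%N.
    by rewrite /f natrM /h -mulrA [_ * (delta / _)]mulrC divfK// pnatr_eq0.
  by rewrite !E1 subnBA ?hf// addnC subnKC// hf.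
have lim := @cvg_draw_blocks R q q_ge2 th xs th0 (fun x hx => conj (proj1 (andP (xs01 x hx))) (xsP x hx).2) None.
(* The left-hand side does not depend on [K]: the limit of [close] is an equality. *)
apply/eqP; rewrite -subr_eq0 -normr_eq0 eq_le normr_ge0 andbT.
apply: (@cvg_le R _ _ _ _ close _ Prbad).
by apply: cvg_norm; apply: cvgB; [exact: cvg_cst|exact: lim].
Qed.

End ThinnedGF.

(** * The limit process *)

Lemma big_iota_ord (V : Type) (idx : V) (op : V -> V -> V) n (F : nat -> V) :
  \big[op/idx]_(j <- iota 0 n) F j = \big[op/idx]_(j < n) F j.
Proof. by rewrite -(big_mkord xpredT) /index_iota subn0. Qed.

Section LinearRate.
Context {R : realType}.

Lemma Rintegral_itv_linear (a b s t : R) : s <= t ->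
  \int[lebesgue_measure]_(u in `]s, t]) (a * u * b) = a * b * (t ^+ 2 - s ^+ 2) / 2%:R.
Proof.
rewrite le_eqVlt => /orP[/eqP <-|st].
  by rewrite set_itvoc0 Rintegral_set0 subrr mulr0 mul0r.
have cf : continuous (fun u : R => a * u * b).
  by move=> u; apply: cvgMr_tmp; apply: cvgMl_tmp; exact: cvg_id.
have ci : {within `[s, t], continuous (fun u : R => a * u * b)} by exact: continuous_subspaceT.
rewrite Rintegral_itv_obnd_cbnd; last first.
  have ic := continuous_compact_integrable (@segment_compact R s t) ci.
  by apply: integrableS ic => //; exact: subset_itv_oc_cc.
pose F (u : R) : R := a * b / 2%:R * u ^+ 2.
have dF (u : R) : is_derive u 1 F (a * u * b).
  rewrite /F; apply: is_derive_eq; rewrite /GRing.scale /=.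
  by field.
have cF : continuous F.
  by move=> u; apply: differentiable_continuous; apply/derivable1_diffP; have [] := dF u.
rewrite /Rintegral (continuous_FTC2 st ci (F := F)).
- by rewrite /F /=; field.
- split; first by move=> u _; have [] := dF u.
    by apply: cvg_at_right_filter; exact: cF.
  by apply: cvg_at_left_filter; exact: cF.
- by move=> u _; rewrite derive1E; apply: derive_val.
Qed.

End LinearRate.

Section PoissonGF.
Context {d : measure_display} {T : measurableType d} {R : realType} (P : probability T R).

Lemma Ex_poisson_gf (V : T -> nat) (mu x : R) : discrete_rv V -> 0 <= x <= 1 ->
  (forall n, fine (P (V @^-1` [set n])) = mu ^+ n / n`!%:R * expR (- mu)) ->
  \int[P]_w x ^+ V w = expR (- (mu * (1 - x))).
Proof.
move=> dV /andP[x0 x1] lawV.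
pose h n w : R := \sum_(k < n) x ^+ k * \1_(V @^-1` [set (k : nat)]) w.
have hE n w : h n w = if (V w < n)%N then x ^+ V w else 0.
  rewrite /h; case: ifP => Vn.
    rewrite (bigD1 (Ordinal Vn))//= indicE mem_set// mulr1 big1 ?addr0// => k kV.
    rewrite indicE memNset ?mulr0// => /= e; move: kV; rewrite -val_eqE /= e.
    by rewrite eqxx.
  rewrite big1// => k _; rewrite indicE memNset ?mulr0// => /= e.
  by rewrite e ltn_ord in Vn.
have xb k : 0 <= x ^+ k <= 1 by rewrite exprn_ge0// exprn_ile1.
have bV : measurable_fun setT (fun w => x ^+ V w).
  exact: (@measurable_discrete _ _ _ _ V (fun k => x ^+ k) dV).
have bh n : bmf (h n).
  by apply: bmf_sum => k; apply: bmfM; [exact: bmf_cst|exact: bmf_indic].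
have c1 : (fun n => \int[P]_w h n w) @ \oo --> \int[P]_w x ^+ V w.
  apply: (@Ex_cvg _ _ _ P h _ 1) => //; first by move=> n; have [] := bh n.
    by move=> n w; rewrite hE; case: ifP; rewrite ?normr0// => _; have /andP[a b] := xb (V w); rewrite ger0_norm.
  apply: aeW => w; apply: dist_cvgn => e e0; exists (V w).+1 => n Vn.
  by rewrite hE Vn subrr normr0.
have c2 : (fun n => \int[P]_w h n w) @ \oo --> expR (- mu) * expR (mu * x).
  apply: (@cvgn_ext _ (fun n => expR (- mu) * series (fun k => (mu * x) ^+ k / k`!%:R) n)).
    move=> n; rewrite /h Ex_sum; last by move=> k; apply: bmfM; [exact: bmf_cst|exact: bmf_indic].
    rewrite seriesE mulr_sumr; apply: eq_bigr => k _.
    rewrite ExZ ?Ex_indic ?lawV//; last exact: bmf_indic.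
    by rewrite exprMn; ring.
  by apply: cvgMl_tmp; exact: cvg_series_exp.
rewrite (cvg_unique _ c1 c2)// -expRD; congr expR; ring.
Qed.

End PoissonGF.

Section PowSums.
Context {R : realType}.

Lemma pow_block_incrsE (xs : seq R) M w : pow xs (block_incrs M w (size xs)) =
  \prod_(j <- iota 0 (size xs)) nth 0 xs j ^+ block_incr M w j.
Proof.
rewrite /pow /block_incrs -{1}(mkseq_nth 0 xs) /mkseq zip_map.
by rewrite big_map.
Qed.

Lemma block_incr_sum_seq (O : Type) (s : seq O) (F : O -> nat -> nat) w j :
  (forall o, {homo F o : a b / (a <= b)%N}) ->
  block_incr (fun c => \sum_(o <- s) F o c)%N w j = (\sum_(o <- s) block_incr (F o) w j)%N.
Proof.
move=> hF; rewrite /block_incr; elim: s => [|o s IH]; first by rewrite !big_nil.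
rewrite !big_cons -IH.
have h1 : (F o (j * w) <= F o (j.+1 * w))%N by apply: hF; rewrite leq_mul2r leqnSn orbT.
have h2 : (\sum_(o <- s) F o (j * w) <= \sum_(o <- s) F o (j.+1 * w))%N.
  by apply: leq_sum => o' _; apply: hF; rewrite leq_mul2r leqnSn orbT.
move: h1 h2; lia.
Qed.

Lemma pow_sum (O : Type) (s : seq O) (F : O -> nat -> nat) (xs : seq R) w :
  (forall o, {homo F o : a b / (a <= b)%N}) ->
  pow xs (block_incrs (fun c => \sum_(o <- s) F o c)%N w (size xs)) =
  \prod_(o <- s) pow xs (block_incrs (F o) w (size xs)).
Proof.
move=> hF; rewrite pow_block_incrsE.
rewrite [RHS](eq_bigr (fun o => \prod_(j <- iota 0 (size xs)) nth 0 xs j ^+ block_incr (F o) w j)); last first.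
  by move=> o _; rewrite pow_block_incrsE.
rewrite exchange_big; apply: eq_bigr => j _.
by rewrite block_incr_sum_seq// expr_sum.
Qed.

End PowSums.

Section LimitProcess.
Context {d : measure_display} {T : measurableType d} {R : realType} {q : nat}.
Hypothesis q_ge2 : (2 <= q)%N.
Variables (P : probability T R) (psi : nat -> R).
Variables (B : R -> T -> nat) (Bs : nat -> 'I_q -> R -> T -> nat).
Hypothesis limit : limit_model P psi B Bs.
Hypothesis psi_ge0 : forall i, 0 <= psi i.
Hypothesis cvg_psi : series (fun i => psi i ^+ 2) @ \oo --> limn (series (fun i => psi i ^+ 2)).
Hypothesis psi_lim1 : limn (series (fun i => psi i ^+ 2)) <= 1.

Local Notation rho := (1 - limn (series (fun i => psi i ^+ 2))).

Definition component (o : option nat) : R -> T -> nat :=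
  if o is Some i then thinned (Bs i) else B.

Definition components (I : nat) : seq (option nat) := None :: [seq Some i | i <- iota 0 I].

Definition partial_process (I : nat) (t : R) (w : T) : nat :=
  (\sum_(o <- components I) component o t w)%N.

Lemma counting_colour i a : counting_process (Bs i a).
Proof. exact: pp_counting (lm_colour limit i a). Qed.

Lemma counting_component o w : counting_fun (component o ^~ w).
Proof.
case: o => [i|]; first by apply: counting_thinned => a; exact: counting_colour.
by apply: counting_process_fun; exact: pp_counting (lm_star limit).
Qed.

Lemma discrete_component o t : 0 <= t -> discrete_rv (component o t).
Proof.
move=> t0; case: o => [i|] /=.
  by apply: discrete_thinned => // a; exact: counting_colour.
by move=> v; apply: (cp_measurable (pp_counting (lm_star limit))).
Qed.

Lemma component_grid (delta : R) o w : 0 < delta ->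
  {homo (fun c : nat => component o (c%:R * delta) w) : a b / (a <= b)%N}.
Proof.
move=> d0 a b ab; apply: (counting_component o w).1; first by rewrite mulr_ge0// ltW.
by rewrite ler_wpM2r ?ler_nat// ltW.
Qed.

Lemma uniq_components I : uniq (components I).
Proof.
rewrite /= map_inj_uniq ?iota_uniq ?andbT; last by move=> i j [].
by apply/mapP => -[].
Qed.

Lemma star_increment_mean (s t : R) : s <= t ->
  \int[lebesgue_measure]_(u in `]s, t]) (rho * u * (1 - q%:R^-1)) =
  rho * (1 - q%:R^-1) * (t ^+ 2 - s ^+ 2) / 2%:R.
Proof. exact: Rintegral_itv_linear. Qed.

Lemma star_mean_ge0 (s t : R) : 0 <= s -> s <= t ->
  0 <= rho * (1 - q%:R^-1) * (t ^+ 2 - s ^+ 2) / 2%:R.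
Proof.
move=> s0 st; rewrite !mulr_ge0 ?subr_ge0//.
  by rewrite ltW//; exact: qi_lt1.
by rewrite lerXn2r// nnegrE; exact: le_trans st.
Qed.

Lemma star_increment_law (s t : R) n : 0 <= s -> s <= t ->
  let mu := rho * (1 - q%:R^-1) * (t ^+ 2 - s ^+ 2) / 2%:R in
  fine (P (increment B s t @^-1` [set n])) = mu ^+ n / n`!%:R * expR (- mu).
Proof.
move=> s0 st mu; rewrite (poisson_increment_law _ (lm_star limit))//.
  by rewrite star_increment_mean.
by rewrite star_increment_mean// star_mean_ge0.
Qed.

(** The mean of B* on block [j] is proportional to [(2j + 1) / 2], the weight of this block in
    [gf_kappaE]. *)
Lemma star_gf (delta : R) (xs : seq R) : 0 < delta -> (forall x, x \in xs -> 0 <= x <= 1) ->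
  \int[P]_w pow xs (block_incrs (fun c => B (c%:R * delta) w) 1 (size xs)) =
  expR (- (gf_kappa q xs * (delta ^+ 2 * rho))).
Proof.
move=> d0 xs01.
have x01 j : 0 <= nth 0 xs j <= 1.
  by have [jx|jx] := ltnP j (size xs); [apply: xs01; exact: mem_nth|rewrite nth_default// lexx ler01].
have g0 : 0 <= 0%:R * delta by rewrite mul0r.
have gm : {homo (fun c : nat => c%:R * delta) : i j / (i <= j)%N >-> i <= j}.
  by move=> i j ij; rewrite ler_wpM2r ?ler_nat// ltW.
pose V j := increment B (j%:R * delta) (j.+1%:R * delta).
have cB := pp_counting (lm_star limit).
have dV j : discrete_rv (V j) by apply: discrete_increment => //; rewrite mulr_ge0// ltW.
under eq_Rintegral do rewrite pow_block_incrsE.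
rewrite (_ : \int[P]_w _ = \int[P]_w \prod_(j <- iota 0 (size xs)) (nth 0 xs j ^+ V j w)); last first.
  by apply: eq_Rintegral => w _; apply: eq_bigr => j _; rewrite /block_incr !muln1.
rewrite (@Ex_prod_indep _ _ _ P _ _ _ V (fun j n => nth 0 xs j ^+ n) (pp_indep (lm_star limit) g0 gm))//.
- rewrite (eq_bigr (fun j => expR (- (rho * (1 - q%:R^-1) * ((j.+1%:R * delta) ^+ 2 - (j%:R * delta) ^+ 2) / 2%:R * (1 - nth 0 xs j))))).
    rewrite -expR_sum; congr expR; rewrite gf_kappaE !mulr_sumr sumrN mulr_suml; congr (- _).
    rewrite big_iota_ord; apply: eq_bigr => j _.
    have e : j.*2.+1%:R = j%:R * 2%:R + 1 :> R by rewrite -natr1 -muln2 natrM.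
    by rewrite e -[j.+1%:R]natr1; set qi := q%:R^-1; field.
  move=> j _; apply: Ex_poisson_gf => // n.
  by rewrite (@star_increment_law (j%:R * delta) (j.+1%:R * delta) n)// ?mulr_ge0 ?gm// ltW.
- by move=> j v; exists [set v].
- move=> j; exists 1 => v; have /andP[a b] := x01 j.
  by rewrite ger0_norm ?exprn_ge0// exprn_ile1.
- exact: iota_uniq.
Qed.

Lemma partial_process_gf I (delta : R) (xs : seq R) : 0 < delta ->
  (forall x, x \in xs -> 0 <= x <= 1 /\ x != q%:R^-1) ->
  \int[P]_w pow xs (block_incrs (fun c => partial_process I (c%:R * delta) w) 1 (size xs)) =
  expR (- (gf_kappa q xs * (delta ^+ 2 * rho))) * \prod_(i < I) blocks_gf q xs (psi i * delta).
Proof.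
move=> d0 xsP; have xs01 x : x \in xs -> 0 <= x <= 1 by move=> /xsP[].
(* Only the values at the ends of the blocks matter: each component enters through a list of natural
   numbers, to which [Ex_prod_indep] applies. *)
pose ts : seq R := [seq c%:R * delta | c <- iota 0 (size xs).+1].
have ts0 t : t \in ts -> 0 <= t by move=> /mapP[c _ ->]; rewrite mulr_ge0// ltW.
pose V o w := [seq component o t w | t <- ts].
pose g (o : option nat) v : R := pow xs (block_incrs (nth 0%N v) 1 (size xs)).
have gE o w : g o (V o w) = pow xs (block_incrs (fun c => component o (c%:R * delta) w) 1 (size xs)).
  rewrite /g; congr pow; apply/eq_in_map => j; rewrite mem_iota add0n /= => js.
  have E c : (c <= size xs)%N -> nth 0%N (V o w) c = component o (c%:R * delta) w.
    move=> cs; rewrite (nth_map 0) ?size_map ?size_iota// (nth_map 0%N) ?size_iota//.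
    by rewrite nth_iota.
  by rewrite /block_incr !muln1 !E// ltnW.
rewrite (_ : \int[P]_w _ = \int[P]_w \prod_(o <- components I) g o (V o w)); last first.
  apply: eq_Rintegral => w _; rewrite /partial_process (@pow_sum _ _ _ (fun o c => component o (c%:R * delta) w)).
    by apply: eq_bigr => o _; rewrite gE.
  by move=> o; exact: component_grid.
rewrite (@Ex_prod_indep _ _ _ P _ _ _ V g (lm_indep limit))//.
- rewrite /components big_cons big_map; congr (_ * _).
    by rewrite -star_gf//; apply: eq_Rintegral => w _; rewrite gE.
  rewrite big_iota_ord; apply: eq_bigr => i _.
  rewrite -(thinned_gf q_ge2 (psi_ge0 i) (lm_colour limit i) (@lm_colour_indep _ _ _ _ _ _ _ _ limit i) d0 xsP).
  by apply: eq_Rintegral => w _; rewrite gE.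
- by move=> o v; exact: (sigma_process_seq id v ts0).
- move=> o v; apply: (discrete_comp id).
  have H : discrete_rv ((fun w => [seq component o `|t| w | t <- ts])).
    by apply: discrete_map => t; exact: discrete_component.
  suff -> : (fun w => [seq component o t w | t <- ts]) = (fun w => [seq component o `|t| w | t <- ts]) by [].
  by apply/funext => w; apply/eq_in_map => t tt; rewrite ger0_norm//; exact: ts0.
- move=> o; exists 1 => v; have /andP[a b] := pow_bound (block_incrs (nth 0%N v) 1 (size xs)) xs01.
  by rewrite ger0_norm.
- exact: uniq_components.
Qed.

End LimitProcess.

(** * Finiteness on bounded intervals and unboundedness of the limit process *)

Section BorelCantelli.
Context {d : measure_display} {T : measurableType d} {R : realType} (P : probability T R).

Lemma borel_cantelli (A : nat -> set T) (a : nat -> R) (l : R) : (forall i, measurable (A i)) ->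
  (forall i, fine (P (A i)) <= a i) -> (forall i, 0 <= a i) ->
  (fun n => \sum_(i < n) a i) @ \oo --> l ->
  {ae P, forall w, exists m, forall i, (m <= i)%N -> ~ A i w}.
Proof.
move=> mA Aa a0 al.
have H : P (lim_sup_set A) = 0%E.
  apply: lim_sup_set_cvg0 => //; apply: (@le_lt_trans _ _ l%:E); last exact: ltry.
  apply: lime_le; first by apply: is_cvg_nneseries.
  apply: nearW => n; rewrite (eq_bigr (fun i => (fine (P (A i)))%:E)); last by move=> i _; rewrite -PrE.
  rewrite sumEFin lee_fin big_mkord.
  apply: le_trans (cvg_series_ge n a0 al); exact: ler_sum.
have mL : measurable (lim_sup_set A).
  by apply: bigcapT_measurable => n; apply: bigcup_measurable => *; exact: mA.
have := @Pr0_ae _ _ _ P _ mL; rewrite H => /(_ erefl).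
apply: filterS => w nw; apply: contrapT => /forallNP h; apply: nw => n _ /=.
have /existsNP[i /not_implyP[ni /contrapT Ai]] := h n.
by exists i.
Qed.

End BorelCantelli.

(* 0 if the sequence is not eventually constant. *)
Definition eventual (v : nat -> nat) : nat :=
  xget 0%N [set k | exists m, forall n, (m <= n)%N -> v n = k].

Lemma eventualE v k m : (forall n, (m <= n)%N -> v n = k) -> eventual v = k.
Proof.
move=> h; have : [set k | exists m, forall n, (m <= n)%N -> v n = k] k by exists m.
move=> /xgetI - /(_ 0%N)[m' h'].
rewrite /eventual; have := h' (maxn m m') (leq_maxr _ _).
by rewrite h ?leq_maxl.
Qed.

Section DiscreteVariables.
Context {d : measure_display} {T : measurableType d} {R : realType}.

Lemma discrete_eventual (V : nat -> T -> nat) : (forall n, discrete_rv (V n)) ->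
  discrete_rv (fun w => eventual (V ^~ w)).
Proof.
move=> dV v.
pose E k := \bigcup_(m : nat) \bigcap_(n in [set n | (m <= n)%N]) V n @^-1` [set k].
have mE k : measurable (E k).
  by apply: bigcupT_measurable => m; apply: bigcap_measurableType => n _; exact: dV.
have EP k w : E k w <-> exists m, forall n, (m <= n)%N -> V n w = k.
  by split => [[m _ h]|[m h]]; exists m.
have Eev k w : E k w -> eventual (V ^~ w) = k by move=> /EP[m h]; exact: eventualE h.
rewrite (_ : _ @^-1` _ = E v `|` ((~` \bigcup_k E k) `&` [set _ | v = 0%N])).
  apply: measurableU => //; apply: measurableI; first by apply: measurableC; exact: bigcupT_measurable.
  have [->|v0] := pselect (v = 0%N); first by rewrite (_ : [set _ | _] = setT)//; apply/seteqP; split.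
  by rewrite (_ : [set _ | _] = set0)//; apply/seteqP; split => // w /v0.
apply/seteqP; split => w /=.
  move=> ev; have [[k _ Ek]|nE] := pselect ((\bigcup_k E k) w).
    by left; rewrite -ev (Eev _ _ Ek).
  right; split => //; rewrite -ev /eventual xgetPN// => k /EP Ek.
  by apply: nE; exists k.
case=> [/Eev//|[nE ->]]; rewrite /eventual xgetPN// => k /EP Ek.
by apply: nE; exists k.
Qed.

Lemma discrete_sub (V V' : T -> nat) : discrete_rv V -> discrete_rv V' ->
  discrete_rv (fun w => V w - V' w)%N.
Proof. by move=> dV dV'; exact: (discrete_comp (fun z => (z.1 - z.2)%N) (discrete_pair dV dV')). Qed.

Lemma discrete_grid_incr (F : R -> T -> nat) (delta : R) j : 0 < delta ->
  (forall t, 0 <= t -> discrete_rv (F t)) ->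
  discrete_rv (fun w => block_incr (fun c => F (c%:R * delta) w) 1 j).
Proof.
by move=> d0 dF; apply: discrete_sub; apply: dF; rewrite mulr_ge0// ltW.
Qed.

Lemma discrete_grid_incrs (F : R -> T -> nat) (delta : R) J : 0 < delta ->
  (forall t, 0 <= t -> discrete_rv (F t)) ->
  discrete_rv (fun w => block_incrs (fun c => F (c%:R * delta) w) 1 J).
Proof.
by move=> d0 dF; apply: discrete_block_incrs => c; apply: dF; rewrite mulr_ge0// ltW.
Qed.

Lemma measurable_grid_incr (F : R -> T -> nat) (delta : R) j n : 0 < delta ->
  (forall t, 0 <= t -> discrete_rv (F t)) ->
  measurable [set w : T | (n <= block_incr (fun c : nat => F (c%:R * delta)%R w) 1 j)%N].
Proof.
move=> d0 dF; exact: (discrete_preimage [set k | (n <= k)%N] (@discrete_grid_incr F delta j d0 dF)).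
Qed.

End DiscreteVariables.

(** Markov's inequality: the indicator of [V n < k] is at most [x^(-k) * x ^+ V n]. *)
Lemma unbounded_ae {d : measure_display} {T : measurableType d} {R : realType} (P : probability T R)
    (V : nat -> T -> nat) (x : R) : (forall n, discrete_rv (V n)) -> 0 < x <= 1 ->
  (fun n => \int[P]_w x ^+ V n w) @ \oo --> (0 : R) ->
  {ae P, forall w, forall k, exists n, (k <= V n w)%N}.
Proof.
move=> dV /andP[x0 x1] cI; apply/ae_foralln => k.
pose A n := [set w | ~ (k <= V n w)%N].
have mA n : measurable (A n) by exact: (discrete_preimage [set j | ~ (k <= j)%N] (dV n)).
have mI : measurable (\bigcap_n A n) by exact: bigcapT_measurable.
have := @Pr0_ae _ _ _ P _ mI.
have -> : fine (P (\bigcap_n A n)) = 0.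
  apply/eqP; rewrite eq_le Pr_ge0 andbT.
  have c0 : (fun n : nat => (x ^+ k)^-1 * \int[P]_w x ^+ V n w) @ \oo --> (0 : R).
    by rewrite -[X in _ --> X](mulr0 (x ^+ k)^-1); exact: cvgMl_tmp.
  apply: (@cvg_le R _ _ _ _ _ (@cvgn_cst R _) c0) => n.
  apply: (@le_trans _ _ (fine (P (A n)))); first by apply: Pr_le => // w; apply.
  have bx : bmf (fun w => x ^+ V n w).
    apply: (bmf_discrete (g := fun j => x ^+ j)); first exact: dV.
    by exists 1 => v; rewrite ger0_norm ?exprn_ge0 ?exprn_ile1// ltW.
  rewrite -ExZ// -Ex_indic//; apply: Ex_le.
  - exact: bmf_indic.
  - by apply: bmfM => //; exact: bmf_cst.
  move=> w; rewrite indicE; have [Aw|nA] := pselect (A n w); last first.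
    by rewrite memNset// mulr_ge0 ?invr_ge0 ?exprn_ge0 ?(ltW x0).
  rewrite mem_set// mulrC ler_pdivlMr ?exprn_gt0// mul1r.
  by apply: ler_wiXn2l => //; [exact: ltW|rewrite ltnW// ltnNge; apply/negP].
move=> /(_ erefl); apply: filterS => w nA; apply: contrapT => /forallNP h; apply: nA => n _; exact: h.
Qed.

Lemma cvg_exp_linear {R : realType} (a : R) : a < 0 -> (fun n => expR (a * n.+1%:R)) @ \oo --> (0 : R).
Proof.
move=> a0; apply: (squeeze_cvgr (f := fun=> 0) (h := fun n => (- a)^-1 * (n.+1%:R)^-1)); last first.
- by rewrite -[X in _ --> X](mulr0 (- a)^-1); apply: cvgMl_tmp; exact: cvg_natS_inv.
- exact: cvg_cst.
apply: nearW => n; rewrite expR_ge0/= -invfM -[a * _]opprK expRN lef_pV2 ?posrE ?expR_gt0//; last first.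
  by rewrite mulr_gt0 ?oppr_gt0.
by rewrite mulNr; apply: le_trans (expR_ge1Dx _); lra.
Qed.

Section LimitCount.
Context {d : measure_display} {T : measurableType d} {R : realType} {q : nat}.
Hypothesis q_ge2 : (2 <= q)%N.
Variables (P : probability T R) (psi : nat -> R).
Variables (B : R -> T -> nat) (Bs : nat -> 'I_q -> R -> T -> nat).
Hypothesis limit : limit_model P psi B Bs.
Hypothesis psi_ge0 : forall i, 0 <= psi i.
Hypothesis cvg_psi : series (fun i => psi i ^+ 2) @ \oo --> limn (series (fun i => psi i ^+ 2)).
Hypothesis psi_lim1 : limn (series (fun i => psi i ^+ 2)) <= 1.

Local Notation rho := (1 - limn (series (fun i => psi i ^+ 2))).
Local Notation component := (component B Bs).
Local Notation partial := (partial_process B Bs).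

(** A version of [collision_process] with values in [nat]: almost surely the partial sums over the
    components are eventually constant. *)
Definition count_process (t : R) (w : T) : nat := eventual (fun I => partial I t w).

Definition regular_limit (w : T) : Prop := (forall o, component o 0 w = 0%N) /\
  forall k : nat, exists m, forall i, (m <= i)%N -> component (Some i) k.+1%:R w = 0%N.

Lemma cell_pos_le i (h : R) j : 0 < h ->
  fine (P [set w | (0 < block_incr (fun c => thinned (Bs i) (c%:R * h) w) 1 j)%N]) <=
  (2 * j.+1)%:R * (psi i * h) ^+ 2.
Proof.
move=> h0; have [le1|gt1] := leP (psi i * h) 1.
  exact: (thinned_cell_le q_ge2 (psi_ge0 i) (lm_colour limit i) (@lm_colour_indep _ _ _ _ _ _ _ _ limit i) h0).
(* When [psi i * h > 1] the bound exceeds 1. *)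
apply: le_trans (_ : 1 <= _).
  by apply: Pr_le1; apply: measurable_grid_incr => // t; exact: (@discrete_component _ _ _ _ _ _ _ _ limit (Some i)).
have : 1 <= (psi i * h) ^+ 2 by rewrite expr_ge1// ltW// (lt_trans ltr01 gt1).
have : 1 <= (2 * j.+1)%:R :> R by rewrite ler1n.
by move=> a b; rewrite -[X in X <= _]mulr1; apply: ler_pM.
Qed.

Lemma component0_ae : {ae P, forall w, forall o, component o 0 w = 0%N}.
Proof.
have Hi : {ae P, forall w, forall i, component (Some i) 0 w = 0%N}.
  apply/ae_foralln => i; have := regular_ae q_ge2 (psi_ge0 i) (lm_colour limit i).
  apply: filterS => w [b0 _]; rewrite /= /thinned /drop_points /superpose big1//.
apply: filterS2 (pp_start (lm_star limit)) Hi => w b0 hi [i|]; [exact: hi|exact: b0].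
Qed.

(** Each interval [0, k + 1] is taken as a single cell: component [i] has a point there with
    probability at most [2 (psi i (k + 1))^2], which is summable in [i]. *)
Lemma regular_limit_ae : {ae P, forall w, regular_limit w}.
Proof.
apply: filterS2 component0_ae (_ : {ae P, forall w, forall k : nat, exists m, forall i, (m <= i)%N ->
    ~ (0 < block_incr (fun c => thinned (Bs i) (c%:R * k.+1%:R) w) 1 0)%N}) => [w w0 hk|].
  split => // k; have [m hm] := hk k; exists m => i mi.
  have /negP := hm i mi; rewrite -leqNgt leqn0 /block_incr !muln1 mul1r mul0r => /eqP.
  by have := w0 (Some i); rewrite /= => ->; rewrite subn0.
apply/ae_foralln => k.
apply: (@borel_cantelli _ _ _ P _ (fun i => (2 * 1)%:R * (psi i * k.+1%:R) ^+ 2) ((2 * 1)%:R * k.+1%:R ^+ 2 * limn (series (fun i => psi i ^+ 2)))).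
- by move=> i; apply: measurable_grid_incr => // t; exact: (@discrete_component _ _ _ _ _ _ _ _ limit (Some i)).
- by move=> i; apply: cell_pos_le.
- by move=> i; rewrite mulr_ge0 ?sqr_ge0.
apply: (@cvgn_ext _ (fun n => (2 * 1)%:R * k.+1%:R ^+ 2 * series (fun i => psi i ^+ 2) n)).
  by move=> n; rewrite seriesE mulr_sumr; apply: eq_bigr => i _; rewrite exprMn; ring.
exact: cvgMl_tmp.
Qed.

Lemma partialE I t w : partial I t w = (B t w + \sum_(i < I) thinned (Bs i) t w)%N.
Proof. by rewrite /partial_process /components big_cons big_map big_iota_ord. Qed.

Lemma counting_partial I w : counting_fun (partial I ^~ w).
Proof.
rewrite (_ : partial I ^~ w = fun t => (component None t w + \sum_(i < I) component (Some (i : nat)) t w)%N).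
  apply: counting_funD; first exact: (counting_component limit None).
  by apply: (counting_fun_sum (F := fun (i : 'I_I) t => component (Some (i : nat)) t w)) => i; exact: (counting_component limit (Some (i : nat))).
by apply/funext => t; rewrite partialE.
Qed.

Lemma discrete_partial I t : 0 <= t -> discrete_rv (partial I t).
Proof.
move=> t0.
have H : discrete_rv (fun w => [seq component o t w | o <- components I]).
  by apply: discrete_map => o; exact: (discrete_component limit).
rewrite (_ : partial I t = (fun s => \sum_(k <- s) k)%N \o (fun w => [seq component o t w | o <- components I])).
  exact: discrete_comp.
by apply/funext => w; rewrite /partial_process -(big_map _ xpredT id).
Qed.

Lemma discrete_count t : 0 <= t -> discrete_rv (count_process t).
Proof. by move=> t0; apply: discrete_eventual => I; exact: discrete_partial. Qed.

Lemma component_eventually0 w k : regular_limit w -> exists I0, forall i t, (I0 <= i)%N -> 0 <= t ->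
  t <= k.+1%:R -> thinned (Bs i) t w = 0%N.
Proof.
move=> [_ /(_ k)[m hm]]; exists m => i t mi t0 tk; apply/eqP; rewrite -leqn0 -[X in (_ <= X)%N](hm i mi).
exact: (counting_component limit (Some i) w).1.
Qed.

Lemma count_partial w k : regular_limit w -> exists I0, forall I t, (I0 <= I)%N -> 0 <= t ->
  t <= k.+1%:R -> partial I t w = count_process t w.
Proof.
move=> reg; have [m hm] := component_eventually0 k reg; exists m => I t mI t0 tk.
apply/esym; apply: (@eventualE _ _ I) => I' II'; rewrite !partialE; congr (_ + _)%N.
rewrite -(subnKC II') big_split_ord /= [X in (_ + X)%N]big1 ?addn0// => i _.
by apply: hm => //; apply: leq_trans mI _; exact: leq_addr.
Qed.

Lemma le_natS (t : R) : exists k : nat, t < k.+1%:R.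
Proof. by exists (Num.truncn t); exact: truncnS_gt. Qed.

Lemma counting_count w : regular_limit w -> counting_fun (count_process ^~ w).
Proof.
move=> reg; split => [s t s0 st|t t0].
  have [k tk] := le_natS t; have [I hI] := count_partial k reg.
  rewrite -(hI I s)//; last exact: le_trans st (ltW tk).
  by rewrite -(hI I t)// ?(ltW tk)// ?(le_trans s0)//; exact: (counting_partial I w).1.
have [k tk] := le_natS t; have [I hI] := count_partial k reg.
have h1 := (counting_partial I w).2 t t0.
have h2 : \forall s \near t^'+, s < k.+1%:R by exact: nbhs_right_lt.
have h3 : \forall s \near t^'+, t < s by exact: nbhs_right_gt.
near=> s; rewrite -!(hI I)// ?(ltW tk)//.
- by near: s.
- by apply: (le_trans t0); apply: ltW; near: s.
- by apply: ltW; near: s.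
Unshelve. all: by end_near. Qed.

Lemma collision_processE w t : regular_limit w -> 0 <= t ->
  collision_process B Bs t w = ((count_process t w)%:R : R)%:E.
Proof.
move=> reg t0; have [k tk] := le_natS t.
have [I0 h0] := component_eventually0 k reg; have [I1 h1] := count_partial k reg.
pose I := maxn I0 I1.
rewrite -(h1 I t) ?leq_maxr ?(ltW tk)// /collision_process partialE natrD EFinD; congr (_ + _)%E.
rewrite (nneseries_split 0 I)//= add0n [X in (_ + X)%E](_ : _ = 0%E) ?adde0.
  by rewrite big_mkord sumEFin natr_sum.
apply: eseries0 => i Ii _; rewrite h0 ?(ltW tk)//; apply: leq_trans Ii; exact: leq_maxl.
Qed.

(** As for [two_colour_timeP], right-continuity makes the infimum a minimum. *)
Lemma arrival_timeP w t k : regular_limit w -> 0 <= t ->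
  (arrival_time (collision_process B Bs) k w <= t%:E)%E <-> (k <= count_process t w)%N.
Proof.
move=> reg t0; split => [le|h]; last first.
  by apply: ereal_inf_lbound; exists t => //; split => //; rewrite collision_processE// lee_fin ler_nat.
have [mono rc] := counting_count reg.
have /at_rightP [e e0 he] := rc t t0.
have : (arrival_time (collision_process B Bs) k w < (t + e)%:E)%E by apply: le_lt_trans le _; rewrite lte_fin; lra.
move=> /ereal_inf_lt [_ [s [s0 hs] <-]]; rewrite lte_fin => st.
move: hs; rewrite collision_processE// lee_fin ler_nat => hs.
have [ts|st'] := ltP t s; first by rewrite -(he s).
by apply: leq_trans hs (mono _ _ _ _).
Qed.

Lemma arrival_time_ge0 w k : (0 <= arrival_time (collision_process B Bs) k w)%E.
Proof. by apply: le_ereal_inf_tmp => _ [t [t0 _] <-]; rewrite lee_fin. Qed.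

Lemma arrival_time_gt0 w k : regular_limit w -> (0 < arrival_time (collision_process B Bs) k.+1 w)%E.
Proof.
move=> reg; rewrite ltNge; apply/negP => /(arrival_timeP k.+1 reg (lexx 0)).
have [I hI] := count_partial 0 reg; rewrite -(hI I 0)// partialE.
have := reg.1 None; rewrite /= => ->; rewrite big1// => i _; exact: (reg.1 (Some (i : nat))).
Qed.

Lemma arrival_time_fin w k (n : R) : regular_limit w -> 0 <= n -> (k <= count_process n w)%N ->
  exists2 tau : R, 0 <= tau <= n & arrival_time (collision_process B Bs) k w = tau%:E.
Proof.
move=> reg n0 /(arrival_timeP k reg n0) le; have := arrival_time_ge0 w k.
case: (arrival_time _ _ _) le => [tau| |]// le ge; exists tau => //.
by rewrite !lee_fin in le ge; rewrite le ge.
Qed.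

Lemma count_process0 w : regular_limit w -> count_process 0 w = 0%N.
Proof.
move=> reg; apply/eqP; rewrite -leqn0 leqNgt; apply/negP => /(arrival_timeP 1 reg (lexx 0)).
by rewrite leNgt arrival_time_gt0.
Qed.

Lemma count_gf (delta : R) (xs : seq R) L' : 0 < delta ->
  (forall x, x \in xs -> 0 <= x <= 1 /\ x != q%:R^-1) ->
  (fun n => \prod_(i < n) blocks_gf q xs (delta * psi i)) @ \oo --> L' ->
  \int[P]_w pow xs (block_incrs (fun c => count_process (c%:R * delta) w) 1 (size xs)) =
  expR (- (gf_kappa q xs * (delta ^+ 2 - delta ^+ 2 * limn (series (fun i => psi i ^+ 2))))) * L'.
Proof.
move=> d0 xsP cL; have xs01 x : x \in xs -> 0 <= x <= 1 by move=> /xsP[].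
have xb v : `|pow xs v| <= 1 by have /andP[a b] := pow_bound v xs01; rewrite ger0_norm.
have mp (F : R -> T -> nat) : (forall t, 0 <= t -> discrete_rv (F t)) ->
    measurable_fun setT (fun w => pow xs (block_incrs (fun c => F (c%:R * delta) w) 1 (size xs))).
  by move=> dF; apply: (measurable_discrete (pow xs)); exact: discrete_grid_incrs.
have c1 : (fun I => \int[P]_w pow xs (block_incrs (fun c => partial I (c%:R * delta) w) 1 (size xs))) @ \oo -->
    \int[P]_w pow xs (block_incrs (fun c => count_process (c%:R * delta) w) 1 (size xs)).
  apply: (@Ex_cvg _ _ _ P _ _ 1) => //.
  - by move=> I; apply: mp => t t0; exact: discrete_partial.
  - by apply: mp => t t0; exact: discrete_count.
  apply: filterS regular_limit_ae => w reg.
  have [k hk] := le_natS ((size xs)%:R * delta).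
  have [I0 hI] := count_partial k reg.
  apply: dist_cvgn => e e0; exists I0 => I II0.
  rewrite (_ : block_incrs (fun c => partial I _ _) _ _ = block_incrs (fun c => count_process (c%:R * delta) w) 1 (size xs)) ?subrr ?normr0//.
  apply/eq_in_map => j; rewrite mem_iota add0n /= => js; rewrite /block_incr !muln1.
  have le c : (c <= size xs)%N -> c%:R * delta <= k.+1%:R.
    by move=> cs; apply: le_trans (ltW hk); rewrite ler_wpM2r ?ler_nat// ltW.
  by rewrite !hI ?le ?mulr_ge0 ?(ltW d0)// ltnW.
apply: (cvg_unique _ c1) => //.
apply: (@cvgn_ext _ (fun I => expR (- (gf_kappa q xs * (delta ^+ 2 - delta ^+ 2 * limn (series (fun i => psi i ^+ 2))))) *
   \prod_(i < I) blocks_gf q xs (delta * psi i))).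
  move=> I; rewrite (partial_process_gf q_ge2 limit psi_ge0 psi_lim1)//; congr (expR (- (_ * _)) * _); first ring.
  by apply: eq_bigr => i _; rewrite mulrC.
exact: cvgMl_tmp.
Qed.

Lemma blocks_gf_le1 xs th : (forall x, x \in xs -> 0 <= x <= 1 /\ x != q%:R^-1) -> 0 < th ->
  forall i, 0 <= blocks_gf q xs (psi i * th) <= 1.
Proof.
move=> xsP th0 i; have xs01 x : x \in xs -> 0 <= x <= 1 by move=> /xsP[].
rewrite -(thinned_gf q_ge2 (psi_ge0 i) (lm_colour limit i) (@lm_colour_indep _ _ _ _ _ _ _ _ limit i) th0 xsP).
set F := fun w => _.
have bF : bmf F.
  apply: (bmf_discrete (V := fun w => block_incrs (fun c => thinned (Bs i) (c%:R * th) w) 1 (size xs)) (g := pow xs)).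
    by apply: discrete_grid_incrs => // t t0; exact: (@discrete_component _ _ _ _ _ _ _ _ limit (Some i)).
  by exists 1 => v; have /andP[a b] := pow_bound v xs01; rewrite ger0_norm.
rewrite Ex_ge0 /=; last by move=> w; have /andP[] := pow_bound (block_incrs (fun c => thinned (Bs i) (c%:R * th) w) 1 (size xs)) xs01.
rewrite -[leRHS](Ex_cst P); apply: Ex_le => //; first exact: bmf_cst.
by move=> w; have /andP[] := pow_bound (block_incrs (fun c => thinned (Bs i) (c%:R * th) w) 1 (size xs)) xs01.
Qed.

(** If [rho > 0], B* alone suffices. If [rho = 0], the squares of the [psi i] sum to 1, so some
    [psi i0] is positive and component [i0] suffices: all its exponential rates are negative since
    the eigenvalues are below 1. *)
Lemma partial_gf_cvg0 (x : R) : 0 < x < 1 -> x != q%:R^-1 -> exists I,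
  (fun n : nat => \int[P]_w x ^+ (partial I n.+1%:R w - partial I 0 w)) @ \oo --> (0 : R).
Proof.
move=> /andP[x0 x1] xq.
have xsP (n : nat) y : y \in [:: x] -> 0 <= y <= 1 /\ y != q%:R^-1.
  by rewrite inE => /eqP ->; rewrite !ltW.
pose F I (n : nat) : R := expR (- (gf_kappa q [:: x] * (n.+1%:R ^+ 2 * rho))) * \prod_(i < I) blocks_gf q [:: x] (psi i * n.+1%:R).
suff [I cI] : exists I, F I @ \oo --> (0 : R).
  exists I; apply: cvgn_ext cI => n.
  rewrite /F -(partial_process_gf q_ge2 limit psi_ge0 psi_lim1 I (delta := n.+1%:R))//; last exact: xsP.
  by apply: eq_Rintegral => w _; rewrite /pow /block_incrs /= big_seq1 /block_incr !muln1 mul1r mul0r.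
have kap : 0 < gf_kappa q [:: x].
  rewrite /= add0r /gf_beta big_nil mulr0 add0r !mulr_gt0 ?invr_gt0 ?subr_gt0//.
  exact: (@qi_lt1 R q q_ge2).
have prod01 I n : 0 <= \prod_(i < I) blocks_gf q [:: x] (psi i * n.+1%:R) <= 1.
  apply/andP; split; first by apply: prodr_ge0 => i _; have /andP[] := blocks_gf_le1 (xsP n) (ltr0Sn R n) i.
  by apply: prodr_ile1 => i _; exact: (blocks_gf_le1 (xsP n) (ltr0Sn R n)).
have [rho0|rho0] := eqVneq rho 0; last first.
  have rho_gt0 : 0 < rho by rewrite lt_neqAle eq_sym rho0 subr_ge0.
  exists 0%N; rewrite /F; under eq_fun do rewrite big_ord0 mulr1.
  apply: (squeeze_cvgr (f := fun=> 0) (h := fun n => expR (- (gf_kappa q [:: x] * rho) * n.+1%:R))).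
  - apply: nearW => n; rewrite expR_ge0 ler_expR mulNr lerN2 -mulrA ler_wpM2l ?(ltW kap)//.
    by rewrite mulrC ler_wpM2r ?(ltW rho_gt0)// expr2 ler_peMr// ler1n.
  - exact: cvg_cst.
  - by apply: cvg_exp_linear; rewrite oppr_lt0 mulr_gt0.
have [i0 psi_gt0] : exists i, 0 < psi i.
  apply: contrapT => /forallNP h; have z i : psi i = 0.
    by apply/eqP; rewrite eq_le psi_ge0 andbT leNgt; apply/negP; exact: h.
  have e : series (fun i => psi i ^+ 2) = fun=> 0.
    by apply/funext => n; rewrite seriesE big1// => i _; rewrite z expr0n.
  move: rho0; rewrite e lim_cst// subr0 => /eqP; by rewrite oner_eq0.
exists i0.+1.
have cb : (fun n : nat => blocks_gf q [:: x] (psi i0 * n.+1%:R)) @ \oo --> (0 : R).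
  rewrite /blocks_gf /= /add_poisson.
  rewrite [X in _ --> X](_ : 0 = \sum_(e : urn_state) eigcoord q x (fun=> 1) e * 0 * eigvec q x e None); last first.
    by rewrite big1// => e _; rewrite mulr0 mul0r.
  apply: cvg_big => [|e _]; first exact: (@add_continuous).
  apply: cvgMr_tmp; apply: cvgMl_tmp.
  have -> : (fun n : nat => expR (psi i0 * n.+1%:R * (eigval q x e - 1))) =
      (fun n : nat => expR (psi i0 * (eigval q x e - 1) * n.+1%:R)) by apply/funext => n; congr expR; ring.
  apply: cvg_exp_linear; rewrite pmulr_rlt0// subr_lt0.
  by case: e => [[]|] //=; exact: (@qi_lt1 R q q_ge2).
apply: (squeeze_cvgr (f := fun=> 0) _ _ cb); last exact: cvg_cst.
apply: nearW => n; rewrite /F rho0 mulr0 mulr0 oppr0 expR0 mul1r.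
have /andP[-> _] /= := prod01 i0.+1 n.
rewrite big_ord_recr /=; have /andP[a b] := prod01 i0 n.
have /andP[c e] := blocks_gf_le1 (xsP n) (ltr0Sn R n) i0.
by rewrite ler_piMl.
Qed.

Lemma count_unbounded : {ae P, forall w, forall k, exists n : nat, (k <= count_process n%:R w)%N}.
Proof.
have q0 := @qi_gt0 R q q_ge2; have q1 := @qi_lt1 R q q_ge2.
(* Any value of ]0, 1[ other than 1/q would do. *)
pose x : R := q%:R^-1 / 2%:R.
have [I cI] : exists I, (fun n : nat => \int[P]_w x ^+ (partial I n.+1%:R w - partial I 0 w)) @ \oo --> (0 : R).
  apply: partial_gf_cvg0; first by rewrite /x; apply/andP; split; lra.
  by rewrite /x; apply/eqP; lra.
have x0 : 0 < x by rewrite /x; lra.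
have x1 : x <= 1 by rewrite /x; lra.
have H : {ae P, forall w, forall k, exists n : nat, (k <= partial I n.+1%:R w - partial I 0 w)%N}.
  apply: (@unbounded_ae _ _ _ P (fun n w => partial I n.+1%:R w - partial I 0 w)%N x) => //; last by rewrite x0.
  by move=> n; apply: discrete_sub; exact: discrete_partial.
apply: filterS2 regular_limit_ae H => w reg hw k.
have [n hn] := hw k; exists n.+1; have [I0 hI] := count_partial n reg.
rewrite -(hI (maxn I0 I) n.+1%:R) ?leq_maxl//.
apply: leq_trans hn (leq_trans (leq_subr _ _) _); rewrite !partialE leq_add2l.
rewrite -(subnKC (leq_maxr I0 I)) big_split_ord /=; exact: leq_addr.
Qed.

End LimitCount.

(** * Absence of multiple points *)

Lemma sum_ge2 (O : eqType) (s : seq O) (f : O -> nat) : uniq s -> (2 <= \sum_(o <- s) f o)%N ->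
  (exists2 o, o \in s & (2 <= f o)%N) \/
  exists o o', [/\ o \in s, o' \in s, o != o', (0 < f o)%N & (0 < f o')%N].
Proof.
elim: s => [_|o s IH /= /andP[os us]]; first by rewrite big_nil.
rewrite big_cons => h.
have [f2|f1] := leqP 2 (f o); first by left; exists o; rewrite ?mem_head.
have [s2|s1] := leqP 2 (\sum_(o <- s) f o).
  case: (IH us s2) => [[u o's fo']|[u [v [a b c e g]]]].
    by left; exists u; rewrite // inE o's orbT.
  by right; exists u, v; split => //; rewrite inE ?a ?b orbT.
right; have fo : (0 < f o)%N by lia.
have s0 : (0 < \sum_(o <- s) f o)%N by lia.
have /hasP[u o's fo'] : has (fun o => 0 < f o)%N s.
  apply: contraLR s0; rewrite -all_predC => /allP H; rewrite -leqNgt leqn0 big1_seq// => i /andP[_ /H].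
  by rewrite /= -leqNgt leqn0 => /eqP.
exists o, u; split => //; rewrite ?mem_head// ?inE ?o's ?orbT//.
by apply/eqP => e; rewrite e o's in os.
Qed.

Lemma indic_ge0 (T : Type) (R : realType) (A : set T) w : 0 <= \1_A w :> R.
Proof. by rewrite indicE. Qed.

Section Strict.
Context {d : measure_display} {T : measurableType d} {R : realType} {q : nat}.
Hypothesis q_ge2 : (2 <= q)%N.
Variables (P : probability T R) (psi : nat -> R).
Variables (B : R -> T -> nat) (Bs : nat -> 'I_q -> R -> T -> nat).
Hypothesis limit : limit_model P psi B Bs.
Hypothesis psi_ge0 : forall i, 0 <= psi i.
Hypothesis psi_le1 : forall i, psi i <= 1.
Hypothesis cvg_psi : series (fun i => psi i ^+ 2) @ \oo --> limn (series (fun i => psi i ^+ 2)).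
Hypothesis psi_lim1 : limn (series (fun i => psi i ^+ 2)) <= 1.

Local Notation rho := (1 - limn (series (fun i => psi i ^+ 2))).
Local Notation component := (component B Bs).
Local Notation partial := (partial_process B Bs).
Local Notation count := (count_process B Bs).
Local Notation Pr A := (fine (P A)).

Let lim_ge0 : 0 <= limn (series (fun i => psi i ^+ 2)).
Proof.
apply: (@cvg_le R _ _ _ _ _ (@cvgn_cst R 0) cvg_psi) => n.
by rewrite seriesE sumr_ge0// => i _; exact: sqr_ge0.
Qed.

Section Cells.
Variable h : R.
Hypothesis h_gt0 : 0 < h.

Definition cell (o : option nat) (c : nat) (w : T) : nat :=
  block_incr (fun c => component o (c%:R * h) w) 1 c.

Lemma measurable_cell o c n : measurable [set w | (n <= cell o c w)%N].
Proof. by apply: measurable_grid_incr => // t; exact: (discrete_component limit). Qed.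

Let mu (c : nat) : R := rho * (1 - q%:R^-1) * ((c.+1%:R * h) ^+ 2 - (c%:R * h) ^+ 2) / 2%:R.

Lemma star_cell_mean c : 0 <= mu c <= c.+1%:R * h ^+ 2.
Proof.
have q0 := @qi_gt0 R q q_ge2; have q1 := @qi_lt1 R q q_ge2.
have E : mu c = rho * (1 - q%:R^-1) * ((2%:R * c%:R + 1) / 2%:R * h ^+ 2).
  by rewrite /mu -natr1; set qi := q%:R^-1; field.
have c0 : 0 <= c%:R :> R by exact: ler0n.
have r1 : rho * (1 - q%:R^-1) <= 1.
  by apply: mulr_ile1; rewrite ?subr_ge0 ?(ltW q1)// lerBlDr lerDl// ltW.
have r0 : 0 <= rho * (1 - q%:R^-1) by rewrite mulr_ge0// subr_ge0// ltW.
have h2 : 0 <= h ^+ 2 by exact: sqr_ge0.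
have b0 : 0 <= (2%:R * c%:R + 1) / 2%:R * h ^+ 2 by rewrite mulr_ge0// divr_ge0//; lra.
rewrite E mulr_ge0//=; apply: le_trans (ler_wpM2r b0 r1) _.
by rewrite mul1r -[c.+1%:R]natr1 ler_wpM2r//; lra.
Qed.

Lemma star_cell_law c n : Pr (cell None c @^-1` [set n]) = mu c ^+ n / n`!%:R * expR (- mu c).
Proof.
have := @star_increment_law _ _ _ _ q_ge2 P psi B Bs limit psi_lim1 (c%:R * h) (c.+1%:R * h) n.
rewrite mulr_ge0 ?(ltW h_gt0)// ler_wpM2r ?ler_nat ?(ltW h_gt0)// => /(_ isT isT) <-.
by congr (fine (P _)); apply/seteqP; split => w; rewrite /= /cell /block_incr !muln1.
Qed.

Lemma discrete_cell o c : discrete_rv (cell o c).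
Proof. by apply: discrete_grid_incr => // t; exact: (discrete_component limit). Qed.

Lemma star_cell_pos c : Pr [set w | (1 <= cell None c w)%N] <= c.+1%:R * h ^+ 2.
Proof.
have /andP[m0 m1] := star_cell_mean c; apply: le_trans m1.
rewrite (_ : [set w | _] = ~` (cell None c @^-1` [set 0%N])); last first.
  by apply/seteqP; split => w /=; rewrite lt0n => /eqP.
rewrite PrC ?star_cell_law; last exact: discrete_cell.
by rewrite expr0 fact0 divr1 mul1r; have := expR_ge1Dx (- mu c); lra.
Qed.

Lemma star_cell_two c : Pr [set w | (2 <= cell None c w)%N] <= (c.+1%:R * h ^+ 2) ^+ 2.
Proof.
have /andP[m0 m1] := star_cell_mean c.
apply: (@le_trans _ _ (mu c ^+ 2)); last by rewrite lerXn2r ?nnegrE// (le_trans m0).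
have [le1|gt1] := leP (mu c) 1; last first.
  by apply: le_trans (Pr_le1 _ (measurable_cell _ _ _)) _; rewrite expr_ge1// ltW.
have dc := discrete_cell None c.
have -> : Pr [set w | (2 <= cell None c w)%N] =
    \int[P]_w (1 - (\1_(cell None c @^-1` [set 0%N]) w + \1_(cell None c @^-1` [set 1%N]) w)).
  rewrite -Ex_indic; last exact: measurable_cell.
  apply: eq_Rintegral => w _; rewrite !indicE.
  case E : (cell None c w) => [|[|n]].
  - rewrite memNset/=; last by rewrite E.
    by rewrite mem_set// memNset/= ?E// addr0 subrr.
  - rewrite memNset/=; last by rewrite E.
    by rewrite memNset/= ?E// mem_set// add0r subrr.
  rewrite mem_set/=; last by rewrite E.
  by rewrite memNset/= ?E// memNset/= ?E// addr0 subr0.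
have b0 := bmf_indic (dc 0%N); have b1 := bmf_indic (dc 1%N).
rewrite ExB; [|exact: bmf_cst|exact: bmfD].
rewrite Ex_cst ExD// !Ex_indic// !star_cell_law expr0 expr1 !fact0 !divr1 mul1r.
have := @exp_poisson_lower R (mu c) 1; rewrite m0 le1 => /(_ isT); rewrite expr1 mul1r mulrDr mulr1.
by rewrite [mu c * _]mulrC; lra.
Qed.

Variable n : nat.
Hypothesis h_le1 : h <= 1.

Lemma cell_pos o c : (c < n)%N -> Pr [set w | (1 <= cell o c w)%N] <= 2%:R * (n%:R * h ^+ 2).
Proof.
move=> cn; have h2 := sqr_ge0 h.
have cnR : c.+1%:R * h ^+ 2 <= n%:R * h ^+ 2 by rewrite ler_wpM2r// ler_nat.
case: o => [i|]; last first.
  apply: le_trans (star_cell_pos c) (le_trans cnR _).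
  by have := mulr_ge0 (ler0n R n) h2; lra.
apply: le_trans (cell_pos_le q_ge2 limit psi_ge0 i c h_gt0) _.
rewrite natrM exprMn -mulrA ler_wpM2l//; apply: le_trans cnR.
rewrite ler_wpM2l// -[X in _ <= X]mul1r ler_wpM2r// exprn_ile1//.
Qed.

Definition double_cell o : set T := [set w | exists2 c, (c < n)%N & (2 <= cell o c w)%N].

Lemma measurable_double_cell o : measurable (double_cell o).
Proof.
rewrite (_ : double_cell o = \bigcup_(c in [set c | (c < n)%N]) [set w | (2 <= cell o c w)%N]).
  by apply: bigcup_measurable => c _; exact: measurable_cell.
by apply/seteqP; split => w [c cn hc]; exists c.
Qed.

(** For a thinned process, two points in a cell force a failing cell, by [thinned_run]; for B* the
    cells are summed. *)
Lemma double_cell_le o : Pr (double_cell o) <= n%:R * h ^+ 2 + n%:R * (n%:R * h ^+ 2) ^+ 2.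
Proof.
have h2 := sqr_ge0 h; have n0 := mulr_ge0 (ler0n R n) h2.
case: o => [i|]; last first.
  apply: (@le_trans _ _ (\sum_(c < n) (n%:R * h ^+ 2) ^+ 2)); last first.
    by rewrite sumr_const card_ord -[X in X <= _]mulr_natl lerDr.
  rewrite -(Ex_indic P (measurable_double_cell None)).
  apply: (@le_trans _ _ (\int[P]_w \sum_(c < n) \1_[set w | (2 <= cell None c w)%N] w)).
    apply: Ex_le; first by apply: bmf_indic; exact: measurable_double_cell.
      by apply: bmf_sum => c; apply: bmf_indic; exact: measurable_cell.
    move=> w; rewrite indicE; have [[c cn hc]|nd] := pselect (double_cell None w).
      rewrite mem_set; last by exists c.
      rewrite (bigD1 (Ordinal cn))//= indicE mem_set// lerDl.
      by apply: sumr_ge0 => i _; exact: indic_ge0.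
    by rewrite memNset//; apply: sumr_ge0 => i _; exact: indic_ge0.
  rewrite Ex_sum; last by move=> c; apply: bmf_indic; exact: measurable_cell.
  apply: ler_sum => c _; rewrite Ex_indic; last exact: measurable_cell.
  apply: le_trans (star_cell_two c) _; rewrite lerXn2r ?nnegrE ?mulr_ge0 ?(ltW h_gt0)//.
  by rewrite ler_wpM2r// ler_nat.
have psi_h : psi i * h <= 1 by apply: mulr_ile1 => //; exact: ltW.
apply: (@le_trans _ _ (n%:R * h ^+ 2)); last by rewrite lerDl mulr_ge0// exprn_ge0.
apply: (@le_trans _ _ (Pr (bad_cell (Bs i) h n))); last first.
  apply: le_trans (bad_cell_le q_ge2 (psi_ge0 i) (lm_colour limit i) (@lm_colour_indep _ _ _ _ _ _ _ _ limit i) h_gt0 n psi_h) _.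
  rewrite ler_wpM2l// lerXn2r ?nnegrE ?mulr_ge0// ?(ltW h_gt0)//.
  by rewrite -[leRHS]mul1r ler_wpM2r// ltW.
have mb := measurable_bad_cell (lm_colour limit i) h_gt0 n.
rewrite -(Ex_indic P (measurable_double_cell _)) -(Ex_indic P mb).
apply: Ex_le_ae; [by apply: bmf_indic; exact: measurable_double_cell|exact: bmf_indic|].
have := thinned_run q_ge2 (psi_ge0 i) (lm_colour limit i) h_gt0.
apply: filterS => w hw; rewrite !indicE.
have [bw|nb] := pselect (bad_cell (Bs i) h n w); first by rewrite (mem_set bw); case: (_ \in double_cell _).
rewrite memNset// => -[c cn hc].
have [|x xn hx|_ /(_ c cn)] := hw (nseq n 1) n; first by rewrite size_nseq.
  by apply: nb; exists x.
by rewrite leqNgt; case/negP.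
Qed.

Definition common_cell o o' c : set T := [set w | (1 <= cell o c w)%N /\ (1 <= cell o' c w)%N].

Lemma measurable_common_cell o o' c : measurable (common_cell o o' c).
Proof. by apply: measurableI; exact: measurable_cell. Qed.

Lemma common_cell_le o o' c : (c < n)%N -> o != o' ->
  Pr (common_cell o o' c) <= (2%:R * (n%:R * h ^+ 2)) ^+ 2.
Proof.
move=> cn oo'.
pose A o := [set w | (1 <= cell o c w)%N].
have -> : common_cell o o' c = \bigcap_(i in [set` [:: o; o']]) A i.
  apply/seteqP; split => [w [a b] i|w H]; first by rewrite /= !inE => /orP[]/eqP->.
  by split; apply: H; rewrite /= !inE eqxx ?orbT.
rewrite (lm_indep limit); last 2 first.
- by rewrite /= inE oo'.
- move=> i _; rewrite (_ : A i = (fun w => (1 <= nth 0 [seq component i t w | t <- [:: (c%:R * h)%R; (c.+1%:R * h)%R]] 1 - nth 0 [seq component i t w | t <- [:: (c%:R * h)%R; (c.+1%:R * h)%R]] 0)%N) @^-1` [set true]).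
    apply: (@sigma_process_seq _ _ _ (component i) _ [:: (c%:R * h)%R; (c.+1%:R * h)%R] (fun s => (1 <= nth 0 s 1 - nth 0 s 0)%N) true).
    by move=> t; rewrite !inE => /orP[]/eqP->; rewrite mulr_ge0// ltW.
  by apply/seteqP; split => w; rewrite /A /= /cell /block_incr !muln1.
rewrite fine_prode; last by move=> i; apply: fin_num_measure; exact: measurable_cell.
rewrite big_cons big_seq1 expr2; apply: ler_pM; rewrite ?Pr_ge0//; exact: cell_pos.
Qed.

(** A random variable rather than an event: its expectation is a union bound, and it is at least 1
    as soon as a cell contains two points of the truncated process. *)
Definition clashes (I : nat) (w : T) : R :=
  \sum_(o <- components I) \1_(double_cell o) w +
  \sum_(o <- components I) \sum_(o' <- components I | o != o') \sum_(c < n) \1_(common_cell o o' c) w.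

Lemma bmf_clashes I : bmf (clashes I).
Proof.
apply: bmfD; first by apply: bmf_sum => o; apply: bmf_indic; exact: measurable_double_cell.
apply: bmf_sum => o; rewrite (_ : (fun w => _) = fun w => \sum_(o' <- [seq o' <- components I | o != o']) \sum_(c < n) \1_(common_cell o o' c) w).
  by apply: bmf_sum => o'; apply: bmf_sum => c; apply: bmf_indic; exact: measurable_common_cell.
by apply/funext => w; rewrite big_filter.
Qed.

(** When [n * h] is bounded, [n h^2] and [n (n h^2)^2] are both of order [h]. *)
Lemma Ex_clashes I : \int[P]_w clashes I w <=
  (I.+1%:R + I.+1%:R ^+ 2) * (n%:R * h ^+ 2 + 4%:R * n%:R * (n%:R * h ^+ 2) ^+ 2).
Proof.
set e := n%:R * h ^+ 2 + _; have h2 := sqr_ge0 h; have n0 := mulr_ge0 (ler0n R n) h2.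
have sq0 : 0 <= n%:R * (n%:R * h ^+ 2) ^+ 2 :> R by rewrite mulr_ge0// sqr_ge0.
have e0 : 0 <= e by rewrite /e -mulrA; lra.
have szc : size (components I) = I.+1 by rewrite /= size_map size_iota.
have bD o : bmf (\1_(double_cell o) : T -> R) by apply: bmf_indic; exact: measurable_double_cell.
have bC o o' c : bmf (\1_(common_cell o o' c) : T -> R) by apply: bmf_indic; exact: measurable_common_cell.
have bS o : bmf (fun w => \sum_(o' <- components I | o != o') \sum_(c < n) \1_(common_cell o o' c) w : R).
  rewrite (_ : (fun w => _) = fun w => \sum_(o' <- [seq o' <- components I | o != o']) \sum_(c < n) \1_(common_cell o o' c) w).
    by apply: bmf_sum => o'; apply: bmf_sum.
  by apply/funext => w; rewrite big_filter.
have cst (s : seq (option nat)) (a : R) : \sum_(o <- s) a = (size s)%:R * a.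
  by rewrite big_const_seq count_predT iter_addr_0 mulr_natl.
rewrite /clashes ExD; [|exact: bmf_sum|exact: bmf_sum].
rewrite !Ex_sum// mulrDl; apply: lerD.
  rewrite -szc -cst; apply: ler_sum => o _; rewrite Ex_indic; last exact: measurable_double_cell.
  by apply: le_trans (double_cell_le o) _; rewrite /e -mulrA; lra.
rewrite expr2 -{1}szc -mulrA -cst; apply: ler_sum => o _.
rewrite (_ : \int[P]_w _ = \int[P]_w \sum_(o' <- [seq o' <- components I | o != o']) \sum_(c < n) \1_(common_cell o o' c) w); last first.
  by apply: eq_Rintegral => w _; rewrite big_filter.
rewrite Ex_sum; last by move=> o'; exact: bmf_sum.
apply: (@le_trans _ _ (\sum_(o' <- [seq o' <- components I | o != o']) e)); last first.
  by rewrite cst -szc ler_wpM2r// ler_nat size_filter count_size.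
rewrite [leLHS]big_seq [leRHS]big_seq; apply: ler_sum => o'.
rewrite mem_filter => /andP[oo' _]; rewrite Ex_sum//.
apply: (@le_trans _ _ (\sum_(c < n) (2%:R * (n%:R * h ^+ 2)) ^+ 2)).
  apply: ler_sum => c _; rewrite Ex_indic; last exact: measurable_common_cell.
  exact: common_cell_le.
rewrite sumr_const card_ord -[X in X <= _]mulr_natl /e exprMn.
have -> : n%:R * (2%:R ^+ 2 * (n%:R * h ^+ 2) ^+ 2) = 4%:R * n%:R * (n%:R * h ^+ 2) ^+ 2 :> R by ring.
by rewrite lerDr.
Qed.

Lemma clashes_ge1 I w c : (c < n)%N ->
  (2 <= block_incr (fun c => partial I (c%:R * h) w) 1 c)%N -> 1 <= clashes I w.
Proof.
move=> cn; rewrite /partial_process.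
rewrite (@block_incr_sum_seq _ _ (fun o c => component o (c%:R * h) w)); last first.
  by move=> o; exact: (component_grid limit).
have s1 : 0 <= \sum_(o <- components I) \1_(double_cell o) w :> R.
  by apply: sumr_ge0 => o _; rewrite indicE.
have t0 o o' : 0 <= \sum_(c < n) \1_(common_cell o o' c) w :> R.
  by apply: sumr_ge0 => c' _; rewrite indicE.
have r0 o : 0 <= \sum_(o' <- components I | o != o') \sum_(c < n) \1_(common_cell o o' c) w :> R.
  exact: sumr_ge0.
have s2 : 0 <= \sum_(o <- components I) \sum_(o' <- components I | o != o') \sum_(c < n) \1_(common_cell o o' c) w :> R.
  exact: sumr_ge0.
move=> /(sum_ge2 (uniq_components I)) [[u oI hc]|[u [v [oI o'I oo' h1 h2]]]].
  rewrite /clashes (big_rem u)//= indicE mem_set; last by exists c.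
  by rewrite -!addrA lerDl addr_ge0// sumr_ge0// => o' _; rewrite indicE.
rewrite /clashes addrC (big_rem u)//= (big_rem v)//= oo' (bigD1 (Ordinal cn))//= indicE mem_set//.
rewrite -!addrA lerDl !addr_ge0//; apply: sumr_ge0 => // i _; rewrite ?indicE//.
Qed.

End Cells.

Lemma partial_no_clash I (n : nat) : {ae P, forall w, exists K : nat,
  forall c, (c < n.+1 * K.+1)%N ->
  (block_incr (fun c => partial I (c%:R * (K.+1%:R)^-1) w) 1 c <= 1)%N}.
Proof.
pose h K : R := (K.+1%:R)^-1; pose m K := (n.+1 * K.+1)%N.
have h0 K : 0 < h K by rewrite invr_gt0.
have h1 K : h K <= 1 by rewrite invf_le1// ler1n.
have mh K : (m K)%:R * h K ^+ 2 = n.+1%:R * h K.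
  by rewrite /m natrM /h expr2 mulrA mulfK// pnatr_eq0.
pose A K := [set w | 1 <= clashes (h K) (m K) I w].
have mA K : measurable (A K).
  have [mc _] := bmf_clashes (h0 K) (m K) I.
  rewrite (_ : A K = clashes (h K) (m K) I @^-1` `[1, +oo[%classic); last first.
    by apply/seteqP; split => w /=; rewrite in_itv /= andbT.
  by rewrite -[X in measurable X]setTI; apply: mc.
have mI : measurable (\bigcap_K A K) by exact: bigcapT_measurable.
have := @Pr0_ae _ _ _ P _ mI.
have -> : Pr (\bigcap_K A K) = 0.
  apply/eqP; rewrite eq_le Pr_ge0 andbT.
  have c0 : (fun K => (I.+1%:R + I.+1%:R ^+ 2) * (n.+1%:R + 4%:R * n.+1%:R ^+ 3) * h K) @ \oo --> (0 : R).
    by rewrite -[X in _ --> X](mulr0 ((I.+1%:R + I.+1%:R ^+ 2) * (n.+1%:R + 4%:R * n.+1%:R ^+ 3))); apply: cvgMl_tmp; exact: cvg_natS_inv.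
  apply: (@cvg_le R _ _ _ _ _ (@cvgn_cst R _) c0) => K.
  apply: (@le_trans _ _ (Pr (A K))); first by apply: Pr_le => // w; apply.
  apply: (@le_trans _ _ (\int[P]_w clashes (h K) (m K) I w)).
    rewrite -(Ex_indic P (mA K)); apply: Ex_le; [exact: bmf_indic|exact: bmf_clashes|].
    move=> w; rewrite indicE; have [Aw|nA] := pselect (A K w); first by rewrite mem_set.
    rewrite memNset// addr_ge0//; first by apply: sumr_ge0 => o _; rewrite indicE.
    apply: sumr_ge0 => o _; apply: sumr_ge0 => o' _; apply: sumr_ge0 => c _; by rewrite indicE.
  apply: le_trans (Ex_clashes _ _ _ _) _ => //.
  rewrite -[leRHS]mulrA; apply: ler_wpM2l; first by rewrite addr_ge0 ?exprn_ge0.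
  rewrite mh [leRHS]mulrDl lerD2l.
  have -> : 4%:R * (m K)%:R * (n.+1%:R * h K) ^+ 2 = 4%:R * (n.+1%:R ^+ 2 * ((m K)%:R * h K ^+ 2)) :> R by ring.
  by rewrite mh le_eqVlt; apply/orP; left; apply/eqP; ring.
move=> /(_ erefl); apply: filterS => w nA; apply: contrapT => /forallNP H; apply: nA => K _.
have /existsNP[c /not_implyP[cm /negP]] := H K; rewrite -ltnNge => h2.
exact: (clashes_ge1 (h0 K) cm h2).
Qed.

(** Two equal arrival times lie in one cell of every mesh, whereas some mesh has at most one point
    per cell. *)
Lemma arrival_times_ae : {ae P, forall w,
  (0 < arrival_time (collision_process B Bs) 1 w)%E /\ forall k,
  (arrival_time (collision_process B Bs) k.+1 w < arrival_time (collision_process B Bs) k.+2 w < +oo)%E}.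
Proof.
have H : {ae P, forall w, forall I n : nat, exists K : nat,
    forall c, (c < n.+1 * K.+1)%N ->
    (block_incr (fun c => partial I (c%:R * (K.+1%:R)^-1) w) 1 c <= 1)%N}.
  by apply/ae_foralln => I; apply/ae_foralln => n; exact: partial_no_clash.
have reg_ae := regular_limit_ae q_ge2 limit psi_ge0 cvg_psi.
have unb_ae := count_unbounded q_ge2 limit psi_ge0 cvg_psi psi_lim1.
apply: filterS3 reg_ae unb_ae H => w reg unb noclash.
split; first exact: (arrival_time_gt0 limit).
move=> k; have [n hn] := unb k.+2.
have [tau /andP[tau0 taun] etau] := arrival_time_fin limit reg (ler0n R n) hn.
rewrite etau ltry andbT ltNge; apply/negP => le.
have [I0 hI] := count_partial limit n reg.
have [K hK] := noclash I0 n.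
set h : R := (K.+1%:R)^-1 in hK.
have h0 : 0 < h by rewrite invr_gt0.
have tau_gt0 : 0 < tau by have := arrival_time_gt0 limit k.+1 reg; rewrite etau lte_fin.
have mh : (n.+1 * K.+1)%:R * h = n.+1%:R by rewrite natrM /h mulfK// pnatr_eq0.
have ex : exists c : nat, tau <= c.+1%:R * h.
  exists (n.+1 * K.+1).-1; rewrite prednK ?muln_gt0// mh; apply: le_trans taun _; by rewrite ler_nat.
(* The cell []c h, (c + 1) h]] that contains [tau]; the case [c = 0] uses [tau > 0]. *)
pose c := ex_minn ex; have [tc minc] : tau <= c.+1%:R * h /\ forall c', tau <= c'.+1%:R * h -> (c <= c')%N.
  by rewrite /c; case: ex_minnP.
have cm : (c < n.+1 * K.+1)%N.
  rewrite -(prednK (n := n.+1 * K.+1)) ?muln_gt0// ltnS; apply: minc.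
  by rewrite prednK ?muln_gt0// mh; apply: le_trans taun _; rewrite ler_nat.
have ctau : c%:R * h < tau.
  case: c tc minc cm => [|c'] tc minc cm; first by rewrite mul0r.
  by rewrite ltNge; apply/negP => /minc; rewrite ltnn.
have ge0 (j : nat) : 0 <= j%:R * h by rewrite mulr_ge0// ltW.
have up (j : nat) : (j <= n.+1 * K.+1)%N -> j%:R * h <= n.+1%:R.
  by move=> jm; rewrite -mh ler_wpM2r ?ler_nat// ltW.
have a1 : (k.+2 <= count (c.+1%:R * h) w)%N.
  by apply/(arrival_timeP limit k.+2 reg (ge0 _)); rewrite etau lee_fin.
have a2 : (count (c%:R * h) w <= k)%N.
  rewrite leqNgt; apply/negP => /(arrival_timeP limit k.+1 reg (ge0 _)).
  move=> /(le_trans le); by rewrite lee_fin leNgt ctau.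
have := hK c cm; rewrite /block_incr !muln1 !(hI I0)// ?up// ?(ltnW cm)//.
by move=> /(leq_trans (leq_sub a1 a2)); rewrite -[k.+2]addn2 addKn.
Qed.

End Strict.

(** * From generating functions to laws *)

Section CollisionTimesFinite.
Context {d : measure_display} {T : measurableType d} {R : realType} {q : nat}.
Hypothesis q_ge2 : (2 <= q)%N.
Variables (P : probability T R) (p : nat -> R) (C : nat -> T -> 'I_q) (Z : nat -> T -> nat).
Hypothesis model : urn_model C Z P p.
Hypothesis p_ge0 : forall i, 0 <= p i.
Hypothesis p_noninc : forall i, p i.+1 <= p i.
Hypothesis p_sum : series p @ \oo --> (1 : R).

(** The first urn suffices: each draw multiplies an eigenvector by [1 - p 0 + p 0 * eigval], which
    is in [0, 1[ as [p 0 > 0]. *)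
Lemma ncollisions_unbounded :
  {ae P, forall w : T, forall m, exists n, (m <= ncollisions C Z n w)%N}.
Proof.
have q0 := @qi_gt0 R q q_ge2; have q1 := @qi_lt1 R q q_ge2.
pose x : R := q%:R^-1 / 2%:R.
have xq : x != q%:R^-1 by rewrite /x; apply/eqP; lra.
have x01 : 0 < x <= 1 by rewrite /x; apply/andP; split; lra.
have p0 : 0 < p 0%N by exact: p0_gt0.
have p1 : p 0%N <= 1 by exact: p0_le1.
have dT I n : discrete_rv (trunc_ncollisions C Z I n) by exact: (discrete_trunc_ncollisions model).
have U : {ae P, forall w, forall m, exists n, (m <= trunc_ncollisions C Z 1 n w)%N}.
  apply: (@unbounded_ae _ _ _ P _ x) => //.
  have E n : \int[P]_w x ^+ trunc_ncollisions C Z 1 n w =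
      \sum_(e : {ffun 'I_1 -> urn_state})
      (\prod_i eigcoord q x (fun=> 1) (e i)) * ((1 - p 0%N + p 0%N * eigval q x (e ord0)) ^+ n *
       prodf (fun i => eigvec q x (e i)) (fun=> None)).
    have xsP y : y \in [:: x] -> 0 <= y <= 1 by rewrite inE => /eqP ->; case/andP: x01 => /ltW -> ->.
    have := @Ex_trunc _ _ _ _ q_ge2 P p C Z model 1 n [:: x] xsP.
    rewrite (_ : \int[P]_v pow _ _ = \int[P]_w x ^+ trunc_ncollisions C Z 1 n w); last first.
      apply: eq_Rintegral => w _; rewrite /pow /block_incrs /= big_seq1 /= /block_incr mul1n mul0n.
      by rewrite {2}/trunc_ncollisions big_ord0 subn0.
    move=> ->; rewrite /draw_blocks /= big_ord1.
    rewrite (_ : (fun=> 1) = prodf (fun (_ : 'I_1) (_ : urn_state) => 1 : R)); last first.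
      by apply/funext => sg; rewrite /prodf big_ord1.
    rewrite iter_draw_op_prodf//; apply: eq_bigr => e _; by rewrite !big_ord1.
  apply: (cvgn_ext (fun n => esym (E n))).
  rewrite [X in _ --> X](_ : 0 = \sum_(e : {ffun 'I_1 -> urn_state})
      (\prod_i eigcoord q x (fun=> 1) (e i)) * (0 * prodf (fun i => eigvec q x (e i)) (fun=> None))); last first.
    by rewrite big1// => e _; rewrite mul0r mulr0.
  apply: cvg_big => [|e _]; first exact: (@add_continuous).
  apply: cvgMl_tmp; apply: cvgMr_tmp; apply: cvg_expr.
  have [l0 l1] : 0 <= eigval q x (e ord0) /\ eigval q x (e ord0) < 1.
    case/andP: x01 => x0 x1; case: (e ord0) => [[]|] /=; split=> //; rewrite ?ltW//.
    by rewrite /x; lra.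
  rewrite ger0_norm; first by nra.
  by rewrite addr_ge0 ?mulr_ge0// subr_ge0.
apply: filterS U => w hw m; have [n hn] := hw m; exists n; apply: leq_trans hn _.
by apply: leq_sum => t _; case: (_ < _)%N.
Qed.

Lemma collision_time_fin_num : {ae P, forall w : T, forall m, (collision_time C Z m w : \bar R) \is a fin_num}.
Proof.
apply: filterS ncollisions_unbounded => w hw m; have [n hn] := hw m.
by have [k [-> _]] := @collision_timeE _ _ R _ q_ge2 C Z m n w hn.
Qed.

End CollisionTimesFinite.

(** * Probabilities as coefficients of generating functions *)

Section CoefficientExtraction.
Context {R : realType} (d : nat -> measure_display) (O : forall N, measurableType (d N))
  (P : forall N, probability (O N) R) (d' : measure_display) (O' : measurableType d')
  (Q : probability O' R).

(** The difference keeps the event [V > k], on which [x ^+ V <= x ^+ k.+1]. *)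
Lemma coeff_bounds {dT : measure_display} {T : measurableType dT} (S : probability T R)
    (V : T -> nat) (W : T -> R) (x : R) k :
  discrete_rv V -> measurable_fun setT W -> (forall w, 0 <= W w <= 1) -> 0 < x <= 1 ->
  0 <= \int[S]_w (x ^+ V w * W w) - \sum_(j < k.+1) x ^+ j * \int[S]_w ((V w == j)%:R * W w) <= x ^+ k.+1.
Proof.
move=> dV mW W01 /andP[x0 x1].
have bW : bmf W by split=> //; exists 1 => w; have /andP[a b] := W01 w; rewrite ger0_norm.
have b1 : bmf (fun w => x ^+ V w * W w).
  apply: bmfM => //; apply: (bmf_discrete (g := fun j => x ^+ j)) => //.
  by exists 1 => v; rewrite ger0_norm ?exprn_ge0 ?exprn_ile1// ltW.
have b2 (j : nat) : bmf (fun w => (V w == j)%:R * W w).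
  apply: bmfM => //; apply: (bmf_discrete (g := fun i => (i == j)%:R)) => //.
  by exists 1 => v; case: (v == j); rewrite ?normr1 ?normr0.
have b3 : bmf (fun w => \sum_(j < k.+1) x ^+ j * ((V w == j)%:R * W w)).
  by apply: bmf_sum => j; apply: bmfM => //; exact: bmf_cst.
have -> : \sum_(j < k.+1) x ^+ j * \int[S]_w ((V w == j)%:R * W w) =
    \int[S]_w \sum_(j < k.+1) x ^+ j * ((V w == j)%:R * W w).
  rewrite Ex_sum; last by move=> j; apply: bmfM => //; exact: bmf_cst.
  by apply: eq_bigr => j _; rewrite ExZ.
rewrite -ExB//.
have E w : x ^+ V w * W w - \sum_(j < k.+1) x ^+ j * ((V w == j)%:R * W w) =
    if (V w < k.+1)%N then 0 else x ^+ V w * W w.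
  case: ifPn => Vk.
    rewrite (bigD1 (Ordinal Vk))//= eqxx mul1r big1 ?addr0 ?subrr// => j jV.
    by rewrite (_ : V w == j = false) ?mul0r ?mulr0//; apply: contraNF jV => /eqP e; apply/eqP/val_inj.
  rewrite big1 ?subr0// => j _; rewrite (_ : V w == j = false) ?mul0r ?mulr0//.
  by apply: contraNF Vk => /eqP ->.
have nonneg w : 0 <= x ^+ V w * W w by have /andP[a b] := W01 w; rewrite mulr_ge0 ?exprn_ge0// ltW.
apply/andP; split; first by apply: Ex_ge0 => w; rewrite E; case: ifP.
rewrite -[leRHS](Ex_cst S); apply: Ex_le; [exact: bmfB|exact: bmf_cst|] => w.
rewrite E; case: ifPn => [_|]; first by rewrite exprn_ge0// ltW.
rewrite -leqNgt => kV; have /andP[a b] := W01 w.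
rewrite -[leRHS]mulr1; apply: ler_pM => //; first by rewrite exprn_ge0// ltW.
by apply: ler_wiXn2l => //; exact: ltW.
Qed.

(** Coefficient [k] is isolated by subtracting the lower ones, known by induction, and dividing by
    [x ^+ k]. Only small [x] are needed, so an excluded value such as 1/q does no harm. *)
Lemma coeff_cvg (V : forall N, O N -> nat) (W : forall N, O N -> R) (V' : O' -> nat) (W' : O' -> R) (c : R) :
  0 < c <= 1 -> (forall N, discrete_rv (V N)) -> discrete_rv V' ->
  (forall N, measurable_fun setT (W N)) -> measurable_fun setT W' ->
  (forall N w, 0 <= W N w <= 1) -> (forall w, 0 <= W' w <= 1) ->
  (forall x, 0 < x < c -> (fun N => \int[P N]_w (x ^+ V N w * W N w)) @ \oo --> \int[Q]_w (x ^+ V' w * W' w)) ->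
  forall k, (fun N => \int[P N]_w ((V N w == k)%:R * W N w)) @ \oo --> \int[Q]_w ((V' w == k)%:R * W' w).
Proof.
move=> /andP[c0 c1] dV dV' mW mW' W01 W'01 cv; elim/ltn_ind => k IH.
apply: dist_cvgn => e e0.
(* After division by [x ^+ k] the higher terms cost at most [x < e / 2]; the other half of [e] pays
   for the convergence of [b]. *)
pose x := Num.min c (e / 2%:R) / 2%:R.
have m0 : 0 < Num.min c (e / 2%:R) by rewrite lt_min c0 divr_gt0.
have mc : Num.min c (e / 2%:R) <= c by rewrite ge_min lexx.
have me : Num.min c (e / 2%:R) <= e / 2%:R by rewrite ge_min lexx orbT.
have x0 : 0 < x by rewrite /x; lra.
have xc : x < c by rewrite /x; lra.
have xe : x < e / 2%:R by rewrite /x; lra.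
have x01 : 0 < x <= 1 by rewrite x0 ltW// (lt_le_trans xc).
pose b N := \int[P N]_w (x ^+ V N w * W N w) - \sum_(j < k) x ^+ j * \int[P N]_w ((V N w == j)%:R * W N w).
pose b' := \int[Q]_w (x ^+ V' w * W' w) - \sum_(j < k) x ^+ j * \int[Q]_w ((V' w == j)%:R * W' w).
have bb : b @ \oo --> b'.
  apply: cvgB; first by apply: cv; rewrite x0 xc.
  apply: cvg_big => [|j _]; first exact: (@add_continuous).
  by apply: cvgMl_tmp; exact: IH.
have xk : 0 < x ^+ k by exact: exprn_gt0.
have [N hN] := cvgn_dist bb (mulr_gt0 xk (divr_gt0 e0 (ltr0n R 2))).
exists N => n Nn.
have := coeff_bounds (P n) k (dV n) (mW n) (W01 n) x01.
have := coeff_bounds Q k dV' mW' W'01 x01.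
rewrite !big_ord_recr /= !opprD !addrA -/(b n) -/b'.
set u := \int[Q]_w ((V' w == k)%:R * W' w); set v := \int[P n]_w ((V n w == k)%:R * W n w).
move=> /andP[l1 l2] /andP[l3 l4]; have := hN n Nn; rewrite ltr_norml => /andP[l5 l6].
have xx : x ^+ k.+1 < x ^+ k * (e / 2%:R) by rewrite exprSr ltr_pM2l.
rewrite -(ltr_pM2l xk) -[x ^+ k in X in X < _](ger0_norm (ltW xk)) -normrM ltr_norml mulrBr.
have -> : x ^+ k * e = x ^+ k * (e / 2%:R) + x ^+ k * (e / 2%:R) by field.
by apply/andP; split; lra.
Qed.

Definition factor (z : R + nat) (k : nat) : R :=
  match z with inl x => x ^+ k | inr j => (k == j)%:R end.

Lemma multi_coeff_cvg (D : forall N, nat -> O N -> nat) (D' : nat -> O' -> nat) (J : nat) (c : R) :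
  0 < c <= 1 -> (forall N j, discrete_rv (D N j)) -> (forall j, discrete_rv (D' j)) ->
  (forall xs : nat -> R, (forall j, 0 < xs j < c) ->
    (fun N => \int[P N]_w \prod_(j < J) xs j ^+ D N j w) @ \oo --> \int[Q]_w \prod_(j < J) xs j ^+ D' j w) ->
  forall ds : nat -> nat,
    (fun N => \int[P N]_w \prod_(j < J) (D N j w == ds j)%:R) @ \oo --> \int[Q]_w \prod_(j < J) (D' j w == ds j)%:R.
Proof.
move=> /andP[c0 c1] dD dD' cv ds.
have c2 : 0 < c / 2%:R < c by apply/andP; split; lra.
have fac01 (z : R + nat) i : (forall x, z = inl x -> 0 < x < c) -> 0 <= factor z i <= 1.
  case: z => [x|j] zP /=; last by case: (i == j); rewrite ?lexx ler01.
  by have /andP[x0 xc] := zP x erefl; rewrite exprn_ge0 ?exprn_ile1// ltW// (lt_le_trans xc).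
(* Coordinates from [k] on are still powers. Each step of the induction turns one more coordinate
   into an indicator by [coeff_cvg], the other factors forming the weight [W]. *)
suff H k (z : nat -> R + nat) : (forall j x, z j = inl x -> 0 < x < c) ->
    (forall j, (k <= j)%N -> exists x, z j = inl x) ->
    (fun N => \int[P N]_w \prod_(j < J) factor (z j) (D N j w)) @ \oo -->
    \int[Q]_w \prod_(j < J) factor (z j) (D' j w).
  pose z j : R + nat := if (j < J)%N then inr (ds j) else inl (c / 2%:R).
  have := H J z; have zP j x : z j = inl x -> 0 < x < c by rewrite /z; case: ifP => // _ [<-].
  move=> /(_ zP) h; have {}h := h _.
  have E dT (T : measurableType dT) (S : probability T R) (F : nat -> T -> nat) :
      \int[S]_w \prod_(j < J) factor (z j) (F j w) = \int[S]_w \prod_(j < J) (F j w == ds j)%:R.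
    by apply: eq_Rintegral => w _; apply: eq_bigr => j _; rewrite /z ltn_ord.
  rewrite -E; under eq_fun do rewrite -E; apply: h => j Jj.
  by exists (c / 2%:R); rewrite /z ltnNge Jj.
elim: k z => [|k IH] z zP zk.
  pose xs j := if z j is inl x then x else c / 2%:R.
  have zE j : z j = inl (xs j) by rewrite /xs; have [x ->] := zk j (leq0n j).
  rewrite (_ : \int[Q]_w _ = \int[Q]_w \prod_(j < J) xs j ^+ D' j w); last first.
    by apply: eq_Rintegral => w _; apply: eq_bigr => j _; rewrite zE.
  rewrite (_ : (fun N => _) = fun N => \int[P N]_w \prod_(j < J) xs j ^+ D N j w); last first.
    by apply/funext => N; apply: eq_Rintegral => w _; apply: eq_bigr => j _; rewrite zE.
  by apply: cv => j; apply: zP; exact: zE.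
pose z' x : nat -> R + nat := update z k (inl x).
have z'P x : 0 < x < c -> (forall j y, z' x j = inl y -> 0 < y < c).
  by move=> x0 j y; rewrite /z' /update; case: eqP => [_ [<-]//|_]; exact: zP.
have z'k x : forall j, (k <= j)%N -> exists y, z' x j = inl y.
  move=> j kj; rewrite /z' /update; case: eqP => [_|/eqP jk]; first by exists x.
  by apply: zk; rewrite ltn_neqAle eq_sym jk.
have cz x : 0 < x < c -> _ := fun hx => IH (z' x) (z'P x hx) (z'k x).
have [kJ|Jk] := ltnP k J; last first.
  have E dT (T : measurableType dT) (S : probability T R) (F : nat -> T -> nat) :
      \int[S]_w \prod_(j < J) factor (z j) (F j w) = \int[S]_w \prod_(j < J) factor (z' (c / 2%:R) j) (F j w).
    apply: eq_Rintegral => w _; apply: eq_bigr => j _; rewrite /z' /update; case: eqP => // jk.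
    by have := ltn_ord j; rewrite jk ltnNge Jk.
  by rewrite E; under eq_fun do rewrite E; exact: cz.
case zE : (z k) => [x|e].
  have E : z = z' x by apply/funext => j; rewrite /z' /update; case: eqP => [->|].
  by rewrite E; apply: cz; exact: zP zE.
pose W (T : Type) (F : nat -> T -> nat) (w : T) : R := \prod_(j < J | j != Ordinal kJ) factor (z j) (F j w).
have W01 (T : Type) (F : nat -> T -> nat) w : 0 <= W T F w <= 1.
  apply/andP; split; first by apply: prodr_ge0 => j _; have /andP[] := fac01 (z j) (F j w) (zP j).
  by apply: prodr_ile1 => j _; apply: fac01 => x; exact: zP.
have mW dT (T : measurableType dT) (F : nat -> T -> nat) : (forall j, discrete_rv (F j)) ->
    measurable_fun setT (W T F).
  move=> dF; rewrite (_ : W T F = fun w => \prod_(j <- [seq j <- index_enum 'I_J | j != Ordinal kJ]) factor (z j) (F j w)).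
    by apply: measurable_prod => j _; exact: (measurable_discrete (factor (z j)) (dF j)).
  by apply/funext => w; rewrite /W big_filter.
have E1 dT (T : measurableType dT) (S : probability T R) (F : nat -> T -> nat) :
    \int[S]_w \prod_(j < J) factor (z j) (F j w) = \int[S]_w ((F k w == e)%:R * W T F w).
  by apply: eq_Rintegral => w _; rewrite (bigD1 (Ordinal kJ))//= zE.
have E2 x dT (T : measurableType dT) (S : probability T R) (F : nat -> T -> nat) :
    \int[S]_w \prod_(j < J) factor (z' x j) (F j w) = \int[S]_w (x ^+ F k w * W T F w).
  apply: eq_Rintegral => w _; rewrite (bigD1 (Ordinal kJ))//= {1}/z' {1}/update eqxx; congr (_ * _).
  by apply: eq_bigr => j jk; rewrite /z' /update ifN.
rewrite E1; under eq_fun do rewrite E1.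
apply: (@coeff_cvg (fun N => D N k) (fun N => W _ (D N)) (D' k) (W _ D') c); rewrite ?c0 ?c1//.
- by move=> N; exact: mW.
- exact: mW.
- by move=> x hx; rewrite -E2; under eq_fun do rewrite -E2; exact: cz.
Qed.

End CoefficientExtraction.

(** * Locating the times by the block that contains them *)

Section BlockIndex.
Context {R : realType}.

(* The index of the block containing the point number [k] (counted from 0)
   when the block [j] contains [ds j] points. *)
Definition block_index (J : nat) (ds : nat -> nat) (k : nat) : nat :=
  (\sum_(j < J) (\sum_(i < j.+1) ds i <= k))%N.

Lemma sum_initial (p : pred nat) J : (forall i j, (i <= j)%N -> p j -> p i) ->
  forall j, (j < J)%N -> p j = (j < \sum_(i < J) p i)%N.
Proof.
move=> hp; elim: J => [//|J IH] j; rewrite ltnS leq_eqVlt big_ord_recr /=.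
case pJ : (p J).
  have -> : (\sum_(i < J) p i)%N = J.
    rewrite (eq_bigr (fun=> 1%N)) ?sum1_card ?card_ord// => i _.
    by rewrite (hp i J)// ltnW.
  by move=> jJ; rewrite addn1 (hp j J) ?ltnS// leq_eqVlt.
rewrite addn0 => /orP[/eqP ->|]; last exact: IH.
rewrite pJ; apply/esym/negbTE; rewrite -leqNgt.
apply: leq_trans (_ : \sum_(i < J) 1 <= _)%N; first by apply: leq_sum => i _; exact: leq_b1.
by rewrite sum1_card card_ord.
Qed.

(** The unit [u] covers both clocks: the number of draws in a block for the urns, [delta] for the
    limit process. *)
Lemma block_indexP (J k : nat) (c : nat -> nat) (tau u : R) : {homo c : i j / (i <= j)%N} ->
  c 0%N = 0%N -> (k < c J)%N -> 0 <= tau -> (forall j : nat, tau <= j%:R * u <-> (k < c j)%N) ->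
  let b := block_index J (block_incr c 1) k in
  (b < J)%N /\ b%:R * u <= tau <= b.+1%:R * u.
Proof.
move=> hc c0 kJ tau0 tauP b.
have cs j : (\sum_(i < j.+1) block_incr c 1 i)%N = c j.+1.
  by rewrite sum_block_incr// c0 subn0.
pose p j := (c j.+1 <= k)%N.
have hp i j : (i <= j)%N -> p j -> p i by move=> ij; apply: leq_trans; exact: hc.
have bE : b = (\sum_(i < J) p i)%N by apply: eq_bigr => j _; rewrite cs.
have pb j : (j < J)%N -> p j = (j < b)%N by rewrite bE; exact: sum_initial.
have bJ : (b < J)%N.
  case: J kJ @b bE pb => [|J] kJ b bE pb; first by rewrite c0 in kJ.
  have := pb J (ltnSn J); rewrite /p leqNgt kJ /= => /esym/negbT; by rewrite -leqNgt ltnS.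
split=> //; apply/andP; split.
  case E : b => [|b']; first by rewrite mul0r.
  rewrite leNgt; apply/negP => /ltW /tauP; rewrite ltnNge => /negP; apply.
  by rewrite -/(p b') pb ?E ?ltnS// -E ltnW.
by apply/tauP; rewrite ltnNge -/(p b) pb// ltnn.
Qed.

End BlockIndex.

Section RowFunctions.
Context {R : realType} {m : nat}.

(** Rounding the coordinates down to multiples of [1 / n.+1] gives functions of countably many
    values, which converge by continuity of [f]. *)
Lemma measurable_row_fun {d : measure_display} {T : measurableType d} (Y : nat -> T -> R)
    (f : 'rV[R]_m -> R) : (forall k, measurable_fun setT (Y k)) -> continuous f ->
  measurable_fun setT (fun w => f (\row_(k < m) Y k w)).
Proof.
move=> mY cf.
pose V n w := [seq Num.floor (n.+1%:R * Y (val k) w) | k <- enum 'I_m].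
pose F n (s : seq int) := f (\row_(k < m) ((nth 0 s k)%:~R / n.+1%:R)).
apply: (@measurable_fun_cvg _ _ _ _ (fun n w => F n (V n w))).
  move=> n; apply: (measurable_discrete (F n)); apply: discrete_map => k v.
  have mk : measurable_fun setT (fun w => n.+1%:R * Y (val k) w) by apply: measurable_funM => //; exact: measurable_cst.
  rewrite (_ : _ @^-1` _ = (fun w => n.+1%:R * Y (val k) w) @^-1` `[v%:~R, (v + 1)%:~R[%classic).
    by rewrite -[X in measurable X]setTI; apply: mk.
  apply/seteqP; split => w /=; rewrite in_itv /=.
    by move=> <-; rewrite floor_le floorD1_gt.
  move=> /andP[a b]; apply/eqP; rewrite eq_le floor_ge_int a andbT -ltzD1 floor_lt_int.
  exact: b.
move=> w _.
suff H : (fun n => \row_(k < m) ((nth 0 (V n w) k)%:~R / n.+1%:R) : 'rV[R]_m) @ \oo --> \row_(k < m) Y k w.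
  exact: (@cvg_comp _ _ _ _ f _ _ _ H (cf _)).
apply/cvg_ballP => e e0.
have [N hN] := cvgn_dist (@cvg_natS_inv R) e0.
exists N => // n /= Nn; split=> // i j; rewrite /ball /= !mxE /V.
rewrite (nth_map j) ?size_enum_ord// nth_ord_enum /=.
set y := Y j w; have n0 : 0 < n.+1%:R :> R by rewrite ltr0n.
have := hN n Nn; rewrite sub0r normrN ger0_norm ?invr_ge0//; apply: le_lt_trans.
have -> : y - (Num.floor (n.+1%:R * y))%:~R / n.+1%:R = (n.+1%:R * y - (Num.floor (n.+1%:R * y))%:~R) / n.+1%:R.
  by rewrite mulrBl [n.+1%:R * y]mulrC mulfK// gt_eqF.
have f1 := floor_le (n.+1%:R * y); have f2 := floorD1_gt (n.+1%:R * y).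
rewrite ger0_norm; last by rewrite divr_ge0// subr_ge0.
rewrite -[leRHS]mul1r ler_wpM2r ?invr_ge0//.
by move: f2; rewrite intrD; lra.
Qed.

(** Only [x] is required to lie in the box: the covering argument controls all the neighbours [y] of
    its points. *)
Lemma unif_continuous_box (f : 'rV[R]_m -> R) (L e : R) : continuous f -> 0 < e ->
  exists2 r, 0 < r & forall x y : 'rV[R]_m, (forall k, 0 <= x ord0 k <= L) ->
    (forall k, `|x ord0 k - y ord0 k| < r) -> `|f x - f y| < e.
Proof.
move=> cf e0.
have cA : compact [set v : 'rV[R]_m | forall k, `[0, L]%classic (v ord0 k)].
  by apply: (@rV_compact _ _ (fun _ => `[0, L]%classic)) => k; exact: segment_compact.
pose Q (r : R) (x : 'rV[R]_m) := forall y : 'rV[R]_m, (forall k, `|x ord0 k - y ord0 k| < r) -> `|f x - f y| < e.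
have H : \forall r \near (0 : R)^'+, [set v : 'rV[R]_m | forall k, `[0, L]%classic (v ord0 k)] `<=` Q r.
  have /compact_near_coveringP := cA; apply => x Ax.
  have [s s0 hs] : exists2 s, 0 < s & forall y : 'rV[R]_m, (forall k, `|x ord0 k - y ord0 k| < s) -> `|f x - f y| < e / 2%:R.
    have /cvg_ballP /(_ (e / 2%:R)) := cf x; rewrite divr_gt0// => /(_ isT).
    rewrite -nbhs_nearE => /nbhs_ballP [s /= s0 hs]; exists s => // y xy.
    by apply: (hs y); split=> // i j; rewrite (ord1 i); exact: xy.
  exists ([set x' | ball x (s / 2%:R) x'], [set r | r < s / 2%:R]).
    split; first by apply: nbhsx_ballx; rewrite divr_gt0.
    by apply: nbhs_right_lt; rewrite divr_gt0.
  move=> [x' r] [/= xx' rs] y x'y.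
  have s2 : s = s / 2%:R + s / 2%:R by field.
  have h1 : `|f x - f x'| < e / 2%:R.
    apply: hs => k; have [_ /(_ ord0 k)] := xx'; rewrite /ball /= => h; apply: (lt_trans h); lra.
  have h2 : `|f x - f y| < e / 2%:R.
    apply: hs => k; have [_ /(_ ord0 k)] := xx'; rewrite /ball /= => h.
    rewrite -(subrK (x' ord0 k) (x ord0 k)) -addrA; apply: le_lt_trans (ler_normD _ _) _.
    by have := x'y k; lra.
  rewrite -(subrK (f x) (f x')) -addrA; apply: le_lt_trans (ler_normD _ _) _.
  by rewrite distrC; lra.
have [r [r0 hr]] : exists r, 0 < r /\ [set v : 'rV[R]_m | forall k, `[0, L]%classic (v ord0 k)] `<=` Q r.
  have [s s0 hs] := at_rightP H; exists (s / 2%:R); split; first by rewrite divr_gt0.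
  by apply: hs; rewrite ?divr_gt0//; lra.
exists r => // x y Ax; apply: hr => k /=; by rewrite in_itv /=; exact: Ax.
Qed.

End RowFunctions.

Lemma measurable_fine_time {d : measure_display} {T : measurableType d} {R : realType} (E : T -> \bar R) :
  (forall u : R, measurable [set w | (E w < u%:E)%E]) -> measurable_fun setT (fun w => fine (E w)).
Proof.
move=> mE; apply: (measurableT_comp (f := fine)); first exact: fine_measurable.
apply: (measurability _ (ErealGenInftyO.measurableE R)) => _ /= -[_ [r ->] <-].
by rewrite setTI preimage_itvNyo; exact: mE.
Qed.

(** * Convergence of the collision times *)

Lemma expectationE {d : measure_display} {T : measurableType d} {R : realType}
    (P : probability T R) (f : T -> R) : bmf f -> 'E_P[f]%E = (\int[P]_w f w)%:E.
Proof.
move=> bf; rewrite unlock /Rintegral fineK//.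
by apply: integrable_fin_num => //; exact: bmf_integrable.
Qed.

Section Patterns.
Context {R : realType}.
Variables (J L m : nat).

Let good (D : nat -> nat) := (m <= \sum_(j < J) D j <= L)%N.

Let extend (ds : {ffun 'I_J -> 'I_L.+1}) (j : nat) : nat :=
  if insub j is Some i then nat_of_ord (ds i) else 0%N.

Let extendE ds (j : 'I_J) : extend ds j = ds j.
Proof. by rewrite /extend valK. Qed.

Definition patterns : seq (nat -> nat) :=
  [seq extend ds | ds <- index_enum {ffun 'I_J -> 'I_L.+1} & good (extend ds)].

(* Only finitely many patterns have a bounded sum: the convergence of their
   probabilities is enough. *)
Lemma pattern_sum (phi : (nat -> nat) -> R) (D : nat -> nat) :
  (forall D', (forall j, (j < J)%N -> D j = D' j) -> phi D = phi D') ->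
  \sum_(ds <- patterns) phi ds * \prod_(j < J) (D j == ds j)%:R =
  if (m <= \sum_(j < J) D j <= L)%N then phi D else 0.
Proof.
move=> phiP; rewrite big_map big_filter -/(good D); case: ifPn => gD; last first.
  apply: big1 => ds gds; rewrite [X in _ * X](_ : _ = 0) ?mulr0//.
  have /existsP[j nj] : [exists j : 'I_J, D j != extend ds j].
    apply: contraT; rewrite negb_exists => /forallP h; move: gds gD; rewrite /good.
    by rewrite (eq_bigr (fun j : 'I_J => D j)) => [-> //|j _]; apply/esym/eqP; have := h j; rewrite negbK.
  by rewrite (bigD1 j)//= (negbTE nj) mul0r.
have Dj (j : 'I_J) : (D j < L.+1)%N.
  by move: gD => /andP[_]; rewrite (bigD1 j)//= ltnS => h; apply: leq_trans h; exact: leq_addr.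
pose ds0 : {ffun 'I_J -> 'I_L.+1} := [ffun j => Ordinal (Dj j)].
have e0 (j : 'I_J) : extend ds0 j = D j by rewrite extendE ffunE.
have g0 : good (extend ds0) by rewrite /good (eq_bigr (fun j : 'I_J => D j)).
rewrite (bigD1 ds0)//=.
rewrite [X in _ + X]big1 ?addr0 => [|ds /andP[gds ne]].
  rewrite big1 ?mulr1; last by move=> j _; rewrite e0 eqxx.
  by apply/esym/phiP => j jJ; rewrite (e0 (Ordinal jJ)).
rewrite [X in _ * X](_ : _ = 0) ?mulr0//.
have /existsP[j nj] : [exists j : 'I_J, D j != extend ds j].
  apply: contraNT ne; rewrite negb_exists => /forallP h; apply/eqP/ffunP => j.
  by apply: val_inj; rewrite ffunE /= -extendE; apply/esym/eqP; have := h j; rewrite negbK.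
by rewrite (bigD1 j)//= (negbTE nj) mul0r.
Qed.

End Patterns.

Section Lattice.
Context {R : realType}.

(** One [delta] is the width of the block; the other absorbs the discrepancy between [delta] and
    [s * u], accumulated over at most [J] blocks. *)
Lemma lattice_close (delta s u tau : R) (J b : nat) : (b < J)%N -> 0 <= s ->
  b%:R * u <= tau <= b.+1%:R * u -> `|delta - s * u| * J%:R < delta ->
  `|delta * b%:R - s * tau| < 2%:R * delta.
Proof.
move=> bJ s0 /andP[t1 t2]; set e := `|_| => eJ.
have b1 : e * b.+1%:R < delta.
  by apply: le_lt_trans eJ; rewrite ler_wpM2l ?normr_ge0// ler_nat.
have b0 : e * b%:R <= e * b.+1%:R by rewrite ler_wpM2l ?normr_ge0// ler_nat.
have := ler_wpM2l s0 t1; have := ler_wpM2l s0 t2.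
have /ler_normlP [e1 e2] := lexx e.
have n0 : 0 <= b%:R :> R by exact: ler0n.
have n1 : 0 <= b.+1%:R :> R by exact: ler0n.
have := ler_wpM2r n0 e1; have := ler_wpM2r n0 e2; have := ler_wpM2r n1 e1; have := ler_wpM2r n1 e2.
rewrite ltr_norml -[b.+1%:R]natr1 in b1 b0 *.
move=> h1 h2 h3 h4 h5 h6; apply/andP; split; nra.
Qed.

Variables (m : nat) (f : 'rV[R]_m -> R) (L e r delta : R) (J : nat).
Hypothesis fP : forall x y : 'rV[R]_m, (forall k, 0 <= x ord0 k <= L) ->
  (forall k, `|x ord0 k - y ord0 k| < r) -> `|f x - f y| < e.
Hypothesis delta0 : 0 < delta.
Hypothesis delta_r : 2%:R * delta <= r.
Hypothesis delta_J : delta * J%:R <= L.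

Definition lattice_value (D : nat -> nat) : R := f (\row_(k < m) (delta * (block_index J D k)%:R)).

Lemma lattice_value_ext D D' : (forall j, (j < J)%N -> D j = D' j) -> lattice_value D = lattice_value D'.
Proof.
move=> DD; congr (f _); apply/matrixP => i k; rewrite !mxE; congr (_ * _%:R).
apply: eq_bigr => j _; congr (nat_of_bool (_ <= _)%N); apply: eq_bigr => i' _.
by apply: DD; apply: leq_trans (ltn_ord i') (ltn_ord j).
Qed.

Lemma lattice_valueP (c : nat -> nat) (s u : R) (tau : nat -> R) :
  {homo c : i j / (i <= j)%N} -> c 0%N = 0%N -> (m <= \sum_(j < J) block_incr c 1 j)%N ->
  0 <= s -> `|delta - s * u| * J%:R < delta -> (forall k, (k < m)%N -> 0 <= tau k) ->
  (forall k, (k < m)%N -> forall j : nat, tau k <= j%:R * u <-> (k < c j)%N) ->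
  `|f (\row_(k < m) (s * tau k)) - lattice_value (block_incr c 1)| < e.
Proof.
move=> hc c0; rewrite sum_block_incr// c0 subn0 => mJ s0 su tau0 tauP; rewrite distrC.
have bP (k : 'I_m) := @block_indexP R J k c (tau k) u hc c0 (leq_trans (ltn_ord k) mJ) (tau0 k (ltn_ord k)) (tauP k (ltn_ord k)).
apply: fP => k; rewrite !mxE; have [bJ bt] := bP k.
  rewrite mulr_ge0 ?ler0n ?(ltW delta0)//=; apply: le_trans delta_J.
  by rewrite ler_wpM2l ?(ltW delta0)// ler_nat ltnW.
by apply: lt_le_trans delta_r; apply: lattice_close bt su.
Qed.

End Lattice.

Section MeasurableTimes.
Context {d : measure_display} {T : measurableType d} {R : realType} {q : nat}.

Lemma measurable_collision_time (P : probability T R) (p : nat -> R) (C : nat -> T -> 'I_q) (Z : nat -> T -> nat) k :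
  urn_model C Z P p -> measurable_fun setT (fun w => fine (collision_time C Z k w : \bar R)).
Proof.
move=> model; apply: measurable_fine_time => u.
rewrite (_ : [set w | _] = \bigcup_(t in [set t : nat | (t%:R : R) < u]) ncollisions C Z t @^-1` [set k]).
  by apply: bigcup_measurable => t _; exact: (discrete_ncollisions model).
apply/seteqP; split => w /=.
  by move=> /ereal_inf_lt [_ [t tk <-]]; rewrite lte_fin => tu; exists t.
move=> [t tu tk]; apply: (@le_lt_trans _ _ (t%:R : R)%:E); last by rewrite lte_fin.
by apply: ereal_inf_lbound; exists t.
Qed.

Variables (P : probability T R) (psi : nat -> R).
Variables (B : R -> T -> nat) (Bs : nat -> 'I_q -> R -> T -> nat).
Hypothesis limit : limit_model P psi B Bs.

Lemma measurable_collision_process t : 0 <= t -> measurable_fun setT (collision_process B Bs t).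
Proof.
move=> t0; have mE (o : option nat) : measurable_fun setT (fun w => ((component B Bs o t w)%:R : R)%:E).
  apply/measurable_EFinP; apply: (measurable_discrete (fun k : nat => k%:R)).
  exact: (discrete_component limit).
apply: emeasurable_funD; first exact: (mE None).
by apply: ge0_emeasurable_sum => // k _; exact: (mE (Some k)).
Qed.

Lemma collision_process_homo w s t : 0 <= s -> s <= t ->
  (collision_process B Bs s w <= collision_process B Bs t w)%E.
Proof.
move=> s0 st; apply: leeD.
  by rewrite lee_fin ler_nat; exact: (counting_component limit None w).1.
apply: lee_nneseries => i _; first by rewrite lee_fin ler0n.
by rewrite lee_fin ler_nat; exact: (counting_component limit (Some i) w).1.
Qed.

Lemma measurable_arrival_time k :
  measurable_fun setT (fun w => fine (arrival_time (collision_process B Bs) k w)).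
Proof.
apply: measurable_fine_time => u.
rewrite (_ : [set w | _] = \bigcup_(i : nat) \bigcup_(j in [set j : nat | i%:R / j.+1%:R < u])
    [set w | ((k%:R : R)%:E <= collision_process B Bs (i%:R / j.+1%:R) w)%E]).
  apply: bigcupT_measurable => i; apply: bigcup_measurable => j _.
  rewrite -[X in measurable X]setTI; apply: emeasurable_fun_c_infty => //.
  by apply: measurable_collision_process; rewrite divr_ge0.
apply/seteqP; split => w /=.
  move=> /ereal_inf_lt [_ [t [t0 tk] <-]] tu; have [i [j [tij iju]]] := grid_between t0 tu.
  exists i => //; exists j; first by rewrite lte_fin in iju.
  by apply: le_trans tk _; exact: collision_process_homo.
move=> [i _ [j iju ijk]]; apply: (@le_lt_trans _ _ (i%:R / j.+1%:R : R)%:E); last by rewrite lte_fin.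
by apply: ereal_inf_lbound; exists (i%:R / j.+1%:R) => //; split=> //; rewrite divr_ge0.
Qed.

End MeasurableTimes.

Section MainConvergence.
Context {R : realType} {q : nat}.
Hypothesis hq : (2 <= q)%N.
Variables (p : nat -> nat -> R) (psi : nat -> R).
Hypothesis p_ge0 : forall N i, 0 <= p N i.
Hypothesis p_noninc : forall N i, p N i.+1 <= p N i.
Hypothesis p_sum : forall N, series (p N) @ \oo --> (1 : R).
Hypothesis p_first : (fun N => p N 0%N) @ \oo --> (0 : R).
Hypothesis psi_lim : forall i, (fun N => p N i / l2_norm (p N)) @ \oo --> psi i.
Context (d : nat -> measure_display) (Omega : forall N, measurableType (d N)).
Variables (P : forall N, probability (Omega N) R)
  (C : forall N, nat -> Omega N -> 'I_q) (Z : forall N, nat -> Omega N -> nat).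
Hypothesis urns : forall N, urn_model (@C N) (@Z N) (P N) (p N).
Context (d' : measure_display) (Omega' : measurableType d').
Variables (Q : probability Omega' R) (B : R -> Omega' -> nat) (Bs : nat -> 'I_q -> R -> Omega' -> nat).
Hypothesis limit : limit_model Q psi B Bs.

Let psi0 := psi_ge0 p_ge0 p_noninc p_sum psi_lim.
Let psi_cvg := @cvg_psi_sqr R p psi p_ge0 p_noninc p_sum psi_lim.
Let psi_lim1 := psi_sqr_lim_le1 p_ge0 p_noninc p_sum psi_lim.
Let s N := l2_norm (p N).
Let s_gt0 N : 0 < s N. Proof. exact: (l2_norm_gt0 (p_ge0 N) (p_noninc N) (@p_sum N)). Qed.
Local Notation count := (count_process B Bs).

Section Mesh.
Variable delta : R.
Hypothesis delta01 : 0 < delta <= 1.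

(** The successor keeps the blocks nonempty and makes their rescaled length at least [delta]. *)
Definition block_length N : nat := (Num.truncn (delta / s N)).+1.

Lemma block_length_cvg : (fun N => (block_length N)%:R * s N) @ \oo --> delta.
Proof.
have /andP[d0 _] := delta01.
apply: (squeeze_cvgr (f := fun=> delta) (h := fun N => delta + s N)); last 2 first.
- exact: cvg_cst.
- rewrite -[X in _ --> X]addr0; apply: cvgD; first exact: cvg_cst.
  exact: (@cvg_l2_norm0 R p p_ge0 p_noninc p_sum p_first).
apply: nearW => N; have ds : 0 <= delta / s N by rewrite divr_ge0 ?ltW.
apply/andP; split; first by rewrite -ler_pdivrMr// ltW// truncnS_gt.
rewrite /block_length -natr1 mulrDl mul1r lerD2r -ler_pdivlMr//.
by rewrite truncn_le.
Qed.

Let c N v (j : nat) := ncollisions (@C N) (@Z N) (j * block_length N) v.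
Let c' v (j : nat) := count (j%:R * delta) v.

Lemma discrete_urn_incr N j : discrete_rv (fun v => block_incr (@c N v) 1 j).
Proof.
exact: (discrete_sub (discrete_ncollisions (urns N) _) (discrete_ncollisions (urns N) _)).
Qed.

Lemma discrete_limit_incr j : discrete_rv (fun v => block_incr (c' v) 1 j).
Proof.
have /andP[d0 _] := delta01.
by apply: discrete_grid_incr => // t t0; exact: (discrete_count limit).
Qed.

Lemma block_law_cvg J (ds : nat -> nat) :
  (fun N => \int[P N]_v \prod_(j < J) (block_incr (@c N v) 1 j == ds j)%:R) @ \oo -->
  \int[Q]_v \prod_(j < J) (block_incr (c' v) 1 j == ds j)%:R.
Proof.
have qi0 := @qi_gt0 R q hq; have qi1 := @qi_lt1 R q hq; have /andP[d0 d1] := delta01.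
(* The bound [c] is 1/q: all variables stay below the excluded value. *)
apply: (@multi_coeff_cvg R d Omega P d' Omega' Q (fun N j v => block_incr (@c N v) 1 j) (fun j v => block_incr (c' v) 1 j) J q%:R^-1).
- by rewrite qi0 ltW.
- by move=> N j; exact: discrete_urn_incr.
- exact: discrete_limit_incr.
move=> xs xsP; pose ys := mkseq xs J.
have ysP y : y \in ys -> 0 <= y <= 1 /\ y != q%:R^-1.
  move=> /mapP[j _ ->]; have /andP[a b] := xsP j; split; last by rewrite lt_eqF.
  by rewrite ltW//= ltW// (lt_trans b).
have yE (F : nat -> nat) w : \prod_(j < J) xs j ^+ block_incr F w j = pow ys (block_incrs F w (size ys)).
  rewrite pow_block_incrsE size_mkseq big_iota_ord; apply: eq_bigr => j _.
  by rewrite nth_mkseq.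
have [L' [cL' cu]] := @draw_blocks_limit R q hq p psi p_ge0 p_noninc p_sum p_first psi_lim block_length delta ys delta01 block_length_cvg (fun N => ltn0Sn _) ysP.
rewrite (_ : \int[Q]_w _ = \int[Q]_w pow ys (block_incrs (c' w) 1 (size ys))); last first.
  by apply: eq_Rintegral => w _; exact: yE.
rewrite (@count_gf _ _ _ _ hq Q psi B Bs limit psi0 psi_cvg psi_lim1 delta ys L' d0 ysP cL').
apply: cu => N; have ys01 y : y \in ys -> 0 <= y <= 1 by move=> /ysP[].
have := @urn_gf _ _ _ _ hq (P N) (p N) (@C N) (@Z N) (urns N) (block_length N) ys ys01.
rewrite (_ : \int[P N]_v _ = \int[P N]_w \prod_(j < J) xs j ^+ block_incr (@c N w) 1 j)//.
by apply: eq_Rintegral => w _; rewrite -yE; apply: eq_bigr => j _; rewrite /block_incr !muln1.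
Qed.

(** [h] vanishes outside finitely many patterns, so its expectation is a finite combination of the
    probabilities in [block_law_cvg]. *)
Lemma pattern_cvg J L m (phi : (nat -> nat) -> R) :
  (forall D D', (forall j, (j < J)%N -> D j = D' j) -> phi D = phi D') ->
  let h (D : nat -> nat) := if (m <= \sum_(j < J) D j <= L)%N then phi D else 0 in
  [/\ forall N, bmf (fun v => h (block_incr (@c N v) 1)), bmf (fun v => h (block_incr (c' v) 1)) &
   (fun N => \int[P N]_v h (block_incr (@c N v) 1)) @ \oo --> \int[Q]_v h (block_incr (c' v) 1)].
Proof.
move=> phiP h.
have hE D : h D = \sum_(ds <- patterns J L m) phi ds * \prod_(j < J) (D j == ds j)%:R.
  by rewrite pattern_sum// => D'; exact: phiP.
have bI (dT : measure_display) (T : measurableType dT) (F : nat -> T -> nat) (ds : nat -> nat) :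
    (forall j, discrete_rv (F j)) -> bmf (fun v => \prod_(j < J) (F j v == ds j)%:R : R).
  move=> dF; apply: bmf_prod => j; apply: (bmf_discrete (V := F j) (g := fun i => (i == ds j)%:R)) => //.
  by exists 1 => v; case: (_ == _); rewrite ?normr1 ?normr0.
have bS (dT : measure_display) (T : measurableType dT) (F : nat -> T -> nat) :
    (forall j, discrete_rv (F j)) -> bmf (fun v => h (F ^~ v)).
  move=> dF; under eq_fun do rewrite hE.
  by apply: bmf_sum => ds; apply: bmfM; [exact: bmf_cst|exact: bI].
have ES (dT : measure_display) (T : measurableType dT) (S : probability T R) (F : nat -> T -> nat) :
    (forall j, discrete_rv (F j)) -> \int[S]_v h (F ^~ v) =
    \sum_(ds <- patterns J L m) phi ds * \int[S]_v \prod_(j < J) (F j v == ds j)%:R.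
  move=> dF; under eq_Rintegral do rewrite hE.
  rewrite Ex_sum; last by move=> ds; apply: bmfM; [exact: bmf_cst|exact: bI].
  by apply: eq_bigr => ds _; rewrite ExZ//; exact: bI.
split.
- by move=> N; apply: (bS _ _ (fun j v => block_incr (@c N v) 1 j)) => j; exact: discrete_urn_incr.
- by apply: (bS _ _ (fun j v => block_incr (c' v) 1 j)) => j; exact: discrete_limit_incr.
rewrite (ES _ _ Q (fun j v => block_incr (c' v) 1 j)); last exact: discrete_limit_incr.
under eq_fun => N do rewrite (ES _ _ (P N) (fun j v => block_incr (@c N v) 1 j) (discrete_urn_incr N)).
apply: cvg_big => [|ds _]; first exact: (@add_continuous).
by apply: cvgMl_tmp; exact: block_law_cvg.
Qed.

End Mesh.

(** On the event that the first [n.+1] units of time contain between [m] and [L] points, [f] is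
    close to a function of the block counts. The limit process satisfies it with high probability,
    and then so do the urns, because the probability of this event converges too. *)
Lemma law_cvg m (f : 'rV[R]_m -> R) (M : R) : continuous f -> (forall x, `|f x| <= M) ->
  [/\ forall N, bmf (fun w => f (\row_(k < m) (s N * fine (collision_time (@C N) (@Z N) k.+1 w)))),
    bmf (fun w => f (\row_(k < m) fine (arrival_time (collision_process B Bs) k.+1 w))) &
    (fun N => \int[P N]_w f (\row_(k < m) (s N * fine (collision_time (@C N) (@Z N) k.+1 w)))) @ \oo -->
    \int[Q]_w f (\row_(k < m) fine (arrival_time (collision_process B Bs) k.+1 w))].
Proof.
move=> cf fM.
have bX N : bmf (fun w => f (\row_(k < m) (s N * fine (collision_time (@C N) (@Z N) k.+1 w)))).
  split; last by exists M => w.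
  apply: (measurable_row_fun (Y := fun k w => s N * fine (collision_time (@C N) (@Z N) k.+1 w))) => // k.
  by apply: measurable_funM; [exact: measurable_cst|exact: (measurable_collision_time _ (urns N))].
have bY : bmf (fun w => f (\row_(k < m) fine (arrival_time (collision_process B Bs) k.+1 w))).
  split; last by exists M => w.
  by apply: (measurable_row_fun (Y := fun k w => fine (arrival_time (collision_process B Bs) k.+1 w))) => // k; exact: (measurable_arrival_time limit).
split=> //; apply: dist_cvgn => e e0.
pose M' := `|M| + 1; have M'0 : 0 < M' by rewrite ltr_wpDl.
have fM' x : `|f x| <= M' by apply: le_trans (fM x) _; rewrite /M'; have := ler_norm M; lra.
(* The total error will be at most [3 e / 8] for the approximations and the convergence, plus
   [2 e / 16] and [3 e / 16] for the exceptional events of the limit and of the urns. *)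
pose eta := e / (16%:R * M'); have eta0 : 0 < eta by rewrite divr_gt0// mulr_gt0.
have eta_e : M' * eta = e / 16%:R by rewrite /eta; field; rewrite gt_eqF.
have reg_ae := regular_limit_ae hq limit psi0 psi_cvg.
have [n hn] : exists n : nat, fine (Q [set w | ~ (m <= count n.+1%:R w)%N]) < eta.
  have mA n : measurable [set w | ~ (m <= count n.+1%:R w)%N].
    exact: (discrete_preimage [set k | ~ (m <= k)%N] (discrete_count limit _)).
  have c0 : (fun n : nat => fine (Q [set w | ~ (m <= count n.+1%:R w)%N])) @ \oo --> (0 : R).
    apply: Pr_cvg0 => //.
    apply: filterS2 reg_ae (count_unbounded hq limit psi0 psi_cvg psi_lim1) => w reg /(_ m)[n hn].
    exists n => n' nn'; apply; apply: leq_trans hn _.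
    by apply: (counting_count limit reg).1 => //; rewrite ler_nat ltnW.
  have [n hn] := cvgn_dist c0 eta0; exists n.
  by have := hn n (leqnn n); rewrite sub0r normrN ger0_norm ?Pr_ge0.
have [L hL] : exists L : nat, fine (Q [set w | ~ (count n.+1%:R w <= L)%N]) < eta.
  have c0 : (fun l : nat => fine (Q [set w | ~ (count n.+1%:R w <= l)%N])) @ \oo --> (0 : R).
    apply: Pr_cvg0; first by move=> l; exact: (discrete_preimage [set k | ~ (k <= l)%N] (discrete_count limit _)).
    by apply: aeW => w; exists (count n.+1%:R w) => l nl; apply.
  have [l hl] := cvgn_dist c0 eta0; exists l.
  by have := hl l (leqnn l); rewrite sub0r normrN ger0_norm ?Pr_ge0.
have e8 : 0 < e / 8%:R by rewrite divr_gt0.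
have [r r0 fr] := unif_continuous_box n.+1%:R cf e8.
have [K hK] : exists K : nat, 2%:R * (K.+1%:R)^-1 <= r.
  have [K hK] := cvgn_dist (@cvg_natS_inv R) (divr_gt0 r0 (ltr0n R 2)); exists K.
  by have := hK K (leqnn K); rewrite sub0r normrN ger0_norm ?invr_ge0// => /ltW; rewrite ler_pdivlMr// mulrC.
pose delta : R := (K.+1%:R)^-1; pose J := (n.+1 * K.+1)%N.
have d0 : 0 < delta by rewrite invr_gt0.
have delta01 : 0 < delta <= 1 by rewrite d0 invf_le1// ler1n.
have dJ : delta * J%:R = n.+1%:R by rewrite mulrC natrM mulfK// pnatr_eq0.
pose DN N v := block_incr (fun j => ncollisions (@C N) (@Z N) (j * block_length delta N) v) 1.
pose DQ v := block_incr (fun j => count (j%:R * delta) v) 1.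
pose phi := lattice_value f delta J.
have phiP D D' : (forall j, (j < J)%N -> D j = D' j) -> phi D = phi D' by exact: lattice_value_ext.
have [b1N b1Q c1] := pattern_cvg delta01 L m phiP.
have [b2N b2Q c2] := @pattern_cvg delta delta01 J L m (fun=> 1) (fun _ _ _ => erefl).
(* For [ph = 1] this is the indicator of the good event. *)
pose h (ph : (nat -> nat) -> R) (D : nat -> nat) := if (m <= \sum_(j < J) D j <= L)%N then ph D else 0.
rewrite -/(h phi) in b1N b1Q c1; rewrite -/(h (fun=> 1)) in b2N b2Q c2.
have badE dT (T : measurableType dT) (S : probability T R) (D : T -> nat -> nat) :
    bmf (fun v => h (fun=> 1) (D v)) -> let A := [set v | h (fun=> 1) (D v) = 0] in
    measurable A /\ fine (S A) = 1 - \int[S]_v h (fun=> 1) (D v).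
  move=> bD A; have mA : measurable A.
    by have [mD _] := bD; rewrite -[X in measurable X]setTI; exact: (mD measurableT [set 0] (measurable_set1 0)).
  split=> //; rewrite -(Ex_indic S mA) -[X in _ = X - _](Ex_cst S 1) -ExB//; last exact: bmf_cst.
  apply: eq_Rintegral => v _; rewrite indicE; have [Av|nA] := pselect (A v).
    by rewrite mem_set// Av subr0.
  by rewrite memNset//; move: nA; rewrite /A /= /h; case: ifP => // _ _; rewrite subrr.
have close dT (T : measurableType dT) (S : probability T R) (X : T -> R) (D : T -> nat -> nat) :
    bmf X -> (forall v, `|X v| <= M') -> bmf (fun v => h phi (D v)) -> bmf (fun v => h (fun=> 1) (D v)) ->
    {ae S, forall v, (m <= \sum_(j < J) D v j)%N -> `|X v - phi (D v)| <= e / 8%:R} ->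
    `|\int[S]_v X v - \int[S]_v h phi (D v)| <= e / 8%:R + M' * (1 - \int[S]_v h (fun=> 1) (D v)).
  move=> bX' XM bD1 bD2 cl; have [mA <-] := badE _ _ S D bD2.
  apply: Ex_close_ae => //; apply: filterS cl => v cl; rewrite indicE /h.
  case: ifPn => [gD|nD].
    have /andP[mD _] := gD; rewrite memNset; first by rewrite mulr0 addr0; exact: cl.
    by rewrite /= gD; apply/eqP; exact: oner_neq0.
  by rewrite mem_set; [|by rewrite /= (negbTE nD)]; rewrite mulr1 subr0; apply: le_trans (XM v) _; rewrite lerDr ltW.
have mono N v : {homo (fun j : nat => ncollisions (@C N) (@Z N) (j * block_length delta N) v) : i j / (i <= j)%N}.
  by move=> i j ij; apply: ncollisions_homo; rewrite leq_mul2r ij orbT.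
have closeQ : `|\int[Q]_w f (\row_(k < m) fine (arrival_time (collision_process B Bs) k.+1 w)) -
    \int[Q]_v h phi (DQ v)| <= e / 8%:R + M' * (1 - \int[Q]_v h (fun=> 1) (DQ v)).
  apply: close => //; apply: filterS reg_ae => v reg mD.
  (* [lattice_valueP] expects rescaled times [s * tau]; here [s = 1]. *)
  rewrite (_ : \row_k _ = \row_(k < m) (1 * fine (arrival_time (collision_process B Bs) k.+1 v))); last first.
    by apply/matrixP => i k; rewrite !mxE mul1r.
  have hc : {homo (fun j : nat => count (j%:R * delta) v) : i j / (i <= j)%N}.
    move=> i j ij; apply: (counting_count limit reg).1; first by rewrite mulr_ge0// ltW.
    by rewrite ler_wpM2r ?ler_nat// ltW.
  have c0 : count (0%:R * delta) v = 0%N by rewrite mul0r; exact: (count_process0 limit reg).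
  have mJ : (m <= count (J%:R * delta) v)%N by move: mD; rewrite /DQ sum_block_incr// c0 subn0.
  have fin k : (k < m)%N -> exists2 tau : R, 0 <= tau & arrival_time (collision_process B Bs) k.+1 v = tau%:E.
    move=> km; have [|tau /andP[t0 _] tE] := arrival_time_fin limit reg (mulr_ge0 (ler0n R J) (ltW d0)) (k := k.+1).
      exact: leq_trans mJ.
    by exists tau.
  apply/ltW; apply: (lattice_valueP fr d0 hK (u := delta) _ (tau := fun k => fine (arrival_time (collision_process B Bs) k.+1 v)) hc c0 mD ler01).
  - by rewrite dJ.
  - by rewrite mul1r subrr normr0 mul0r.
  - by move=> k km; have [tau t0 ->] := fin k km.
  move=> k km j; have [tau t0 tE] := fin k km.
  have := arrival_timeP limit k.+1 reg (mulr_ge0 (ler0n R j) (ltW d0)).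
  by rewrite tE lee_fin.
have closeN N : `|delta - s N * (block_length delta N)%:R| * J%:R < delta ->
    `|\int[P N]_w f (\row_(k < m) (s N * fine (collision_time (@C N) (@Z N) k.+1 w))) -
    \int[P N]_v h phi (DN N v)| <= e / 8%:R + M' * (1 - \int[P N]_v h (fun=> 1) (DN N v)).
  move=> su; apply: close => //; apply: aeW => v mD.
  have c0 : ncollisions (@C N) (@Z N) (0 * block_length delta N) v = 0%N by rewrite mul0n /ncollisions big_ord0.
  have mJ : (m <= ncollisions (@C N) (@Z N) (J * block_length delta N) v)%N.
    by move: mD; rewrite /DN sum_block_incr ?c0 ?subn0//; exact: mono.
  have fin k : (k < m)%N -> exists k' : nat, collision_time (@C N) (@Z N) k.+1 v = (k'%:R : R)%:E /\
      forall n, (k' <= n)%N = (k.+1 <= ncollisions (@C N) (@Z N) n v)%N.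
    by move=> km; apply: (@collision_timeE _ _ R _ hq _ _ _ _ _ (leq_trans km mJ)).
  apply/ltW; apply: (lattice_valueP fr d0 hK (u := (block_length delta N)%:R) _ (tau := fun k => fine (collision_time (@C N) (@Z N) k.+1 v)) (mono N v) c0 mD (ltW (s_gt0 N)) su).
  - by rewrite dJ.
  - by move=> k km; have [k' [-> _]] := fin k km.
  move=> k km j; have [k' [-> k'E]] := fin k km.
  by rewrite /= -natrM ler_nat k'E.
have badQ : 1 - \int[Q]_v h (fun=> 1) (DQ v) <= 2%:R * eta.
  have [mA <-] := badE _ _ Q DQ b2Q.
  have mA1 : measurable [set w | ~ (m <= count n.+1%:R w)%N].
    exact: (discrete_preimage [set k | ~ (m <= k)%N] (discrete_count limit _)).
  have mA2 : measurable [set w | ~ (count n.+1%:R w <= L)%N].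
    exact: (discrete_preimage [set k | ~ (k <= L)%N] (discrete_count limit _)).
  apply: (@le_trans _ _ (fine (Q [set w | ~ (m <= count n.+1%:R w)%N]) + fine (Q [set w | ~ (count n.+1%:R w <= L)%N]))).
    rewrite -!Ex_indic// -ExD; [|exact: bmf_indic|exact: bmf_indic].
    apply: Ex_le_ae; [exact: bmf_indic|by apply: bmfD; exact: bmf_indic|].
    apply: filterS reg_ae => v reg; rewrite !indicE.
    have hc : {homo (fun j : nat => count (j%:R * delta) v) : i j / (i <= j)%N}.
      move=> i j ij; apply: (counting_count limit reg).1; first by rewrite mulr_ge0// ltW.
      by rewrite ler_wpM2r ?ler_nat// ltW.
    have [Av|nA] := pselect (h (fun=> 1) (DQ v) = 0); last by rewrite memNset// addr_ge0.
    rewrite mem_set//; move: Av; rewrite /h /DQ sum_block_incr// mul0r (count_process0 limit reg) subn0.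
    rewrite [J%:R * delta]mulrC dJ; case: ifP => [_ /eqP|]; first by rewrite oner_eq0.
    case: (leqP m (count n.+1%:R v)) => [le1 /= nL _|lt1 _ _].
      rewrite (@mem_set _ [set w | ~ (count n.+1%:R w <= L)%N]); last by move=> /=; rewrite nL.
      by rewrite lerDr.
    rewrite (@mem_set _ [set w | ~ (m <= count n.+1%:R w)%N]); last by apply/negP; rewrite -ltnNge.
    by rewrite lerDl.
  by have := ltW hn; have := ltW hL; lra.
have cs : (fun N => (block_length delta N)%:R * s N) @ \oo --> delta by exact: block_length_cvg.
have dJ0 : 0 < delta / J.+1%:R by rewrite divr_gt0.
have [N0 hN0] := cvgn_dist cs dJ0.
have [N1 hN1] := cvgn_dist c1 e8.
have [N2 hN2] := cvgn_dist c2 eta0.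
exists (maxn N0 (maxn N1 N2)) => N; rewrite !geq_max => /and3P[NN0 NN1 NN2].
have su : `|delta - s N * (block_length delta N)%:R| * J%:R < delta.
  have := hN0 N NN0; rewrite mulrC ltr_pdivlMr ?ltr0n// => h0; apply: le_lt_trans h0.
  by rewrite ler_wpM2l ?normr_ge0// ler_nat.
have := closeN N su; have := hN1 N NN1; have := hN2 N NN2; move: closeQ badQ.
rewrite -/(DN _) -/DQ.
set aQ := \int[Q]_w f _; set aN := \int[P N]_w f _.
set q1 := \int[Q]_v h phi _; set n1 := \int[P N]_v h phi _.
set q2 := \int[Q]_v h (fun=> 1) _; set n2 := \int[P N]_v h (fun=> 1) _.
rewrite !ler_norml !ltr_norml => /andP[i1 i2] i3 /andP[i4 i5] /andP[i6 i7] /andP[i8 i9].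
have j1 : M' * (1 - q2) <= 2%:R * (e / 16%:R) by rewrite -eta_e mulrCA; apply: ler_wpM2l => //; exact: ltW.
have j2 : M' * (1 - n2) <= 3%:R * (e / 16%:R).
  by rewrite -eta_e mulrCA; apply: ler_wpM2l; [exact: ltW|lra].
by apply/andP; split; lra.
Qed.
End MainConvergence.

Theorem theorem1p2 (R : realType) (q : nat) (hq : (2 <= q)%N)
    (p : nat -> nat -> R) (psi : nat -> R)
    (p_ge0 : forall N i, 0 <= p N i)
    (p_noninc : forall N i, p N i.+1 <= p N i)
    (p_sum : forall N, series (p N) @ \oo --> (1 : R))
    (p_first : (fun N => p N 0%N) @ \oo --> (0 : R))
    (psi_lim : forall i, (fun N => p N i / l2_norm (p N)) @ \oo --> psi i)
    (d : nat -> measure_display) (Omega : forall N, measurableType (d N))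
    (P : forall N, probability (Omega N) R)
    (C : forall N, nat -> Omega N -> 'I_q) (Z : forall N, nat -> Omega N -> nat)
    (urns : forall N, urn_model (C N) (Z N) (P N) (p N))
    (d' : measure_display) (Omega' : measurableType d')
    (Q : probability Omega' R)
    (B : R -> Omega' -> nat) (Bs : nat -> 'I_q -> R -> Omega' -> nat)
    (limit : limit_model Q psi B Bs) :
  let T N m : Omega N -> \bar R := collision_time (C N) (Z N) m in
  let eta k : Omega' -> \bar R := arrival_time (collision_process B Bs) k in
  [/\ forall N m, {ae P N, forall w, T N m.+1 w \is a fin_num},
      {ae Q, forall w, (0 < eta 1%N w)%E /\ forall k, (eta k.+1 w < eta k.+2 w < +oo)%E}
    & forall m, (1 <= m)%N ->
        cvg_in_law P
          (fun N w => \row_(k < m) (l2_norm (p N) * fine (T N k.+1 w)))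
          Q (fun w => \row_(k < m) fine (eta k.+1 w))].
Proof.
have psi0 := psi_ge0 p_ge0 p_noninc p_sum psi_lim.
have psi1 := psi_le1 p_ge0 p_noninc p_sum psi_lim.
have psi_cvg := @cvg_psi_sqr R p psi p_ge0 p_noninc p_sum psi_lim.
have psi_lim1 := psi_sqr_lim_le1 p_ge0 p_noninc p_sum psi_lim.
move=> T eta; split.
- move=> N m; have := collision_time_fin_num hq (urns N) (p_ge0 N) (p_noninc N) (@p_sum N).
  by apply: filterS => w; apply.
- exact: (arrival_times_ae hq limit psi0 psi1 psi_cvg psi_lim1).
- move=> m _ f cf [M fM].
  have [bX bY cXY] := law_cvg hq p_ge0 p_noninc p_sum p_first psi_lim urns limit cf fM.
  rewrite (expectationE Q bY).
  rewrite (_ : (fun N => _) = fun N => (\int[P N]_w f (\row_(k < m) (l2_norm (p N) * fine (T N k.+1 w))))%:E).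
    by apply: cvg_EFin; [exact: nearW|exact: cXY].
  by apply/funext => N; rewrite (expectationE (P N) (bX N)).
Qed.
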